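(* The counting version of \textsc{Linked Planar 3-SAT}, i.e., computing the number of satisfying assignments of $\phi$ for a given instance $(\phi, G_\phi, \kappa)$, is \#P-complete.
   Context: A CNF formula $\phi$ has variable set $V$ and clause set $C$. Its incidence graph $G_\phi$ has vertex set $C \cup V$ and an edge between a variable $v$ and a clause $c$ if and only if $v$ occurs in $c$ (negated or unnegated); there are no other edges. A 3-SAT formula is a CNF formula in which every clause contains at most three variables. An instance of \textsc{Linked Planar 3-SAT} consists of a 3-SAT formula $\phi$, its incidence graph $G_\phi = (C\cup V, E)$, and a Hamiltonian cycle $\kappa$ on $C \cup V$ that first visits all elements of $C$ and then all elements of $V$, such that the union of $G_\phi$ and $\kappa$ is a planar graph. *)

(* Defs.v *)
From HB Require Import structures.
From mathcomp Require Import all_boot all_order all_algebra.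
From mathcomp Require Import all_classical all_reals all_analysis.

Set Implicit Arguments.
Unset Strict Implicit.
Unset Printing Implicit Defensive.

Import Order.TTheory GRing.Theory Num.Theory.
Import numFieldNormedType.Exports.

Local Open Scope nat_scope.

(** * Deterministic multitape Turing machines, with an optional oracle

    Tape symbols are blank ([None]), a bit, or one of finitely many work
    symbols.  A tape is two-way infinite and is stored as
    [(left part, reversed ; right part)]; the head scans the first symbol of
    the right part, and all cells beyond the stored ones are blank. *)

Definition symbol (G : finType) : finType := option (bool + G).

Definition bit (G : finType) (b : bool) : symbol G := Some (inl b).

Inductive direction := GoLeft | Stay | GoRight.

Definition tape (G : finType) : Type := seq (symbol G) * seq (symbol G).

Definition scanned (G : finType) (t : tape G) : symbol G := head None t.2.

Definition write_move (G : finType) (a : symbol G) (d : direction)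
    (t : tape G) : tape G :=
  let r := a :: behead t.2 in
  match d with
  | GoLeft => (behead t.1, head None t.1 :: r)
  | Stay => (t.1, r)
  | GoRight => (a :: t.1, behead t.2)
  end.

Definition tape_of_word (G : finType) (w : seq bool) : tape G :=
  ([::], map (@bit G) w).

Fixpoint leading_bits (G : finType) (s : seq (symbol G)) : seq bool :=
  if s is Some (inl b) :: s' then b :: leading_bits s' else [::].

(** The word on a tape starts at the head and ends before the first symbol
    that is not a bit. *)
Definition word_of_tape (G : finType) (t : tape G) : seq bool :=
  leading_bits t.2.

(** Tape 0 is the input tape, tape 1 the output tape and tape 2 the oracle
    tape; [delta] undefined means that the machine halts.  A state [q] with
    [query q = Some q'] is a query state. *)
Record machine := Machine {
  work_symbol : finType;
  extra_tapes : nat;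
  state : finType;
  start : state;
  query : state -> option state;
  delta : state -> {ffun 'I_extra_tapes.+3 -> symbol work_symbol} ->
          option (state *
                  ('I_extra_tapes.+3 -> symbol work_symbol * direction))
}.

Definition input_tape (M : machine) : 'I_(extra_tapes M).+3 := inord 0.
Definition output_tape (M : machine) : 'I_(extra_tapes M).+3 := inord 1.
Definition oracle_tape (M : machine) : 'I_(extra_tapes M).+3 := inord 2.

Definition config (M : machine) : Type :=
  state M * ('I_(extra_tapes M).+3 -> tape (work_symbol M)).

Definition init_config (M : machine) (x : seq bool) : config M :=
  (start M,
   fun i => if i == input_tape M then tape_of_word _ x
            else tape_of_word _ [::]).

(** A query replaces, in one step, the content [w] of the oracle tape by
    [O w]. *)
Definition step (M : machine) (O : seq bool -> seq bool) (c : config M) :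
    option (config M) :=
  match query c.1 with
  | Some q =>
      Some (q, fun i => if i == oracle_tape M
                        then tape_of_word _ (O (word_of_tape (c.2 i)))
                        else c.2 i)
  | None =>
      match delta c.1 [ffun i => scanned (c.2 i)] with
      | Some (q, act) =>
          Some (q, fun i => write_move (act i).1 (act i).2 (c.2 i))
      | None => None
      end
  end.

Definition run (M : machine) (O : seq bool -> seq bool) (t : nat)
    (c : config M) : config M :=
  iter t (fun c => odflt c (step O c)) c.

Definition computes_in_time (M : machine) (O : seq bool -> seq bool)
    (f : seq bool -> seq bool) (T : nat -> nat) : Prop :=
  forall x : seq bool,
    let c := run O (T (size x)) (init_config M x) in
    step O c = None /\ word_of_tape (c.2 (output_tape M)) = f x.

Definition poly_bound (p : {poly nat}) (n : nat) : nat := p.[n]%R.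

(** [f] belongs to FP^O. *)
Definition in_FP_oracle (O f : seq bool -> seq bool) : Prop :=
  exists (M : machine) (p : {poly nat}),
    computes_in_time M O f (poly_bound p).

(** [f] belongs to FP: the machine has no query state, so the (dummy) oracle
    is irrelevant. *)
Definition in_FP (f : seq bool -> seq bool) : Prop :=
  exists (M : machine) (p : {poly nat}),
    (forall q : state M, query q = None) /\
    computes_in_time M id f (poly_bound p).

Definition in_P (V : seq bool -> bool) : Prop := in_FP (fun z => [:: V z]).

(** * The class #P and completeness *)

Definition pair_word (x y : seq bool) : seq bool :=
  flatten [seq [:: true; b] | b <- x] ++ false :: y.

Definition in_sharpP (f : seq bool -> nat) : Prop :=
  exists (V : seq bool -> bool) (p : {poly nat}),
    in_P V /\
    forall x : seq bool,
      f x = #|[set y : (poly_bound p (size x)).-tuple bool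
                 | V (pair_word x y)]|%SET.

(** Binary representation, least significant bit first, [[::]] for 0. *)
Fixpoint binary_rec (fuel n : nat) : seq bool :=
  match fuel, n with
  | k.+1, _.+1 => odd n :: binary_rec k n./2
  | _, _ => [::]
  end.
Definition binary (n : nat) : seq bool := binary_rec n n.

(** Hardness is with respect to polynomial-time Turing reductions. *)
Definition sharpP_hard (f : seq bool -> nat) : Prop :=
  forall g : seq bool -> nat,
    in_sharpP g ->
    in_FP_oracle (fun w => binary (f w)) (fun w => binary (g w)).

Definition sharpP_complete (f : seq bool -> nat) : Prop :=
  in_sharpP f /\ sharpP_hard f.

(** * Planar graphs *)

(** [e] is meant to be symmetric and irreflexive.  [pos] places the vertices
    and [arc x y], restricted to [0, 1], is a simple arc drawing the edge
    [xy] from [pos x] to [pos y]; [arc y x] is the same arc reversed. *)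
Definition planar (R : realType) (T : finType) (e : rel T) : Prop :=
  exists (pos : T -> R * R) (arc : T -> T -> R -> R * R),
    [/\ injective pos,
        forall x y, e x y ->
          [/\ {within `[0%R, 1%R], continuous (arc x y)}%classic,
              {in `[0, 1]%R &, injective (arc x y)},
              arc x y 0%R = pos x,
              arc x y 1%R = pos y &
              {in `[0, 1]%R, forall t, arc y x t = arc x y (1 - t)%R}],
        forall x y z, e x y ->
          {in `]0, 1[%R, forall t, arc x y t <> pos z} &
        forall x y x' y', e x y -> e x' y' ->
          {in `]0, 1[%R &, forall t t',
             arc x y t = arc x' y' t' -> [set x; y]%SET = [set x'; y']%SET}].

(** * Linked Planar 3-SAT *)

(** The literal [(v, true)] is the variable [v], and [(v, false)] its
    negation. *)
Definition literal (n : nat) : finType := ('I_n * bool)%type.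

(** A CNF formula with variable set ['I_nvars], whose clauses, as sets of
    literals, are listed by [clause]. *)
Record cnf := Cnf {
  nvars : nat;
  nclauses : nat;
  clause : {ffun 'I_nclauses -> {set literal nvars}}
}.

Definition occurs (phi : cnf) (v : 'I_(nvars phi)) (c : 'I_(nclauses phi)) :
    bool := [exists b : bool, (v, b) \in clause phi c].

(** The listing of the clause set has no repetitions, and each clause
    contains at most three variables. *)
Definition is_3SAT (phi : cnf) : Prop :=
  injective (clause phi) /\
  forall c : 'I_(nclauses phi), #|[set v | occurs v c]%SET| <= 3.

Definition satisfies (phi : cnf) (a : {ffun 'I_(nvars phi) -> bool}) : bool :=
  [forall c : 'I_(nclauses phi),
     exists l : literal (nvars phi), (l \in clause phi c) && (a l.1 == l.2)].

Definition nb_satisfying (phi : cnf) : nat :=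
  #|[set a : {ffun 'I_(nvars phi) -> bool} | satisfies a]%SET|.

Definition vertex (phi : cnf) : finType :=
  ('I_(nclauses phi) + 'I_(nvars phi))%type.

(** A candidate instance: a formula, a bipartite graph between clauses and
    variables, and a list of vertices. *)
Record instance := Instance {
  formula : cnf;
  edges : {set 'I_(nclauses formula) * 'I_(nvars formula)};
  cycle_seq : seq (vertex formula)
}.

Definition incidence_edges (phi : cnf) :
    {set 'I_(nclauses phi) * 'I_(nvars phi)} :=
  [set cv | occurs cv.2 cv.1]%SET.

Definition graph_adj (phi : cnf)
    (E : {set 'I_(nclauses phi) * 'I_(nvars phi)}) : rel (vertex phi) :=
  fun x y =>
    match x, y with
    | inl c, inr v | inr v, inl c => (c, v) \in E
    | _, _ => false
    end.

Definition cycle_adj (T : eqType) (s : seq T) : rel T :=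
  fun x y => [&& x \in s, y \in s & (next s x == y) || (next s y == x)].

(** [s] lists the vertices of a cycle (hence at least three of them) through
    all elements of [T]. *)
Definition hamiltonian_cycle (T : finType) (s : seq T) : Prop :=
  [/\ 2 < size s, uniq s & forall x : T, x \in s].

Definition clauses_then_variables (phi : cnf) (s : seq (vertex phi)) : Prop :=
  exists (cs : seq 'I_(nclauses phi)) (vs : seq 'I_(nvars phi)),
    s = map inl cs ++ map inr vs.

Definition linked_planar_3SAT (R : realType) (I : instance) : Prop :=
  [/\ is_3SAT (formula I),
      edges I = incidence_edges (formula I),
      hamiltonian_cycle (cycle_seq I),
      clauses_then_variables (cycle_seq I) &
      planar R (fun x y : vertex (formula I) =>
                  graph_adj (edges I) x y || cycle_adj (cycle_seq I) x y)].

(** ** Encoding of instances as bit strings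

    The numbers of variables and of clauses in unary, the clause/literal
    incidence matrix, the clause/variable adjacency matrix (both row by row),
    then the vertices of the cycle in order, each as a tag bit followed by its
    index in unary.  As the cycle lists all the vertices, unary and binary
    indices give polynomially related lengths. *)

Definition unary (n : nat) : seq bool := nseq n true ++ [:: false].

Definition encode_vertex (phi : cnf) (x : vertex phi) : seq bool :=
  match x with
  | inl c => true :: unary c
  | inr v => false :: unary v
  end.

Definition encode (I : instance) : seq bool :=
  unary (nvars (formula I)) ++ unary (nclauses (formula I)) ++
  [seq cl.2 \in clause (formula I) cl.1
     | cl <- enum {: 'I_(nclauses (formula I)) * literal (nvars (formula I))}]
  ++
  [seq cv \in edges I
     | cv <- enum {: 'I_(nclauses (formula I)) * 'I_(nvars (formula I))}] ++
  flatten [seq encode_vertex x | x <- cycle_seq I].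

Lemma unary_inj (m n : nat) (s t : seq bool) :
  unary m ++ s = unary n ++ t -> m = n /\ s = t.
Proof.
elim: m n => [|m IH] [|n] //=; first by case.
by case=> /IH [-> ->].
Qed.

Lemma encode_vertices_inj (phi : cnf) (s t : seq (vertex phi)) :
  flatten [seq encode_vertex x | x <- s] =
  flatten [seq encode_vertex x | x <- t] -> s = t.
Proof.
elim: s t => [|x s IH] [|y t] //=.
- by case: y.
- by case: x.
- case: x => x; case: y => y //= [] /unary_inj [/val_inj -> /IH ->] //.
Qed.

Lemma encode_inj : injective encode.
Proof.
move=> [[n m C] E s] [[n' m' C'] E' s']; rewrite /encode /=.
move=> /unary_inj [en]; move: C' E' s'; rewrite -en => C' E' s'.
move=> /unary_inj [em]; move: C' E' s'; rewrite -em => C' E' s' /eqP.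
rewrite eqseq_cat ?size_map // => /andP[/eqP eC].
rewrite eqseq_cat ?size_map // => /andP[/eqP eE /eqP es].
have eqC : C = C'.
  apply/ffunP => c; apply/setP => l.
  by move/eq_in_map: eC => /(_ (c, l)); rewrite mem_enum => /(_ isT).
rewrite -{}eqC in s' es *.
have -> : E = E'.
  by apply/setP => cv; move/eq_in_map: eE => /(_ cv); rewrite mem_enum => /(_ isT).
by rewrite (encode_vertices_inj (phi := Cnf C) es).
Qed.

(** The number of satisfying assignments of the formula of the instance
    encoded by [w] (unique by [encode_inj]); a string that encodes no instance
    has count 0. *)
Definition count_linked_planar_3SAT (R : realType) (w : seq bool) : nat :=
  match pselect (exists I : instance, linked_planar_3SAT R I /\ encode I = w)
  with
  | left H => nb_satisfying (formula (sval (cid H)))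
  | right _ => 0
  end.

Lemma count_linked_planar_3SAT_encode (R : realType) (I : instance) :
  linked_planar_3SAT R I ->
  count_linked_planar_3SAT R (encode I) = nb_satisfying (formula I).
Proof.
move=> HI; rewrite /count_linked_planar_3SAT; case: pselect => [H|[]].
  by case: (cid H) => J /= [_ /encode_inj ->].
by exists I.
Qed.

(* Main.v *)
Require Import Defs.
From mathcomp Require Import all_boot all_order all_algebra.
From mathcomp Require Import all_classical all_reals all_analysis.
From mathcomp Require Import zify ring lra.
From Stdlib Require Import Btauto.

(** Hardness.  A polynomial-time verifier is unrolled, as in the Cook-Levin theorem, into a
    cellular automaton, which in one-hot encoding is a circuit of NOR gates.  The circuit is
    evaluated on a row of registers by local gates only: an accumulator travels along the
    row, passing each register by the crossing through three exclusive ors, so that every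
    new variable depends on variables at distance [W - 1], [W] and [W + 1] before it.  When
    the variables, and likewise the clauses, are listed in the order of creation, the
    incidence graph consists of two monotone staircases, hence can be drawn with the cycle,
    one staircase inside and one outside.  Each clause group determines its new variable, so
    solutions correspond to the inputs accepted by the circuit.

    Membership.  The union of the incidence graph and the cycle is planar iff no three
    incidence edges cross pairwise inside the cycle.  Three such edges together with the
    cycle form a subdivision of K(3,3), which is not planar by a parity count of crossings of
    polygonal paths; otherwise the edges split into two noncrossing pages.  Hence instances
    are recognized in polynomial time, and a witness is an assignment padded with zeros.

    Polynomial time is obtained from a language of bounded sums over the bits of the input,
    compiled to Turing machines with unary registers. *)

Set Implicit Arguments.
Unset Strict Implicit.
Unset Printing Implicit Defensive.

Import Order.TTheory GRing.Theory Num.Theory.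
Import numFieldNormedType.Exports.

Local Open Scope nat_scope.

(** Membership carries as much weight as hardness: a string that encodes no instance counts 0, so
    the verifier has to decide planarity, which is defined through arbitrary continuous arcs. A
    combinatorial criterion is therefore proved in both directions. To refute a drawing, only
    crossings modulo 2 are used: they telescope to data attached to the vertices, and this takes the
    place of the Jordan curve theorem. The same criterion guides the reduction. A planar formula
    leaves no room for long wires, so values must be carried past one another by gates. Since the
    number of solutions must be preserved exactly, no gadget may add freedom: every value, idle
    copies included, is a function of the inputs. The reduction is then parsimonious and asks a
    single query. The reduction and the verifier must both run on the machines of the definition.
    Unary registers suffice, because all the numbers involved are polynomially bounded in the length
    of the input. *)

Notation sym := (symbol void).

(** Tapes up to trailing blanks: the two halves as infinite sequences. *)
Definition ftape : Type := (nat -> sym) * (nat -> sym).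
Notation tapes := (nat -> ftape).

Definition scons (T : Type) (a : T) (f : nat -> T) : nat -> T :=
  fun k => if k is k'.+1 then f k' else a.

Definition stail (T : Type) (f : nat -> T) : nat -> T := fun k => f k.+1.

Lemma scons_stail T (f : nat -> T) : scons (f 0) (stail f) = f.
Proof. by apply/funext; case. Qed.

Definition fmove (a : sym) (d : direction) (t : ftape) : ftape :=
  match d with
  | GoLeft => (stail t.1, scons (t.1 0) (scons a (stail t.2)))
  | Stay => (t.1, scons a (stail t.2))
  | GoRight => (scons a t.1, stail t.2)
  end.

Arguments fmove : simpl never.
Arguments write_move : simpl never.
Arguments run : simpl never.

Definition absT (t : tape void) : ftape := (nth None t.1, nth None t.2).

Lemma nth_behead_stail (s : seq sym) : nth None (behead s) = stail (nth None s).
Proof. by apply/funext => k; rewrite nth_behead. Qed.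

Lemma nth_cons_scons (a : sym) s : nth None (a :: s) = scons a (nth None s).
Proof. by apply/funext; case. Qed.

Lemma absT_write_move a d t : absT (write_move a d t) = fmove a d (absT t).
Proof.
case: t => l r; case: d; rewrite /absT /write_move /fmove /=;
  by rewrite ?nth_cons_scons ?nth_behead_stail // nth0.
Qed.

Lemma absT_scanned t : scanned t = (absT t).2 0.
Proof. by rewrite /scanned /= nth0. Qed.

Lemma fmove_stay t : fmove (t.2 0) Stay t = t.
Proof. by case: t => l r; rewrite /fmove /= scons_stail. Qed.

Definition fword (w : seq bool) (t : ftape) : Prop :=
  (forall k, k < size w -> t.2 k = bit _ (nth false w k)) /\
  (if t.2 (size w) is Some (inl _) then false else true).

Lemma fword_leading_bits w t : fword w (absT t) -> word_of_tape t = w.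
Proof.
case: t => l r; rewrite /fword /word_of_tape /=.
elim: w r => [|b w IH] [|a r] //= [H1 H2].
- by case: a H2 {H1} => [[]|].
- by have := H1 0 isT.
- have /= -> := H1 0 isT; rewrite /= IH //; split=> // k kw.
  exact: (H1 k.+1).
Qed.

Definition upd (T : Type) (f : nat -> T) (i : nat) (v : T) : nat -> T :=
  fun j => if j == i then v else f j.

Lemma upd_eq T (f : nat -> T) i v : upd f i v i = v.
Proof. by rewrite /upd eqxx. Qed.

Lemma upd_neq T (f : nat -> T) i j v : j != i -> upd f i v j = f j.
Proof. by rewrite /upd => /negbTE ->. Qed.

(** * Structured commands and their compilation to machines *)

Inductive cmd :=
  | CSkip
  | CAct of nat & (sym -> sym) & direction
  | CSeq of cmd & cmd
  | CIf of nat & pred sym & cmd & cmd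
  | CWhile of nat & pred sym & cmd
  | CQuery.

(** The costs are those of the code generated below: one step per test, one for the jump over the
    true branch, which is laid out after the false one, and one for the jump back in a loop. *)
Inductive exec (O : seq bool -> seq bool) : cmd -> tapes -> nat -> tapes -> Prop :=
  | ESkip st : exec O CSkip st 0 st
  | EAct i f d st :
      exec O (CAct i f d) st 1 (upd st i (fmove (f ((st i).2 0)) d (st i)))
  | ESeq c1 c2 st1 st2 st3 t1 t2 :
      exec O c1 st1 t1 st2 -> exec O c2 st2 t2 st3 ->
      exec O (CSeq c1 c2) st1 (t1 + t2) st3
  | EIfT i (p : pred sym) c1 c2 st st' t :
      p ((st i).2 0) -> exec O c1 st t st' ->
      exec O (CIf i p c1 c2) st t.+1 st'
  | EIfF i (p : pred sym) c1 c2 st st' t :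
      ~~ p ((st i).2 0) -> exec O c2 st t st' ->
      exec O (CIf i p c1 c2) st t.+2 st'
  | EWhileF i (p : pred sym) c st :
      ~~ p ((st i).2 0) -> exec O (CWhile i p c) st 1 st
  | EWhileT i (p : pred sym) c st st' st'' t t' :
      p ((st i).2 0) -> exec O c st t st' ->
      exec O (CWhile i p c) st' t' st'' ->
      exec O (CWhile i p c) st (t.+2 + t') st''
  | EQuery st w : fword w (st 2) ->
      exec O CQuery st 1 (upd st 2 (absT (tape_of_word _ (O w)))).

Inductive instr :=
  | IAct of nat & (sym -> sym) & direction
  | IBr of nat & pred sym & nat
  | IQuery.

Fixpoint csize (c : cmd) : nat :=
  match c with
  | CSkip => 0
  | CAct _ _ _ | CQuery => 1
  | CSeq c1 c2 => csize c1 + csize c2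
  | CIf _ _ c1 c2 => (csize c2 + csize c1).+2
  | CWhile _ _ c => (csize c).+2
  end.

(** Branch targets are absolute, so [b] is the address of the first instruction. An unconditional
    jump is a branch whose test always succeeds. *)
Fixpoint code (b : nat) (c : cmd) : seq instr :=
  match c with
  | CSkip => [::]
  | CAct i f d => [:: IAct i f d]
  | CQuery => [:: IQuery]
  | CSeq c1 c2 => code b c1 ++ code (b + csize c1) c2
  | CIf i p c1 c2 =>
      IBr i p (b + csize c2).+2 :: code b.+1 c2 ++
      IBr 0 xpredT (b + (csize c2 + csize c1).+2) :: code (b + csize c2).+2 c1
  | CWhile i p c =>
      IBr i (predC p) (b + csize c).+2 :: code b.+1 c ++ [:: IBr 0 xpredT b]
  end.

Lemma size_code b c : size (code b c) = csize c.
Proof.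
elim: c b => //= [c1 IH1 c2 IH2|i p c1 IH1 c2 IH2|i p c IH] b.
- by rewrite size_cat IH1 IH2.
- by rewrite size_cat /= IH1 IH2 addnS.
- by rewrite size_cat IH addn1.
Qed.

Section CodeMachine.
Variables (k : nat) (prog : seq instr).

Definition code_state : finType := 'I_(size prog).+1.

(** The default instruction is not a query, so that the final state, numbered [size prog], halts. *)
Definition code_query (q : code_state) : option code_state :=
  if nth (IAct 0 id Stay) prog q is IQuery then Some (inord q.+1) else None.

Definition code_delta (q : code_state) (a : {ffun 'I_k.+3 -> sym}) :
    option (code_state * ('I_k.+3 -> sym * direction)) :=
  if q == size prog :> nat then None else
  match nth IQuery prog q with
  | IAct i f d =>
      Some (inord q.+1,
            fun j : 'I_k.+3 => if j == i :> nat then (f (a j), d) else (a j, Stay))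
  | IBr i p n =>
      Some (inord (if p (a (inord i)) then n else q.+1), fun j => (a j, Stay))
  | IQuery => None
  end.

Definition code_machine : machine :=
  @Machine void k code_state ord0 code_query code_delta.

Definition agree (st : tapes) (c : config code_machine) : Prop :=
  forall j : 'I_k.+3, absT (c.2 j) = st j.

Definition fits (n : nat) (c : seq instr) :=
  all (fun i => match i with IAct i _ _ | IBr i _ _ => i < n | IQuery => true end) c.

Hypothesis prog_fits : fits k.+3 prog.

Lemma step_act O (q : code_state) i f d ts st :
  q < size prog -> nth IQuery prog q = IAct i f d ->
  agree st (q, ts) ->
  exists c', [/\ step O ((q, ts) : config code_machine) = Some c',
     c'.1 = q.+1 :> nat & agree (upd st i (fmove (f ((st i).2 0)) d (st i))) c'].
Proof.
move=> qs nq ag; rewrite /step /= /code_query (set_nth_default IQuery) // nq.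
rewrite /code_delta ltn_eqF // nq; eexists; split; first by [].
  by rewrite /= inordK.
move=> j; rewrite /= absT_write_move /upd; case: eqP => [ji|_] /=.
  by rewrite ffunE absT_scanned (ag j) /= ji.
by rewrite ffunE absT_scanned (ag j) /= fmove_stay.
Qed.

Lemma step_br O (q : code_state) i (p : pred sym) n ts st :
  q < size prog -> nth IQuery prog q = IBr i p n -> n <= size prog ->
  agree st (q, ts) ->
  exists c', [/\ step O ((q, ts) : config code_machine) = Some c',
     c'.1 = (if p ((st i).2 0) then n else q.+1) :> nat & agree st c'].
Proof.
move=> qs nq ns ag; rewrite /step /= /code_query (set_nth_default IQuery) // nq.
rewrite /code_delta ltn_eqF // nq; eexists; split; first by [].
  have ik : i < k.+3.
    by move/(all_nthP IQuery): prog_fits => /(_ q qs); rewrite nq.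
  have sti : st (inord i : 'I_k.+3) = st i by rewrite inordK.
  rewrite /= ffunE absT_scanned (ag (inord i)) sti inordK //.
  by case: ifP.
by move=> j; rewrite /= absT_write_move ffunE absT_scanned (ag j) fmove_stay.
Qed.

Lemma step_query O (q : code_state) w ts st :
  q < size prog -> nth IQuery prog q = IQuery -> fword w (st 2) ->
  agree st (q, ts) ->
  exists c', [/\ step O ((q, ts) : config code_machine) = Some c',
     c'.1 = q.+1 :> nat & agree (upd st 2 (absT (tape_of_word _ (O w)))) c'].
Proof.
move=> qs nq fw ag; rewrite /step /= /code_query (set_nth_default IQuery) // nq.
eexists; split; first by []; first by rewrite /= inordK.
move=> j; rewrite /= /upd -[RHS]/(if _ then _ else _) -val_eqE /= inordK //.
case: eqP => [j2|_]; last exact: ag.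
by rewrite (@fword_leading_bits w) //; rewrite (ag j) j2.
Qed.

Lemma run_add O t1 t2 (c : config code_machine) :
  run O (t1 + t2) c = run O t2 (run O t1 c).
Proof. by rewrite /run addnC iterD. Qed.

Lemma run_step O (c c' : config code_machine) :
  step O c = Some c' -> run O 1 c = c'.
Proof. by rewrite /run /= => ->. Qed.

(** The code may sit anywhere in the program: for each subcommand the code around it is moved into
    [pre] and [post], and the induction goes through. *)
Lemma code_correct O c st t st' : exec O c st t st' ->
  forall pre post (q : code_state) ts,
  prog = pre ++ code (size pre) c ++ post -> q = size pre :> nat ->
  agree st (q, ts) ->
  (run O t ((q, ts) : config code_machine)).1 = (size pre + csize c) :> nat /\
  agree st' (run O t ((q, ts) : config code_machine)).
Proof.
elim=> {c st t st'}.
- by move=> st pre post q ts _ qp ag; rewrite /= addn0.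
- move=> i f d st pre post q ts E qp ag.
  have sE := congr1 size E; rewrite !size_cat size_code /= in sE.
  have [||c' [Hs H1 H2]] := @step_act O q i f d ts st _ _ ag.
  + lia.
  + by rewrite qp E nth_cat ltnn subnn.
  by rewrite (run_step Hs) H1 qp addn1.
- move=> c1 c2 st1 st2 st3 t1 t2 _ IH1 _ IH2 pre post q ts E qp ag.
  have sE := congr1 size E; rewrite !size_cat size_code /= in sE.
  rewrite run_add /=.
  have [|H1 H2] := IH1 pre (code (size pre + csize c1) c2 ++ post) q ts _ qp ag.
    by rewrite E /= -catA.
  case: (run _ _ _) H1 H2 => q' ts' /= H1 H2.
  have := IH2 (pre ++ code (size pre) c1) post q' ts'.
  rewrite size_cat size_code => /(_ _ H1 H2); rewrite -addnA; apply.
  by rewrite E /= !catA.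
- move=> i p c1 c2 st st' t pt _ IH pre post q ts E qp ag.
  have sE := congr1 size E; rewrite !size_cat size_code /= in sE.
  have [|||c' [Hs H1 H2]] := @step_br O q i p (size pre + csize c2).+2 ts st _ _ _ ag.
  + lia.
  + by rewrite qp E nth_cat ltnn subnn.
  + lia.
  rewrite (run_add O 1 t) (run_step Hs) /=.
  rewrite pt in H1; case: c' H1 H2 {Hs} => q' ts' /= H1 H2.
  pose pre' := pre ++ IBr i p (size pre + csize c2).+2 :: code (size pre).+1 c2 ++
      [:: IBr 0 xpredT (size pre + (csize c2 + csize c1).+2)].
  have sp : size pre' = (size pre + csize c2).+2.
    by rewrite /pre' size_cat /= size_cat size_code /=; lia.
  have := IH pre' post q' ts'; rewrite sp => /(_ _ H1 H2) [].
    by rewrite E /pre' /= -!catA /= -?catA.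
  by move=> -> Hag; split=> //; lia.
- move=> i p c1 c2 st st' t pt _ IH pre post q ts E qp ag.
  have sE := congr1 size E; rewrite !size_cat size_code /= in sE.
  have [|||c' [Hs H1 H2]] := @step_br O q i p (size pre + csize c2).+2 ts st _ _ _ ag.
  + lia.
  + by rewrite qp E nth_cat ltnn subnn.
  + lia.
  have -> : t.+2 = 1 + (t + 1) by lia.
  rewrite !run_add (run_step Hs).
  rewrite (negbTE pt) in H1; case: c' H1 H2 {Hs} => q' ts' /= H1 H2.
  pose pre' := pre ++ [:: IBr i p (size pre + csize c2).+2].
  have sp : size pre' = (size pre).+1 by rewrite /pre' size_cat /= addn1.
  set post' := IBr 0 xpredT (size pre + (csize c2 + csize c1).+2) ::
                 code (size pre + csize c2).+2 c1 ++ post.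
  have := IH pre' post' q' ts'; rewrite sp => /(_ _ _ H2) [].
  + by rewrite E /pre' /post' /= -!catA /= -?catA.
  + by rewrite H1 qp.
  case: (run _ t _) => q2 ts2 /= H3 H4.
  have [|||c' [Hs H5 H6]] := @step_br O q2 0 xpredT (size pre + (csize c2 + csize c1).+2) ts2 st' _ _ _ H4.
  + lia.
  + rewrite H3 E nth_cat ltnNge addSn -addnS leq_addr /= addKn /= nth_cat.
    by rewrite size_cat /= !size_code addnS ltnS leq_addr nth_cat size_code ltnn subnn.
  + lia.
  by rewrite (run_step Hs) H5.
- move=> i p c st pt pre post q ts E qp ag.
  have sE := congr1 size E; rewrite !size_cat size_code /= in sE.
  have [|||c' [Hs H1 H2]] := @step_br O q i (predC p) (size pre + csize c).+2 ts st _ _ _ ag.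
  + lia.
  + by rewrite qp E nth_cat ltnn subnn.
  + lia.
  rewrite (run_step Hs) H1 /= pt; split=> //; lia.
- move=> i p c st st' st'' t t' pt _ IH1 _ IH2 pre post q ts E qp ag.
  have sE := congr1 size E; rewrite !size_cat size_code /= in sE.
  have [|||c' [Hs H1 H2]] := @step_br O q i (predC p) (size pre + csize c).+2 ts st _ _ _ ag.
  + lia.
  + by rewrite qp E nth_cat ltnn subnn.
  + lia.
  have -> : t.+2 + t' = 1 + (t + (1 + t')) by lia.
  rewrite !run_add (run_step Hs).
  rewrite /= pt in H1; case: c' H1 H2 {Hs} => q' ts' /= H1 H2.
  pose pre' := pre ++ [:: IBr i (predC p) (size pre + csize c).+2].
  have sp : size pre' = (size pre).+1 by rewrite /pre' size_cat /= addn1.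
  have := IH1 pre' (IBr 0 xpredT (size pre) :: post) q' ts'; rewrite sp => /(_ _ _ H2) [].
  + by rewrite E /pre' /= -!catA /= -?catA.
  + by rewrite H1 qp.
  case: (run _ t _) => q2 ts2 /= H3 H4.
  have [|||c' [Hs H5 H6]] := @step_br O q2 0 xpredT (size pre) ts2 st' _ _ _ H4.
  + lia.
  + rewrite H3 E nth_cat ltnNge addSn -addnS leq_addr /= addKn /= nth_cat.
    by rewrite size_cat /= size_code addn1 ltnSn nth_cat size_code ltnn subnn.
  + lia.
  rewrite (run_step Hs); case: c' H5 H6 {Hs} => q3 ts3 /= H5 H6.
  exact: IH2 E _ H6.
- move=> st w fw pre post q ts E qp ag.
  have sE := congr1 size E; rewrite !size_cat size_code /= in sE.
  have [||c' [Hs H1 H2]] := @step_query O q w ts st _ _ fw ag.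
  + lia.
  + by rewrite qp E nth_cat ltnn subnn.
  by rewrite (run_step Hs) H1 qp addn1.
Qed.

Lemma run_halted O t (c : config code_machine) :
  step O c = None -> run O t c = c.
Proof. by move=> H; rewrite /run; elim: t => //= t ->; rewrite H. Qed.

Lemma step_end O (c : config code_machine) :
  c.1 = size prog :> nat -> step O c = None.
Proof.
by move=> H; rewrite /step /= /code_query H nth_default // /code_delta H eqxx.
Qed.

End CodeMachine.

(** * Unary registers on tapes *)

Definition input_ftape (x : seq bool) (h : nat) : ftape :=
  (fun k => if k < h then nth None (map (@bit void) x) (h - k.+1) else None,
   fun k => nth None (map (@bit void) x) (h + k)).

Definition output_ftape (o : seq bool) : ftape :=
  (fun k => nth None (rev (map (@bit void) o)) k, fun _ => None).

(** The ones start at the head and everything to the left is blank. Adding one moves left before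
    writing, and the test for zero looks at a single cell. *)
Definition counter_ftape (v : nat) : ftape :=
  (fun _ => None, fun k => if k < v then bit _ true else None).

(** Position of the input head, registers, words written on tapes 1 and 2. *)
Record rstate := RState {
  rs_head : nat;
  rs_reg : nat -> nat;
  rs_out : seq bool;
  rs_ask : seq bool
}.

Definition conc (x : seq bool) (a : rstate) : tapes := fun i =>
  match i with
  | 0 => input_ftape x (rs_head a)
  | 1 => output_ftape (rs_out a)
  | 2 => output_ftape (rs_ask a)
  | r.+3 => counter_ftape (rs_reg a r)
  end.

Definition set_reg a r v :=
  RState (rs_head a) (upd (rs_reg a) r v) (rs_out a) (rs_ask a).
Definition set_head a h := RState h (rs_reg a) (rs_out a) (rs_ask a).
Definition emit_to (ask : bool) a w :=
  RState (rs_head a) (rs_reg a)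
    (if ask then rs_out a else rs_out a ++ w)
    (if ask then rs_ask a ++ w else rs_ask a).

Lemma rstate_ext a b :
  rs_head a = rs_head b -> (forall r, rs_reg a r = rs_reg b r) ->
  rs_out a = rs_out b -> rs_ask a = rs_ask b -> a = b.
Proof. by case: a b => ? ? ? ? [? ? ? ?] /= -> /funext -> -> ->. Qed.

Ltac rstate_eq :=
  apply: rstate_ext => //= ?; rewrite /upd;
  repeat (case: eqP => ?); subst; try lia; try congruence.

(** Only an upper bound on the time is kept, so that branches of different lengths can share one
    bound. *)
Definition aruns O x c a a' n :=
  exists2 t, t <= n & exec O c (conc x a) t (conc x a').

Lemma aruns_eq O x c a a' b b' n m :
  aruns O x c a a' n -> a = b -> a' = b' -> n <= m -> aruns O x c b b' m.
Proof. by move=> [t tn H] <- <- nm; exists t => //; apply: leq_trans nm. Qed.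

Lemma aruns_skip O x a : aruns O x CSkip a a 0.
Proof. by exists 0 => //; constructor. Qed.

Lemma aruns_seq O x c1 c2 a1 a2 a3 n1 n2 :
  aruns O x c1 a1 a2 n1 -> aruns O x c2 a2 a3 n2 ->
  aruns O x (CSeq c1 c2) a1 a3 (n1 + n2).
Proof.
by move=> [t1 l1 H1] [t2 l2 H2]; exists (t1 + t2); [apply: leq_add|apply: ESeq H1 H2].
Qed.

Definition Inc r := CSeq (CAct r.+3 id GoLeft) (CAct r.+3 (fun _ => bit _ true) Stay).
Definition Dec r := CAct r.+3 (fun _ => None) GoRight.
Definition Loop r c := CWhile r.+3 isSome (CSeq (Dec r) c).

Lemma aruns_inc O x a r : aruns O x (Inc r) a (set_reg a r (rs_reg a r).+1) 2.
Proof.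
exists (1 + 1) => //; apply: ESeq; first exact: EAct.
set s := upd _ _ _.
have -> : conc x (set_reg a r (rs_reg a r).+1) =
    upd s r.+3 (fmove (bit _ true) Stay (s r.+3)); last exact: EAct.
rewrite /s; apply/funext => -[|[|[|i]]] //=.
rewrite upd_eq /upd !eqSS; case: eqP => // _; congr pair => /=.
by apply/funext => -[|[|k]].
Qed.

Lemma aruns_dec O x a r v : rs_reg a r = v.+1 ->
  aruns O x (Dec r) a (set_reg a r v) 1.
Proof.
move=> E; exists 1 => //.
have -> : conc x (set_reg a r v) =
    upd (conc x a) r.+3 (fmove None GoRight (conc x a r.+3)); last exact: EAct.
apply/funext => -[|[|[|i]]] //=.
rewrite /upd !eqSS; case: eqP => // _; congr pair; apply/funext => -[|k] //=.
- by rewrite /stail E.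
- by rewrite /stail E.
Qed.

Lemma aruns_if O x a r c1 c2 a' n :
  (0 < rs_reg a r -> aruns O x c1 a a' n) ->
  (rs_reg a r = 0 -> aruns O x c2 a a' n) ->
  aruns O x (CIf r.+3 isSome c1 c2) a a' n.+2.
Proof.
move=> H1 H2; case: (posnP (rs_reg a r)) => E.
  have [t tn H] := H2 E; exists t.+2 => //; apply: EIfF => //=.
  by rewrite E.
have [t tn H] := H1 E; exists t.+1; first exact: leq_trans tn _.
by apply: EIfT => //=; rewrite E.
Qed.

(** Here [f i] is the state after [i] turns. A turn consists of the test, the decrement, the body
    and the jump back, hence [B + 3]. *)
Lemma aruns_loop O x r c (f : nat -> rstate) N B :
  (forall i, i <= N -> rs_reg (f i) r = N - i) ->
  (forall i, i < N -> aruns O x c (set_reg (f i) r (N - i.+1)) (f i.+1) B) ->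
  aruns O x (Loop r c) (f 0) (f N) (N * (B + 3) + 1).
Proof.
elim: N f => [|N IH] f H1 H2.
  exists 1 => //; apply: EWhileF => /=.
  by rewrite H1.
have [||t tn Ht] := IH (fun i => f i.+1).
- by move=> i iN; rewrite H1.
- by move=> i iN; apply: aruns_eq (H2 i.+1 iN) _ _ _.
have [t2 t2n Ht2] := H2 0 isT.
have [|t1 t1n Ht1] := @aruns_dec O x (f 0) r N; first by rewrite H1.
exists ((t1 + t2).+2 + t); first by nia.
apply: EWhileT Ht; first by rewrite /= H1.
by apply: ESeq Ht1 _; move: Ht2; rewrite subn1.
Qed.

Definition Clear r := Loop r CSkip.

Lemma aruns_clear O x a r : aruns O x (Clear r) a (set_reg a r 0) (rs_reg a r * 3 + 1).
Proof.
pose f i := set_reg a r (rs_reg a r - i).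
apply: (@aruns_eq _ _ _ (f 0) (f (rs_reg a r)) _ _ (rs_reg a r * (0 + 3) + 1)); last by [].
- apply: aruns_loop => i iN; first by rewrite /= upd_eq.
  by apply: aruns_eq (aruns_skip _ _ _) _ _ _ => //; rstate_eq.
- by rstate_eq.
- by rewrite /f subnn.
Qed.

(** Register [s] is emptied. *)
Definition AddTo r s := Loop s (Inc r).

Lemma aruns_addto O x a r s : r != s ->
  aruns O x (AddTo r s) a (set_reg (set_reg a s 0) r (rs_reg a r + rs_reg a s))
    (rs_reg a s * 5 + 1).
Proof.
move=> /eqP rs; pose f i := set_reg (set_reg a s (rs_reg a s - i)) r (rs_reg a r + i).
apply: (@aruns_eq _ _ _ (f 0) (f (rs_reg a s)) _ _ (rs_reg a s * (2 + 3) + 1)); last by [].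
- apply: aruns_loop => i iN; first by rewrite /= upd_neq ?upd_eq // eq_sym; apply/eqP.
  by apply: aruns_eq (aruns_inc _ _ _ _) _ _ _ => //; rstate_eq.
- by rstate_eq.
- by rewrite /f subnn.
Qed.

Definition MoveR := CAct 0 id GoRight.
Definition MoveL := CAct 0 id GoLeft.

Lemma aruns_mover O x a : aruns O x MoveR a (set_head a (rs_head a).+1) 1.
Proof.
exists 1 => //.
have -> : conc x (set_head a (rs_head a).+1) =
    upd (conc x a) 0 (fmove ((conc x a 0).2 0) GoRight (conc x a 0)); last exact: EAct.
apply/funext => -[|i] //=; rewrite /upd eqxx; congr pair; apply/funext => k /=.
- by case: k => [|k] //=; rewrite subn1 addn0.
- by rewrite /stail addSnnS.
Qed.

Lemma aruns_movel O x a h : rs_head a = h.+1 -> aruns O x MoveL a (set_head a h) 1.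
Proof.
move=> E; exists 1 => //.
have -> : conc x (set_head a h) =
    upd (conc x a) 0 (fmove ((conc x a 0).2 0) GoLeft (conc x a 0)); last exact: EAct.
apply/funext => -[|i] //=; rewrite /upd eqxx E; congr pair; apply/funext => k /=.
case: k => [|[|k]] /=; rewrite ?addn0 ?addn1 ?subn1 // /stail /=; congr nth; lia.
Qed.

(** [s] must hold the position of the input head. *)
Definition Rewind s := Loop s MoveL.

Lemma aruns_rewind O x a s : rs_head a = rs_reg a s ->
  aruns O x (Rewind s) a (set_head (set_reg a s 0) 0) (rs_reg a s * 4 + 1).
Proof.
move=> E; pose f i := set_head (set_reg a s (rs_reg a s - i)) (rs_reg a s - i).
apply: (@aruns_eq _ _ _ (f 0) (f (rs_reg a s)) _ _ (rs_reg a s * (1 + 3) + 1)); last by [].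
- apply: aruns_loop => i iN; first by rewrite /= /upd eqxx.
  apply: aruns_eq (@aruns_movel O x _ (rs_reg a s - i.+1) _) _ _ _ => //=.
    by rewrite /f /= -subSn // subSS.
  by rstate_eq.
- by rewrite /f subn0 -E; rstate_eq.
- by rewrite /f subnn.
Qed.

Definition Emit (ask : bool) b := CAct (if ask then 2 else 1) (fun _ => bit _ b) GoRight.

Lemma output_ftape_rcons o b :
  output_ftape (o ++ [:: b]) = fmove (bit _ b) GoRight (output_ftape o).
Proof.
congr pair => //; apply/funext => -[|k] /=; by rewrite map_cat rev_cat.
Qed.

Lemma aruns_emit O x ask a b : aruns O x (Emit ask b) a (emit_to ask a [:: b]) 1.
Proof.
exists 1 => //; set i := if ask then 2 else 1.
have -> : conc x (emit_to ask a [:: b]) =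
    upd (conc x a) i (fmove (bit _ b) GoRight (conc x a i)); last exact: EAct.
rewrite /i; apply/funext => -[|[|[|j]]] //=; case: ask {i} => //=.
- by rewrite /upd eqxx output_ftape_rcons.
- by rewrite /upd eqxx output_ftape_rcons.
Qed.

Ltac upd_tac :=
  rewrite /= /upd; repeat (case: eqP => ?); subst; try lia; try congruence.

(** * Polynomially bounded functions *)

Definition polyb (f : nat -> nat) := exists p : {poly nat}, forall n, f n <= poly_bound p n.

Lemma poly_boundD p q n : poly_bound (p + q)%R n = poly_bound p n + poly_bound q n.
Proof. by rewrite /poly_bound hornerD. Qed.

Lemma poly_boundM p q n : poly_bound (p * q)%R n = poly_bound p n * poly_bound q n.
Proof. by rewrite /poly_bound hornerM. Qed.

Lemma poly_boundE p n : poly_bound p n = foldr (fun c r => r * n + c) 0 (polyseq p).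
Proof. by rewrite /poly_bound /horner /=; elim: (polyseq p) => //= c s ->. Qed.

Lemma leq_poly_bound p m n : m <= n -> poly_bound p m <= poly_bound p n.
Proof.
move=> mn; rewrite !poly_boundE; elim: (polyseq p) => //= c s IH.
by rewrite leq_add2r leq_mul.
Qed.

Lemma polyb_cst c : polyb (fun _ => c).
Proof. by exists (polyC c) => n; rewrite /poly_bound hornerC. Qed.

Lemma polyb_id : polyb id.
Proof. by exists 'X%R => n; rewrite /poly_bound hornerX. Qed.

Lemma polyb_add f g : polyb f -> polyb g -> polyb (fun n => f n + g n).
Proof.
by move=> [p Hp] [q Hq]; exists (p + q)%R => n; rewrite poly_boundD leq_add.
Qed.

Lemma polyb_mul f g : polyb f -> polyb g -> polyb (fun n => f n * g n).
Proof.
by move=> [p Hp] [q Hq]; exists (p * q)%R => n; rewrite poly_boundM leq_mul.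
Qed.

Lemma polyb_comp f g : polyb f -> polyb g -> polyb (fun n => f (g n)).
Proof.
move=> [p Hp] [q Hq]; exists (p \Po q)%R => n; rewrite /poly_bound horner_comp.
by apply: leq_trans (Hp _) (leq_poly_bound p (Hq n)).
Qed.

Lemma polyb_poly_bound p : polyb (poly_bound p).
Proof. by exists p. Qed.

Ltac polyb_tac :=
  repeat first [ assumption | exact: polyb_id | exact: polyb_cst
    | exact: polyb_poly_bound
    | apply: polyb_add | apply: polyb_mul
    | match goal with
      | H : polyb ?f |- polyb (fun n => ?f _) => apply: (polyb_comp H)
      end ].

(** * Arithmetic expressions over the bits of an input word *)

(** Variables are de Bruijn indices; a missing variable has value 0. *)
Inductive expr :=
  | Var of nat
  | Cst of nat
  | Len
  | Bit of expr
  | Add of expr & expr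
  | Sub of expr & expr
  | Sum of expr & expr
  | Shift of expr.

Fixpoint ev (x : seq bool) (s : seq nat) (e : expr) : nat :=
  match e with
  | Var k => nth 0 s k
  | Cst c => c
  | Len => size x
  | Bit e => nth false x (ev x s e)
  | Add e1 e2 => ev x s e1 + ev x s e2
  | Sub e1 e2 => ev x s e1 - ev x s e2
  | Sum e1 e2 => \sum_(i < ev x s e1) ev x (val i :: s) e2
  | Shift e => ev x (behead s) e
  end.

(** [comp r d e] adds the value of [e] to register [d]; the variables are held by
    the registers [r], and the registers from [d] on are free. *)
Fixpoint comp (r : seq nat) (d : nat) (e : expr) : cmd :=
  match e with
  | Var k => if k < size r then
      CSeq (Loop (nth 0 r k) (CSeq (Inc d) (Inc d.+1))) (AddTo (nth 0 r k) d.+1)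
      else CSkip
  | Cst c => iter c (fun k => CSeq (Inc d) k) CSkip
  | Len => CSeq (CWhile 0 isSome (CSeq MoveR (CSeq (Inc d) (Inc d.+1)))) (Rewind d.+1)
  | Bit e => CSeq (comp r d.+1 e) (CSeq (Loop d.+1 (CSeq MoveR (Inc d.+2)))
      (CSeq (CIf 0 (pred1 (bit _ true)) (Inc d) CSkip) (Rewind d.+2)))
  | Add e1 e2 => CSeq (comp r d e1) (CSeq (comp r d.+1 e2) (AddTo d d.+1))
  | Sub e1 e2 => CSeq (comp r d e1) (CSeq (comp r d.+1 e2)
      (Loop d.+1 (CIf d.+3 isSome (Dec d) CSkip)))
  | Sum e1 e2 => CSeq (comp r d.+1 e1) (CSeq (Loop d.+1
      (CSeq (comp (d.+2 :: r) d.+3 e2) (CSeq (AddTo d d.+3) (Inc d.+2)))) (Clear d.+2))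
  | Shift e => comp (behead r) d e
  end.

Definition ready (r : seq nat) (d : nat) (s : seq nat) (a : rstate) :=
  [/\ rs_head a = 0, all (fun i => i < d) r, s = map (rs_reg a) r &
      forall i, d <= i -> rs_reg a i = 0].

Lemma ready_set r d s a v :
  ready r d s a -> ready r d.+1 s (set_reg a d v).
Proof.
move=> [h rd -> z]; split=> //.
- by apply: sub_all rd => i /ltnW; rewrite ltnS.
- by apply/eq_in_map => i ir /=; rewrite upd_neq // ltn_eqF //; move/allP: rd; apply.
- by move=> i di; rewrite /= upd_neq ?z // ?gtn_eqF // ltnW.
Qed.

Lemma ready_S r d s a : ready r d s a -> ready r d.+1 s a.
Proof.
move=> R; have z : rs_reg a d = 0 by case: R => _ _ _; apply.
have -> : a = set_reg a d 0 by rstate_eq.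
exact: ready_set.
Qed.

Lemma aruns_while O x j p c (f : nat -> rstate) N B :
  (forall i, i <= N -> p ((conc x (f i) j).2 0) = (i < N)) ->
  (forall i, i < N -> aruns O x c (f i) (f i.+1) B) ->
  aruns O x (CWhile j p c) (f 0) (f N) (N * (B + 2) + 1).
Proof.
elim: N f => [|N IH] f H1 H2.
  by exists 1 => //; apply: EWhileF; rewrite H1.
have [||t tn Ht] := IH (fun i => f i.+1).
- by move=> i iN; rewrite H1.
- by move=> i iN; apply: H2.
have [t2 t2n Ht2] := H2 0 isT.
exists (t2.+2 + t); first by nia.
by apply: EWhileT Ht2 Ht; rewrite H1.
Qed.

Lemma aruns_if_tape O x j (p : pred sym) c1 c2 a a' n :
  (p ((conc x a j).2 0) -> aruns O x c1 a a' n) ->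
  (~~ p ((conc x a j).2 0) -> aruns O x c2 a a' n) ->
  aruns O x (CIf j p c1 c2) a a' n.+2.
Proof.
move=> H1 H2; case: (boolP (p ((conc x a j).2 0))) => E.
  have [t tn H] := H1 E; exists t.+1; first exact: leq_trans tn _.
  exact: EIfT.
by have [t tn H] := H2 E; exists t.+2 => //; apply: EIfF.
Qed.

(** [C] bounds the time. The bound [B] on the value is needed as well, because values become the
    numbers of turns of later loops. *)
Definition comp_ok (e : expr) (B C : nat -> nat) :=
  forall n x s, size x <= n -> (forall k, nth 0 s k <= n) -> ev x s e <= B n /\
    forall O r d a, ready r d s a ->
      aruns O x (comp r d e) a (set_reg a d (ev x s e)) (C n).

(** Reading a counter destroys it: the register is emptied into both [d] and [d.+1], then refilled
    from [d.+1]. *)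
Lemma comp_ok_var k : comp_ok (Var k) id (fun n => (n * 7 + 1) + (n * 5 + 1)).
Proof.
move=> n x s xn sn; split=> [|O r d a R]; first exact: sn.
case: (R) => h rd es z; rewrite [comp _ _ _]/=; case: ifP => kr; last first.
  apply: aruns_eq (aruns_skip _ _ _) _ _ _ => //; rewrite /= nth_default; last first.
    by rewrite es size_map leqNgt kr.
  by move: (z d (leqnn d)) => zd; rstate_eq.
set q := nth 0 r k; have qd : q < d by move/all_nthP: rd; apply.
set v := ev x s (Var k).
have vE : v = rs_reg a q by rewrite /v /= es (nth_map 0).
have vn : v <= n by apply: sn.
pose f i := set_reg (set_reg (set_reg a q (v - i)) d i) d.+1 i.
have zd := z d (leqnn d); have zd1 := z d.+1 (leqnSn d).
apply: (@aruns_eq _ _ _ (f 0) _ _ _ ((v * 7 + 1) + (v * 5 + 1))).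
- apply: aruns_seq.
  + apply: (@aruns_loop _ _ _ _ f v 4).
      by move=> i iv; rewrite /f; upd_tac.
    move=> i iv; apply: aruns_eq (aruns_seq (aruns_inc _ _ _ _) (aruns_inc _ _ _ _)) erefl _ _ => //.
    by rstate_eq.
  + by apply: aruns_eq (aruns_addto _ _ _ _) erefl erefl _ => //; [lia|rewrite /f; upd_tac].
- by rstate_eq.
- by rewrite /f; rstate_eq; upd_tac.
- lia.
Qed.

Lemma comp_ok_cst c : comp_ok (Cst c) (fun=> c) (fun=> 2 * c).
Proof.
move=> n x s xn sn; split=> // O r d a R.
have zd : rs_reg a d = 0 by case: R => _ _ _; apply.
suff H k b : aruns O x (iter k (fun k => CSeq (Inc d) k) CSkip) b
    (set_reg b d (rs_reg b d + k)) (2 * k).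
  by apply: aruns_eq (H c a) _ _ _ => //; rewrite zd.
elim: k b => [|k IH] b.
  by apply: aruns_eq (aruns_skip _ _ _) _ _ _ => //; rstate_eq.
apply: aruns_eq (aruns_seq (aruns_inc _ _ _ _) (IH _)) _ _ _ => //; last lia.
by rstate_eq; upd_tac.
Qed.

Lemma comp_ok_len : comp_ok Len id (fun n => (n * 7 + 1) + (n * 4 + 1)).
Proof.
move=> n x s xn sn; split=> // O r d a [h rd es z].
have zd := z d (leqnn d); have zd1 := z d.+1 (leqnSn d).
pose f i := set_head (set_reg (set_reg a d i) d.+1 i) i.
apply: (@aruns_eq _ _ _ (f 0) _ _ _ ((size x * 7 + 1) + (size x * 4 + 1))).
- apply: aruns_seq.
  + apply: (@aruns_while _ _ _ _ _ f (size x) 5).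
      move=> i ix; rewrite /= addn0; case: ltnP => xi; last by rewrite nth_default ?size_map.
      by rewrite (nth_map false).
    move=> i ix; apply: aruns_eq (aruns_seq (aruns_mover _ _ _) (aruns_seq (aruns_inc _ _ _ _) (aruns_inc _ _ _ _))) erefl _ _ => //.
    by rstate_eq.
  + by apply: aruns_eq (aruns_rewind _ _ _) erefl erefl _; rewrite /f; upd_tac.
- by rewrite /f; apply: rstate_ext => // q; upd_tac.
- by rewrite /f; apply: rstate_ext => // q; upd_tac.
- by lia.
Qed.

(** Register [d.+2] records how far the input head has moved, for the way back. A position past the
    end of the input scans a blank and contributes 0. *)
Lemma comp_ok_bit e B C : comp_ok e B C ->
  comp_ok (Bit e) (fun=> 1)
    (fun n => C n + ((B n * 6 + 1) + (4 + (B n * 4 + 1)))).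
Proof.
move=> H n x s xn sn; have [Hb He] := H n x s xn sn.
split=> [|O r d a R]; first exact: leq_b1.
have h := let: And4 h _ _ _ := R in h; have z := let: And4 _ _ _ z := R in z.
have zd := z d (leqnn d); have zd1 := z d.+1 (leqnSn d).
have zd2 := z d.+2 (leqW (leqnSn d)).
rewrite [comp _ _ _]/= [ev _ _ _]/=.
set v := ev x s e in Hb He *.
pose f i := set_head (set_reg (set_reg a d.+1 (v - i)) d.+2 i) i.
pose b : nat := nth false x v.
apply: (@aruns_eq _ _ _ _ _ _ _ (C n + ((v * 6 + 1) + (4 + (v * 4 + 1))))).
- apply: aruns_seq; first exact: He (ready_S R).
  apply: aruns_seq.
    apply: (@aruns_eq _ _ _ (f 0) (f v) _ _ (v * (3 + 3) + 1)) => //.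
      apply: aruns_loop => i iv; first by rewrite /f; upd_tac.
      by apply: aruns_eq (aruns_seq (aruns_mover _ _ _) (aruns_inc _ _ _ _)) erefl _ _ => //; rstate_eq.
    by rewrite /f; apply: rstate_ext => // q; upd_tac.
  apply: (@aruns_seq _ _ _ _ _ (set_reg (f v) d b)).
    apply: aruns_if_tape; rewrite /f /= addn0.
    + move=> H1; apply: aruns_eq (aruns_inc _ _ _ _) erefl _ _ => //.
      have -> : b = 1.
        rewrite /b; case: (ltnP v (size x)) H1 => vx; last by rewrite nth_default ?size_map.
        by rewrite (nth_map false) //; case: (nth _ _ _).
      by rstate_eq; upd_tac.
    + move=> H1; apply: (aruns_eq (n := 0)) (aruns_skip _ _ _) erefl _ _ => //.
      have -> : b = 0.
        rewrite /b; case: (ltnP v (size x)) H1 => vx; last by rewrite [nth false _ _]nth_default.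
        by rewrite (nth_map false) //; case: (nth _ _ _).
      by rstate_eq; upd_tac.
  by apply: aruns_eq (aruns_rewind _ _ _) erefl erefl _; rewrite /f; upd_tac.
- by [].
- by rewrite /f; apply: rstate_ext => // q; upd_tac.
- by nia.
Qed.

Lemma comp_ok_add e1 e2 B1 C1 B2 C2 : comp_ok e1 B1 C1 -> comp_ok e2 B2 C2 ->
  comp_ok (Add e1 e2) (fun n => B1 n + B2 n)
    (fun n => C1 n + (C2 n + (B2 n * 5 + 1))).
Proof.
move=> H1 H2 n x s xn sn; have [Hb1 He1] := H1 n x s xn sn.
have [Hb2 He2] := H2 n x s xn sn; split=> [|O r d a R]; first exact: leq_add.
have z := let: And4 _ _ _ z := R in z.
have zd := z d (leqnn d); have zd1 := z d.+1 (leqnSn d).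
apply: (@aruns_eq _ _ _ a _ _ _ (C1 n + (C2 n + (ev x s e2 * 5 + 1)))).
- apply: aruns_seq (He1 _ _ _ _ R) (aruns_seq (He2 _ _ _ _ (ready_set _ R)) _).
  by apply: aruns_eq (aruns_addto _ _ _ _) erefl erefl _; [lia|upd_tac].
- by [].
- by rstate_eq; upd_tac.
- by nia.
Qed.

(** The index [d.+3] in the test of the code is the tape of register [d]. The decrement is skipped
    once that register is empty, which makes the subtraction truncated. *)
Lemma comp_ok_sub e1 e2 B1 C1 B2 C2 : comp_ok e1 B1 C1 -> comp_ok e2 B2 C2 ->
  comp_ok (Sub e1 e2) B1 (fun n => C1 n + (C2 n + (B2 n * 6 + 1))).
Proof.
move=> H1 H2 n x s xn sn; have [Hb1 He1] := H1 n x s xn sn.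
have [Hb2 He2] := H2 n x s xn sn.
split=> [|O r d a R]; first by apply: leq_trans Hb1; apply: leq_subr.
have z := let: And4 _ _ _ z := R in z.
have zd := z d (leqnn d); have zd1 := z d.+1 (leqnSn d).
rewrite [comp _ _ _]/= [ev _ _ _]/=.
set v := ev x s e1 in Hb1 He1 *; set w := ev x s e2 in Hb2 He2 *.
pose f i := set_reg (set_reg a d (v - i)) d.+1 (w - i).
apply: (@aruns_eq _ _ _ a _ _ _ (C1 n + (C2 n + (w * 6 + 1)))).
- apply: aruns_seq (He1 _ _ _ _ R) (aruns_seq (He2 _ _ _ _ (ready_set _ R)) _).
  apply: (@aruns_eq _ _ _ (f 0) (f w) _ _ (w * (3 + 3) + 1)) => //.
    apply: aruns_loop => i iv; first by rewrite /f; upd_tac.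
    apply: aruns_if => Hr.
      apply: aruns_eq (@aruns_dec _ _ _ _ (v - i.+1) _) erefl _ _ => //.
        by move: Hr; rewrite /f; upd_tac.
      by rewrite /f; rstate_eq; upd_tac.
    apply: (aruns_eq (n := 0)) (aruns_skip _ _ _) erefl _ _ => //.
    by move: Hr; rewrite /f => Hr; rstate_eq; move: Hr; upd_tac.
  by rewrite /f; rstate_eq; upd_tac.
- by [].
- by rewrite /f; rstate_eq; upd_tac.
- by nia.
Qed.

(** The body runs in an environment extended by the index, which is below [B1 n]; its bounds are
    therefore taken at [n + B1 n]. *)
Lemma comp_ok_sum e1 e2 B1 C1 B2 C2 : comp_ok e1 B1 C1 -> comp_ok e2 B2 C2 ->
  comp_ok (Sum e1 e2) (fun n => B1 n * B2 (n + B1 n))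
    (fun n => C1 n + ((B1 n * ((C2 (n + B1 n) + ((B2 (n + B1 n) * 5 + 1) + 2)) + 3) + 1)
       + (B1 n * 3 + 1))).
Proof.
move=> H1 H2 n x s xn sn; have [Hb1 He1] := H1 n x s xn sn.
set v := ev x s e1 in Hb1 He1 *; set n2 := n + B1 n.
have xn2 : size x <= n2 by rewrite (leq_trans xn) // leq_addr.
have sn2 i : i < v -> forall k, nth 0 (i :: s) k <= n2.
  move=> iv [|k] /=; first by rewrite /n2; lia.
  by rewrite (leq_trans (sn k)) // leq_addr.
pose S i := \sum_(j < i) ev x (val j :: s) e2.
have SS i : S i.+1 = S i + ev x (i :: s) e2 by rewrite /S big_ord_recr.
split=> [|O r d a R].
  rewrite /= -/v -/(S v); apply: (@leq_trans (v * B2 n2)); last by rewrite leq_mul.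
  suff: forall i, i <= v -> S i <= i * B2 n2 by apply.
  elim=> [|i IH] iv; first by rewrite /S big_ord0.
  rewrite SS mulSn addnC; apply: leq_add; last exact: IH (ltnW iv).
  by case: (H2 n2 x (i :: s) xn2 (sn2 i iv)).
case: (R) => h rd es z.
have zd := z d (leqnn d); have zd1 := z d.+1 (leqnSn d).
have zd2 := z d.+2 (leqW (leqnSn d)).
have zd3 := z d.+3 (leqW (leqW (leqnSn d))).
rewrite [comp _ _ _]/= [ev _ _ _]/= -/v -/(S v).
pose f i := set_reg (set_reg (set_reg a d.+1 (v - i)) d.+2 i) d (S i).
have S0 : S 0 = 0 by rewrite /S big_ord0.
apply: (@aruns_eq _ _ _ a _ _ _ (C1 n + ((v * ((C2 n2 + ((B2 n2 * 5 + 1) + 2)) + 3) + 1)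
       + (v * 3 + 1)))).
- apply: aruns_seq (He1 _ _ _ _ (ready_S R)) (aruns_seq (a2 := f v) _ _).
  + apply: (@aruns_eq _ _ _ (f 0) _ _ _ _ _ _ _ erefl (leqnn _)).
      apply: aruns_loop => i iv; first by rewrite /f; upd_tac.
      set b := set_reg _ _ _.
      have [Hb2 He2] := H2 n2 x (i :: s) xn2 (sn2 i iv).
      apply: (@aruns_seq _ _ _ _ _ (set_reg b d.+3 (ev x (i :: s) e2))).
        apply: He2; split.
        * by rewrite /b /f.
        * by apply/andP; split=> //; apply: sub_all rd => q /= qd; rewrite !ltnS ltnW // ltnW // ltnW.
        * rewrite /b /f [RHS]/=; congr cons; first by upd_tac.
          rewrite es; apply/eq_in_map => q qr.
          have qd : q < d by move/allP: rd; apply.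
          by upd_tac.
        * by move=> q dq; rewrite /b /f; upd_tac; apply: z; lia.
      apply: aruns_seq.
        by apply: aruns_eq (aruns_addto _ _ _ _) erefl erefl _; [lia|rewrite /b /f; upd_tac].
      apply: aruns_eq (aruns_inc _ _ _ _) erefl _ _ => //.
      by rewrite /b /f; apply: rstate_ext => // q; have := SS i; upd_tac.
    by rewrite /f; apply: rstate_ext => // q; upd_tac.
  + by apply: aruns_eq (aruns_clear _ _ _ _) erefl erefl _; rewrite /f; upd_tac.
- by [].
- by rewrite /f; apply: rstate_ext => // q; upd_tac.
- have vB : v * ((C2 n2 + ((B2 n2 * 5 + 1) + 2)) + 3) <=
     B1 n * ((C2 n2 + ((B2 n2 * 5 + 1) + 2)) + 3) by rewrite leq_mul.
  by lia.
Qed.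

Lemma comp_ok_shift e B C : comp_ok e B C -> comp_ok (Shift e) B C.
Proof.
move=> H n x s xn sn; have [|Hb He] := H n x (behead s) xn.
  by move=> k; rewrite nth_behead.
split=> // O r d a [h rd es z]; apply: He; split=> //.
- by case: r rd {es} => //= q r /andP[].
- by rewrite es; case: r {rd es}.
Qed.

Lemma comp_correct e : exists B C, [/\ polyb B, polyb C & comp_ok e B C].
Proof.
elim: e => [k|c||e [B [C [pB pC H]]]|e1 [B1 [C1 [pB1 pC1 H1]]] e2 [B2 [C2 [pB2 pC2 H2]]]
  |e1 [B1 [C1 [pB1 pC1 H1]]] e2 [B2 [C2 [pB2 pC2 H2]]]
  |e1 [B1 [C1 [pB1 pC1 H1]]] e2 [B2 [C2 [pB2 pC2 H2]]]|e [B [C [pB pC H]]]].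
- by do 2!eexists; split; last exact: comp_ok_var; polyb_tac.
- by do 2!eexists; split; last exact: comp_ok_cst; polyb_tac.
- by do 2!eexists; split; last exact: comp_ok_len; polyb_tac.
- by do 2!eexists; split; last exact: comp_ok_bit H; polyb_tac.
- by do 2!eexists; split; last exact: comp_ok_add H1 H2; polyb_tac.
- by do 2!eexists; split; last exact: comp_ok_sub H1 H2; polyb_tac.
- by do 2!eexists; split; last exact: comp_ok_sum H1 H2; polyb_tac.
- by do 2!eexists; split; last exact: comp_ok_shift H; polyb_tac.
Qed.

(** * Words generated by nested loops *)

Inductive gen :=
  | GEmit of expr
  | GCat of gen & gen
  | GFor of expr & gen.

Fixpoint gv (x : seq bool) (s : seq nat) (g : gen) : seq bool :=
  match g with
  | GEmit e => [:: 0 < ev x s e]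
  | GCat g1 g2 => gv x s g1 ++ gv x s g2
  | GFor e g => flatten [seq gv x (i :: s) g | i <- iota 0 (ev x s e)]
  end.

Fixpoint gcomp (ask : bool) (r : seq nat) (d : nat) (g : gen) : cmd :=
  match g with
  | GEmit e => CSeq (comp r d e)
      (CIf d.+3 isSome (CSeq (Clear d) (Emit ask true)) (Emit ask false))
  | GCat g1 g2 => CSeq (gcomp ask r d g1) (gcomp ask r d g2)
  | GFor e g => CSeq (comp r d e)
      (CSeq (Loop d (CSeq (gcomp ask (d.+1 :: r) d.+2 g) (Inc d.+1))) (Clear d.+1))
  end.

Lemma ready_emit r d s ask a w : ready r d s a -> ready r d s (emit_to ask a w).
Proof. by case. Qed.

Lemma emit_to_cat ask a w1 w2 : emit_to ask (emit_to ask a w1) w2 = emit_to ask a (w1 ++ w2).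
Proof. by rewrite /emit_to /=; case: ask; rewrite ?catA. Qed.

Lemma emit_to_nil ask a : emit_to ask a [::] = a.
Proof. by rewrite /emit_to; case: a => ? ? ? ?; case: ask; rewrite ?cats0. Qed.

Lemma emit_to_set_reg ask a w r v :
  emit_to ask (set_reg a r v) w = set_reg (emit_to ask a w) r v.
Proof. by []. Qed.

Definition gcomp_ok (g : gen) (C : nat -> nat) :=
  forall n x s, size x <= n -> (forall k, nth 0 s k <= n) ->
    forall O ask r d a, ready r d s a ->
      aruns O x (gcomp ask r d g) a (emit_to ask a (gv x s g)) (C n).

Lemma gcomp_correct g : exists2 C, polyb C & gcomp_ok g C.
Proof.
elim: g => [e|g1 [C1 pC1 H1] g2 [C2 pC2 H2]|e g [C2 pC2 H2]].
- have [B [C [pB pC H]]] := comp_correct e.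
  exists (fun n => C n + (B n * 3 + 4)); first by polyb_tac.
  move=> n x s xn sn O ask r d a R; have [Hb He] := H n x s xn sn.
  have zd : rs_reg a d = 0 by case: R => _ _ _; apply.
  rewrite [gcomp _ _ _ _]/= [gv _ _ _]/=.
  apply: aruns_seq (He _ _ _ _ R) _.
  rewrite addnS addnS; apply: aruns_if; rewrite [rs_reg _ _]/= upd_eq => v0.
    apply: aruns_eq (aruns_seq (aruns_clear _ _ _ _) (aruns_emit _ _ _ _ _)) erefl _ _.
      by rewrite v0 !emit_to_set_reg; rstate_eq; upd_tac.
    by rewrite [rs_reg _ _]/= upd_eq; lia.
  apply: aruns_eq (aruns_emit _ _ _ _ _) erefl _ _; last lia.
  by rewrite v0 !emit_to_set_reg; rstate_eq; upd_tac.
- exists (fun n => C1 n + C2 n); first by polyb_tac.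
  move=> n x s xn sn O ask r d a R.
  have := aruns_seq (H1 _ _ _ xn sn O ask _ _ _ R) (H2 _ _ _ xn sn O ask _ _ _ (ready_emit _ _ R)).
  by rewrite emit_to_cat.
- have [B [C [pB pC H]]] := comp_correct e.
  exists (fun n => C n + ((B n * ((C2 (n + B n) + 2) + 3) + 1) + (B n * 3 + 1))).
    by polyb_tac.
  move=> n x s xn sn O ask r d a R; have [Hb He] := H n x s xn sn.
  case: (R) => h rd es z.
  have zd := z d (leqnn d); have zd1 := z d.+1 (leqnSn d).
  have zd2 := z d.+2 (leqW (leqnSn d)).
  rewrite [gcomp _ _ _ _]/= [gv _ _ _]/=.
  set v := ev x s e in Hb He *; set n2 := n + B n.
  pose S i := flatten [seq gv x (j :: s) g | j <- iota 0 i].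
  pose f i := set_reg (set_reg (emit_to ask a (S i)) d (v - i)) d.+1 i.
  have SS i : S i.+1 = S i ++ gv x (i :: s) g.
    by rewrite /S -(addn1 i) iotaD map_cat flatten_cat /= cats0.
  apply: (@aruns_eq _ _ _ a _ _ _ (C n + ((v * ((C2 n2 + 2) + 3) + 1) + (v * 3 + 1)))).
  + apply: aruns_seq (He _ _ _ _ R) (aruns_seq (a2 := f v) _ _).
    * apply: (@aruns_eq _ _ _ (f 0) _ _ _ _ _ _ _ erefl (leqnn _)).
        apply: aruns_loop => i iv; first by rewrite /f; upd_tac.
        set b := set_reg _ _ _.
        have Hg := H2 n2 x (i :: s) _ _ O ask (d.+1 :: r) d.+2 b _.
        apply: aruns_eq (aruns_seq (Hg _ _ _) (aruns_inc _ _ _ _)) erefl _ _ => //.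
        - by rewrite (leq_trans xn) // leq_addr.
        - by move=> [|k] /=; [rewrite /n2; lia | rewrite (leq_trans (sn k)) // leq_addr].
        - split.
          - by rewrite /b /f.
          - by apply/andP; split=> //; apply: sub_all rd => q /= qd; rewrite !ltnS ltnW // ltnW.
          - rewrite /b /f [RHS]/=; congr cons; first by upd_tac.
            rewrite es; apply/eq_in_map => q qr.
            have qd : q < d by move/allP: rd; apply.
            by upd_tac.
          - by move=> q dq; rewrite /b /f; upd_tac; apply: z; lia.
        - rewrite /b /f SS -emit_to_cat; apply: rstate_ext => //= q; upd_tac.
      rewrite /f /S /= emit_to_nil; apply: rstate_ext => // q; upd_tac.
    * by apply: aruns_eq (aruns_clear _ _ _ _) erefl erefl _; rewrite /f; upd_tac.
  + by [].
  + by rewrite /f -/(S v); apply: rstate_ext => // q; upd_tac.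
  + have vB : v * ((C2 n2 + 2) + 3) <= B n * ((C2 n2 + 2) + 3) by rewrite leq_mul.
    by lia.
Qed.

(** * From commands to polynomial-time machines *)

Fixpoint no_query (c : cmd) : bool :=
  match c with
  | CSkip | CAct _ _ _ => true
  | CSeq c1 c2 | CIf _ _ c1 c2 => no_query c1 && no_query c2
  | CWhile _ _ c => no_query c
  | CQuery => false
  end.

Definition not_query i := if i is IQuery then false else true.

Lemma no_query_code c b : no_query c -> all not_query (code b c).
Proof.
elim: c b => //= [c1 IH1 c2 IH2|i p c1 IH1 c2 IH2|i p c IH] b.
- by move=> /andP[n1 n2]; rewrite all_cat IH1 ?IH2.
- by move=> /andP[n1 n2]; rewrite all_cat /= IH1 ?IH2.
- by move=> n; rewrite all_cat /= IH.
Qed.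

Lemma fitsW m n c : m <= n -> fits m c -> fits n c.
Proof. by move=> mn; apply: sub_all => -[i f d|i p k|] //= im; apply: leq_trans mn. Qed.

Lemma fits_exists c : exists k, fits k.+3 c.
Proof.
elim: c => [|i c [k IH]]; first by exists 0.
have [j Hj] : exists j, fits j.+3 [:: i].
  by case: i => [i f d|i p n|]; [exists i|exists i|exists 0] => //=; lia.
exists (k + j); rewrite /= (fitsW _ IH) ?andbT; last lia.
have : fits (k + j).+3 [:: i] by apply: fitsW Hj; lia.
by rewrite /= andbT.
Qed.

Definition rinit : rstate := RState 0 (fun=> 0) [::] [::].

Lemma machine_of_cmd O c (f : seq bool -> seq bool) (C : nat -> nat) : polyb C ->
  (forall x, exists t st', [/\ t <= C (size x), exec O c (conc x rinit) t st'
     & fword (f x) (st' 1)]) ->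
  exists M p, (no_query c -> forall q : state M, query q = None) /\
    computes_in_time M O f (poly_bound p).
Proof.
move=> [p Hp] H; set prog := code 0 c.
have [k fk] := fits_exists prog.
exists (code_machine k prog), p; split.
  move=> nq q /=; rewrite /code_query.
  move: (no_query_code 0 nq) => /(all_nthP (IAct 0 id Stay)) Ha.
  case: (ltnP q (size prog)) => qs; last by rewrite nth_default.
  by move: (Ha q qs); case: (nth _ _ _).
move=> x /=; have [t [st' [tC ex fw]]] := H x.
have ag : agree (conc x rinit) (init_config (code_machine k prog) x).
  move=> j; rewrite /init_config /= -val_eqE /= inordK //.
  case: j => -[|[|[|j]]] jk //=; congr pair; apply/funext => i; by rewrite ?nth_nil.
have := code_correct fk ex (pre := [::]) (post := [::]) (q := ord0) _ erefl ag.
rewrite cats0 add0n => /(_ erefl) [H1 H2].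
have tp : t <= poly_bound p (size x) by apply: leq_trans tC (Hp _).
(* The configuration no longer changes after the halting time [t], so the machine can be run up to
   the polynomial bound. *)
rewrite -(subnKC tp) run_add.
have hal : step O (run O t (init_config (code_machine k prog) x)) = None.
  by apply: step_end; rewrite [LHS]H1 -(size_code 0).
rewrite run_halted //; split=> //.
by apply: fword_leading_bits; rewrite H2 inordK.
Qed.

(** The head is one cell to the left of position [h]; for [h = 0] it scans the blank that precedes
    the word. *)
Definition left_of_ftape (x : seq bool) (h : nat) : ftape :=
  if h is h'.+1 then input_ftape x h'
  else (fun=> None, scons None (input_ftape x 0).2).

Lemma fmove_left_of x h :
  fmove ((left_of_ftape x h.+1).2 0) GoLeft (left_of_ftape x h.+1) = left_of_ftape x h.
Proof.
case: h => [|h] /=; congr pair; apply/funext => k //=.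
  by case: k => [|k] //=; rewrite /scons; case: k.
by case: k => [|[|k]] /=; rewrite ?addn0 ?addn1 ?subn1 // /stail /=; congr nth; lia.
Qed.

Lemma output_input_ftape o : output_ftape o = input_ftape o (size o).
Proof.
congr pair; apply/funext => k; last by rewrite nth_default // size_map leq_addr.
case: ltnP => ko; last by rewrite nth_default // size_rev size_map.
by rewrite nth_rev size_map.
Qed.

Lemma absT_tape_of_word w : absT (tape_of_word _ w) = input_ftape w 0.
Proof. by congr pair; apply/funext => k; rewrite ?nth_nil. Qed.

Lemma fword_input_ftape w : fword w (input_ftape w 0).
Proof.
split=> [k kw|] /=; first by rewrite (nth_map false).
by rewrite nth_default ?size_map.
Qed.

(** No register holds the position here: the head goes left up to the blank before the word, then
    one cell back. *)
Definition RewindWord j := CSeq (CAct j id GoLeft)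
  (CSeq (CWhile j isSome (CAct j id GoLeft)) (CAct j id GoRight)).

Lemma upd_upd T (f : nat -> T) i u v : upd (upd f i u) i v = upd f i v.
Proof. by apply/funext => k; rewrite /upd; case: eqP. Qed.

Lemma exec_rewind O j st o : st j = output_ftape o ->
  exists2 t, t <= size o * 3 + 3 &
    exec O (RewindWord j) st t (upd st j (input_ftape o 0)).
Proof.
move=> E.
have W h : h <= size o ->
    exec O (CWhile j isSome (CAct j id GoLeft)) (upd st j (left_of_ftape o h)) (h * 3 + 1)
      (upd st j (left_of_ftape o 0)).
  elim: h => [|h IH] ho; first by apply: EWhileF; rewrite upd_eq.
  have -> : h.+1 * 3 + 1 = 1.+2 + (h * 3 + 1) by lia.
  apply: EWhileT (IH (ltnW ho)).
    by rewrite upd_eq /= addn0 (nth_map false).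
  by have := EAct O j id GoLeft (upd st j (left_of_ftape o h.+1));
    rewrite upd_eq fmove_left_of upd_upd.
exists (1 + ((size o * 3 + 1) + 1)); first lia.
apply: ESeq; last apply: ESeq (W _ (leqnn _)) _.
  have := EAct O j id GoLeft st; rewrite E output_input_ftape.
  by rewrite -/(left_of_ftape o (size o).+1) fmove_left_of.
have := EAct O j id GoRight (upd st j (left_of_ftape o 0)).
rewrite upd_eq upd_upd; congr exec; congr upd; congr pair; apply/funext => k //.
by case: k.
Qed.

(** The answer of the oracle appears on tape 2, whereas the output is read from tape 1. *)
Definition CopyWord := CWhile 2 isSome (CSeq
  (CIf 2 (pred1 (bit _ true)) (CAct 1 (fun=> bit _ true) GoRight)
     (CAct 1 (fun=> bit _ false) GoRight))
  (CAct 2 id GoRight)).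

Lemma exec_copy O st w : st 1 = output_ftape [::] -> st 2 = input_ftape w 0 ->
  exists st' t, [/\ t <= size w * 6 + 1, exec O CopyWord st t st' & st' 1 = output_ftape w].
Proof.
move=> E1 E2.
pose g i := upd (upd st 1 (output_ftape (take i w))) 2 (input_ftape w i).
have W i : i <= size w -> exists2 t, t <= i * 6 + 1 &
    exec O CopyWord (g (size w - i)) t (g (size w)).
  elim: i => [|i IH] iw.
    rewrite subn0; exists 1 => //; apply: EWhileF.
    by rewrite /g upd_eq /= addn0 nth_default // size_map.
  have [t ti Ht] := IH (ltnW iw).
  have -> : size w - i.+1 = (size w - i).-1 by lia.
  set h := (size w - i).-1; have hw : h < size w by rewrite /h; lia.
  have hE : size w - i = h.+1 by rewrite /h; lia.
  rewrite hE in Ht.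
  have sc : (g h 2).2 0 = bit _ (nth false w h).
    by rewrite /g upd_eq /= addn0 (nth_map false).
  pose m := upd (g h) 1 (output_ftape (take h.+1 w)).
  have Hm : exists2 t1, t1 <= 3 & exec O (CIf 2 (pred1 (bit _ true))
      (CAct 1 (fun=> bit _ true) GoRight) (CAct 1 (fun=> bit _ false) GoRight)) (g h) t1 m.
    have mE : m = upd (g h) 1 (fmove (bit _ (nth false w h)) GoRight (g h 1)).
      by rewrite /m (take_nth false) // -cats1 output_ftape_rcons.
    case: (boolP (nth false w h)) => nh.
      exists 2 => //; apply: EIfT; first by rewrite sc nh.
      by rewrite mE nh; exact: (EAct O 1 (fun=> bit _ true)).
    exists 3 => //; apply: EIfF; first by rewrite sc (negbTE nh).
    by rewrite mE (negbTE nh); exact: (EAct O 1 (fun=> bit _ false)).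
  have [t1 t13 H1] := Hm.
  exists ((t1 + 1).+2 + t); first lia.
  apply: EWhileT Ht; first by rewrite sc.
  apply: ESeq H1 _.
  have := EAct O 2 id GoRight m; congr exec; rewrite /m /g.
  apply/funext => -[|[|[|k]]] //=; rewrite /upd /=; congr pair; apply/funext => k.
    by case: k => [|k] //=; rewrite subn1 addn0.
  by rewrite /stail /= addSnnS.
have [t tw Ht] := W _ (leqnn _).
exists (g (size w)), t; split=> //; last by rewrite /g /upd /= take_size.
move: Ht; rewrite subnn; congr exec; rewrite /g; apply/funext => -[|[|[|k]]] //=.
by rewrite /upd /= take0.
Qed.

Lemma no_query_iter c k : no_query c -> no_query (iter k (CSeq c) CSkip).
Proof. by move=> nc; elim: k => //= k ->; rewrite nc. Qed.

Lemma no_query_comp r d e : no_query (comp r d e).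
Proof.
elim: e r d => //= [k|c|e IH|e1 IH1 e2 IH2|e1 IH1 e2 IH2|e1 IH1 e2 IH2] r d;
  rewrite ?IH ?IH1 ?IH2 //; first by case: ifP.
exact: no_query_iter.
Qed.

Lemma no_query_gcomp ask r d g : no_query (gcomp ask r d g).
Proof.
by elim: g r d => //= [e|g1 IH1 g2 IH2|e g IH] r d;
  rewrite ?no_query_comp ?IH ?IH1 ?IH2.
Qed.

Lemma gen_run g : exists2 C, polyb C & forall x O ask,
  aruns O x (gcomp ask [::] 0 g) rinit (emit_to ask rinit (gv x [::] g)) (C (size x)) /\
  size (gv x [::] g) <= C (size x).
Proof.
have [C pC H] := gcomp_correct g.
suff [D pD HD] : exists2 D, polyb D & forall n x s, size x <= n -> (forall k, nth 0 s k <= n) ->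
    size (gv x s g) <= D n.
  exists (fun n => C n + D n); first by polyb_tac.
  move=> x O ask; split.
    by apply: aruns_eq (H _ _ [::] (leqnn _) _ O ask [::] 0 rinit _) _ _ (leq_addr _ _) => // k; rewrite nth_nil.
  by apply: leq_trans (HD (size x) x [::] _ _) _; rewrite ?leq_addl // => k; rewrite nth_nil.
elim: {C pC H} g => [e|g1 [D1 pD1 H1] g2 [D2 pD2 H2]|e g [D pD H]].
- by exists (fun=> 1) => //; polyb_tac.
- exists (fun n => D1 n + D2 n) => [|n x s xn sn]; first by polyb_tac.
  by rewrite size_cat leq_add // ?H1 ?H2.
- have [B [C [pB pC He]]] := comp_correct e.
  exists (fun n => B n * D (n + B n)) => [|n x s xn sn]; first by polyb_tac.
  have [Hb _] := He n x s xn sn.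
  rewrite /=; apply: (@leq_trans (ev x s e * D (n + B n))); last by rewrite leq_mul.
  suff: forall i, i <= ev x s e ->
      size (flatten [seq gv x (i :: s) g | i <- iota 0 i]) <= i * D (n + B n) by apply.
  elim=> [|i IH] iv //.
  rewrite -(addn1 i) iotaD map_cat flatten_cat size_cat /= cats0 addn1 mulSn addnC.
  apply: leq_add; last exact: IH (ltnW iv).
  apply: H; first by rewrite (leq_trans xn) // leq_addr.
  by move=> [|k] /=; [lia | rewrite (leq_trans (sn k)) // leq_addr].
Qed.

Theorem gen_in_FP g : in_FP (fun x => gv x [::] g).
Proof.
have [C pC H] := gen_run g.
pose c := CSeq (gcomp false [::] 0 g) (RewindWord 1).
have [||M [p [nq HM]]] := @machine_of_cmd id c (fun x => gv x [::] g) (fun n => C n + (C n * 3 + 3)).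
- by polyb_tac.
- move=> x; have [[t1 t1C H1] sC] := H x id false.
  have [|t2 t2o H2] := @exec_rewind id 1 (conc x (emit_to false rinit (gv x [::] g))) (gv x [::] g).
    by [].
  exists (t1 + t2); eexists; split; [lia|exact: ESeq H1 H2|].
  by rewrite upd_eq; exact: fword_input_ftape.
exists M, p; split=> //; apply: nq; by rewrite /= no_query_gcomp.
Qed.

(** A single query is made. [D] bounds the length of its answer, hence the time to copy it. *)
Theorem gen_in_FP_oracle O g (D : nat -> nat) : polyb D ->
  (forall x, size (O (gv x [::] g)) <= D (size x)) ->
  in_FP_oracle O (fun x => O (gv x [::] g)).
Proof.
move=> pD HD; have [C pC H] := gen_run g.
pose c := CSeq (gcomp true [::] 0 g) (CSeq (RewindWord 2) (CSeq CQuery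
   (CSeq CopyWord (RewindWord 1)))).
have [||M [p [_ HM]]] := @machine_of_cmd O c (fun x => O (gv x [::] g))
   (fun n => C n + ((C n * 3 + 3) + (1 + ((D n * 6 + 1) + (D n * 3 + 3))))).
- by polyb_tac.
- move=> x; have [[t1 t1C H1] sC] := H x O true.
  set w := gv x [::] g in H1 sC *; set st1 := conc x (emit_to _ _ _) in H1.
  have [|t2 t2o H2] := @exec_rewind O 2 st1 w; first by [].
  set st2 := upd _ _ _ in H2.
  have H3 : exec O CQuery st2 1 (upd st2 2 (absT (tape_of_word _ (O w)))).
    by apply: EQuery; rewrite /st2 upd_eq; exact: fword_input_ftape.
  set st3 := upd st2 _ _ in H3.
  have [||st4 [t4 [t4w H4 E4]]] := @exec_copy O st3 (O w).
  + by [].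
  + by rewrite /st3 upd_eq absT_tape_of_word.
  have [t5 t5o H5] := exec_rewind O E4.
  exists (t1 + (t2 + (1 + (t4 + t5)))); eexists; split.
  + by have := HD x; rewrite -/w; lia.
  + exact: ESeq H1 (ESeq H2 (ESeq H3 (ESeq H4 H5))).
  + by rewrite upd_eq; exact: fword_input_ftape.
by exists M, p.
Qed.

(** * Definable functions *)

(** Functions of an input word and an environment given by an expression or a
    generator: these classes are closed under the usual operations, so that
    polynomial-time computability is read off the shape of a definition. *)
Definition Df (f : seq bool -> seq nat -> nat) :=
  exists e, forall x s, ev x s e = f x s.

Definition Db (f : seq bool -> seq nat -> bool) :=
  Df (fun x s => nat_of_bool (f x s)).

Definition Dg (f : seq bool -> seq nat -> seq bool) :=
  exists g, forall x s, gv x s g = f x s.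

Lemma Df_eq f g : Df g -> (forall x s, f x s = g x s) -> Df f.
Proof. by move=> [e H] fg; exists e => x s; rewrite H fg. Qed.

Lemma Db_eq (f g : seq bool -> seq nat -> bool) : Db g -> (forall x s, f x s = g x s) -> Db f.
Proof. by move=> H fg; apply: Df_eq H _ => x s; rewrite fg. Qed.

Lemma Df_var k : Df (fun x s => nth 0 s k).
Proof. by exists (Var k). Qed.

Lemma Df_cst c : Df (fun x s => c).
Proof. by exists (Cst c). Qed.

Lemma Df_len : Df (fun x s => size x).
Proof. by exists Len. Qed.

Lemma Db_bit f : Df f -> Db (fun x s => nth false x (f x s)).
Proof. by move=> [e H]; exists (Bit e) => x s /=; rewrite H. Qed.

Lemma Df_add f g : Df f -> Df g -> Df (fun x s => f x s + g x s).
Proof. by move=> [e H] [e' H']; exists (Add e e') => x s /=; rewrite H H'. Qed.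

Lemma Df_sub f g : Df f -> Df g -> Df (fun x s => f x s - g x s).
Proof. by move=> [e H] [e' H']; exists (Sub e e') => x s /=; rewrite H H'. Qed.

Lemma Df_shift f : Df f -> Df (fun x s => f x (behead s)).
Proof. by move=> [e H]; exists (Shift e) => x s /=; rewrite H. Qed.

Lemma Df_sum f g : Df f -> Df g ->
  Df (fun x s => \sum_(i < f x s) g x (val i :: s)).
Proof.
move=> [e H] [e' H']; exists (Sum e e') => x s /=; rewrite H.
by apply: eq_bigr => i _; rewrite H'.
Qed.

Lemma Df_mul f g : Df f -> Df g -> Df (fun x s => f x s * g x s).
Proof.
move=> Hf Hg; apply: Df_eq (Df_sum Hf (Df_shift Hg)) _ => x s /=.
by rewrite sum_nat_const card_ord.
Qed.

(** [1 - (g x s - i)] singles out the last index. *)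
Lemma Df_let f g : Df f -> Df g -> Df (fun x s => f x (g x s :: s)).
Proof.
move=> Hf Hg.
apply: Df_eq (Df_sum (Df_add Hg (Df_cst 1))
  (Df_mul Hf (Df_sub (Df_cst 1) (Df_sub (Df_shift Hg) (Df_var 0))))) _ => x s /=.
rewrite addn1 big_ord_recr /= subnn muln1 big1 // => i _.
by have := ltn_ord i; rewrite -subn_gt0; case: (g x s - i) => // m _; rewrite subSS sub0n muln0.
Qed.

(** Definability need only be checked on variables; substitution then gives it for all definable
    arguments. *)
Lemma Df_app1 (f : seq bool -> nat -> nat) g : Df (fun x s => f x (nth 0 s 0)) ->
  Df g -> Df (fun x s => f x (g x s)).
Proof. exact: Df_let. Qed.

Lemma Df_app2 (f : seq bool -> nat -> nat -> nat) g0 g1 :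
  Df (fun x s => f x (nth 0 s 0) (nth 0 s 1)) ->
  Df g0 -> Df g1 -> Df (fun x s => f x (g0 x s) (g1 x s)).
Proof. by move=> H H0 H1; apply: (Df_let (Df_let H (Df_shift H0)) H1). Qed.

Lemma Db_app2 (f : seq bool -> nat -> nat -> bool) g0 g1 :
  Db (fun x s => f x (nth 0 s 0) (nth 0 s 1)) ->
  Df g0 -> Df g1 -> Db (fun x s => f x (g0 x s) (g1 x s)).
Proof. exact: (Df_app2 (f := fun x a b => nat_of_bool (f x a b))). Qed.

Lemma Db_neg f : Db f -> Db (fun x s => ~~ f x s).
Proof.
by move=> H; apply: Df_eq (Df_sub (Df_cst 1) H) _ => x s; case: (f x s).
Qed.

Lemma Db_and f g : Db f -> Db g -> Db (fun x s => f x s && g x s).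
Proof. by move=> H H'; apply: Df_eq (Df_mul H H') _ => x s; case: (f x s); case: (g x s). Qed.

Lemma Db_or f g : Db f -> Db g -> Db (fun x s => f x s || g x s).
Proof.
move=> H H'; apply: Db_eq (Db_neg (Db_and (Db_neg H) (Db_neg H'))) _ => x s.
by case: (f x s); case: (g x s).
Qed.

Lemma Db_imp f g : Db f -> Db g -> Db (fun x s => f x s ==> g x s).
Proof.
by move=> H H'; apply: Db_eq (Db_or (Db_neg H) H') _ => x s; rewrite implybE.
Qed.

Lemma Db_pos f : Df f -> Db (fun x s => 0 < f x s).
Proof.
move=> H; apply: Df_eq (Df_sub (Df_cst 1) (Df_sub (Df_cst 1) H)) _ => x s.
by case: (f x s) => // n; rewrite /= subSS sub0n.
Qed.

Lemma Db_leq f g : Df f -> Df g -> Db (fun x s => f x s <= g x s).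
Proof.
move=> H H'; apply: Db_eq (Db_neg (Db_pos (Df_sub H H'))) _ => x s.
by rewrite subn_gt0 -leqNgt.
Qed.

Lemma Db_ltn f g : Df f -> Df g -> Db (fun x s => f x s < g x s).
Proof. by move=> H H'; apply: (Db_eq (Db_leq (Df_add (Df_cst 1) H) H')). Qed.

Lemma Db_eqn f g : Df f -> Df g -> Db (fun x s => f x s == g x s).
Proof.
move=> H H'; apply: Db_eq (Db_and (Db_leq H H') (Db_leq H' H)) _ => x s.
by rewrite eqn_leq.
Qed.

Lemma Db_eqb f g : Db f -> Db g -> Db (fun x s => f x s == g x s).
Proof.
by move=> H H'; apply: Db_eq (Db_eqn H H') _ => x s; case: (f x s); case: (g x s).
Qed.

Lemma Df_if b f g : Db b -> Df f -> Df g -> Df (fun x s => if b x s then f x s else g x s).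
Proof.
move=> H H1 H2; apply: Df_eq (Df_add (Df_mul H H1) (Df_mul (Db_neg H) H2)) _ => x s.
by case: (b x s); rewrite /= ?mul1n ?mul0n ?addn0.
Qed.

Lemma Db_if b f g : Db b -> Db f -> Db g -> Db (fun x s => if b x s then f x s else g x s).
Proof.
by move=> H H1 H2; apply: Df_eq (Df_if H H1 H2) _ => x s; case: (b x s).
Qed.

Lemma Df_count f b : Df f -> Db b ->
  Df (fun x s => count (fun i => b x (i :: s)) (iota 0 (f x s))).
Proof.
move=> H Hb; apply: Df_eq (Df_sum H Hb) _ => x s.
rewrite -sum1_count big_mkcond /= -[iota 0 _]/(iota 0 (f x s)) -{1}(subn0 (f x s)) -/(index_iota 0 (f x s)) big_mkord.
by apply: eq_bigr => i _; case: ifP.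
Qed.

Lemma Db_has f b : Df f -> Db b ->
  Db (fun x s => has (fun i => b x (i :: s)) (iota 0 (f x s))).
Proof.
by move=> H Hb; apply: Db_eq (Db_pos (Df_count H Hb)) _ => x s; rewrite has_count.
Qed.

Lemma Db_all f b : Df f -> Db b ->
  Db (fun x s => all (fun i => b x (i :: s)) (iota 0 (f x s))).
Proof.
move=> H Hb; apply: Db_eq (Db_neg (Db_has H (Db_neg Hb))) _ => x s.
by rewrite has_predC negbK.
Qed.

(** Counting the positive multiples of [d] up to [a] makes division a bounded sum. *)
Lemma divn_count a d : 0 < d -> a %/ d = count (fun i => i.+1 * d <= a) (iota 0 a).
Proof.
move=> d0; have qa : a %/ d <= a by apply: leq_div.
have -> : iota 0 a = iota 0 (a %/ d) ++ iota (a %/ d) (a - a %/ d).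
  by rewrite -{3}(add0n (a %/ d)) -iotaD subnKC.
rewrite count_cat (@eq_in_count _ _ predT) => [|i]; last first.
  by rewrite mem_iota /= add0n leq_divRL // => ->.
rewrite count_predT size_iota (@eq_in_count _ _ pred0) ?count_pred0 ?addn0 // => i.
by rewrite mem_iota -leq_divRL // => /andP[iq _]; rewrite leqNgt ltnS iq.
Qed.

Lemma Df_div f g : Df f -> Df g -> Df (fun x s => f x s %/ g x s).
Proof.
move=> H H'.
have D : Df (fun x s => count (fun i => i.+1 * g x s <= f x s) (iota 0 (f x s))).
  apply: Df_eq (Df_count H (Db_leq (Df_mul (Df_add (Df_cst 1) (Df_var 0)) (Df_shift H'))
    (Df_shift H))) _ => x s /=.
  by apply: eq_count => i; rewrite add1n.
apply: Df_eq (Df_if (Db_pos H') D (Df_cst 0)) _ => x s.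
by case: (posnP (g x s)) => [-> | g0]; rewrite ?divn0 // divn_count.
Qed.

Lemma Df_mod f g : Df f -> Df g -> Df (fun x s => f x s %% g x s).
Proof.
move=> H H'; apply: Df_eq (Df_sub H (Df_mul (Df_div H H') H')) _ => x s.
by rewrite {2}(divn_eq (f x s) (g x s)) addKn.
Qed.

(** A fixed table is a nest of conditionals. This is how the finite data of a machine enter the
    reduction. *)
Lemma Df_nth (L : seq nat) f : Df f -> Df (fun x s => nth 0 L (f x s)).
Proof.
move=> H; suff D : Df (fun x s => nth 0 L (nth 0 s 0)) by apply: (Df_app1 (f := fun x n => nth 0 L n)) D H.
elim: L => [|a L IH]; first by apply: Df_eq (Df_cst 0) _ => x s; rewrite nth_nil.
have D : Df (fun x s => nth 0 L (nth 0 s 0 - 1)).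
  exact: (Df_app1 (f := fun x n => nth 0 L n)) IH (Df_sub (Df_var 0) (Df_cst 1)).
apply: Df_eq (Df_if (Db_pos (Df_var 0)) D (Df_cst a)) _ => x s.
by case: (nth 0 s 0) => //= n; rewrite subn1.
Qed.

Lemma Db_nth (L : seq bool) f : Df f -> Db (fun x s => nth false L (f x s)).
Proof.
move=> H; apply: Df_eq (Df_nth (map nat_of_bool L) H) _ => x s.
case: (ltnP (f x s) (size L)) => Hs; first by rewrite (nth_map false).
by rewrite !nth_default ?size_map.
Qed.

Lemma Df_poly p f : Df f -> Df (fun x s => poly_bound p (f x s)).
Proof.
move=> H; apply: (Df_eq (g := fun x s => foldr (fun c r => r * f x s + c) 0 (polyseq p))).
  elim: (polyseq p) => [|c r IH]; first exact: Df_cst.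
  exact: (Df_add (Df_mul IH H) (Df_cst c)).
by move=> x s; rewrite poly_boundE.
Qed.

Lemma Dg_eq f g : Dg g -> (forall x s, f x s = g x s) -> Dg f.
Proof. by move=> [e H] fg; exists e => x s; rewrite H fg. Qed.

Lemma Dg_emit b : Db b -> Dg (fun x s => [:: b x s]).
Proof. by move=> [e H]; exists (GEmit e) => x s /=; rewrite H; case: (b x s). Qed.

Lemma Dg_cat f g : Dg f -> Dg g -> Dg (fun x s => f x s ++ g x s).
Proof. by move=> [e H] [e' H']; exists (GCat e e') => x s /=; rewrite H H'. Qed.

Lemma Dg_for f g : Df f -> Dg g ->
  Dg (fun x s => flatten [seq g x (i :: s) | i <- iota 0 (f x s)]).
Proof.
move=> [e H] [e' H']; exists (GFor e e') => x s /=; rewrite H.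
by congr flatten; apply: eq_map => i; rewrite H'.
Qed.

Lemma Dg_map f b : Df f -> Db b -> Dg (fun x s => [seq b x (i :: s) | i <- iota 0 (f x s)]).
Proof.
move=> H Hb; apply: Dg_eq (Dg_for H (Dg_emit Hb)) _ => x s.
by elim: (iota _ _) => //= i r ->.
Qed.

Lemma Dg_unary f : Df f -> Dg (fun x s => unary (f x s)).
Proof.
move=> H; apply: Dg_eq (Dg_cat (Dg_map H (Df_cst 1 : Db (fun _ _ => true)))
  (Dg_emit (Df_cst 0 : Db (fun _ _ => false)))) _ => x s.
by rewrite /unary; congr cat; elim: (f x s) 0 => //= n IH k; rewrite -IH.
Qed.

Lemma Dg_in_FP f : Dg f -> in_FP (fun x => f x [::]).
Proof.
move=> [g H]; have [M [p HM]] := gen_in_FP g; exists M, p.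
case: HM => nq HM; split=> // x; have := HM x; rewrite /= H; exact.
Qed.

Lemma Dg_in_FP_oracle O f D : Dg f -> polyb D ->
  (forall x, size (O (f x [::])) <= D (size x)) ->
  in_FP_oracle O (fun x => O (f x [::])).
Proof.
move=> [g H] pD HD; have [|M [p HM]] := @gen_in_FP_oracle O g D pD.
  by move=> x; rewrite H.
by exists M, p => x; have := HM x; rewrite /= H; exact.
Qed.

(** * Crossing parity of paths *)

Section CrossingParity.
Variables (V : Type) (r : V -> V -> V -> bool) (lt : V -> V -> bool).

(** For segments, [r d a b] will say that [d] lies below [ab] and [lt] compares
    abscissas; [cr] is then the parity of the number of crossings of [ab] and [de].
    Its interest is that it telescopes along paths. *)
Definition cr (a b d e : V) : bool :=
  xorb (xorb (xorb (r d a b) (r e a b)) (xorb (r a d e) (r b d e)))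
       (xorb (xorb (lt a d) (lt b d)) (xorb (lt a e) (lt b e))).

Fixpoint rpath (d a : V) (p : seq V) : bool :=
  if p is b :: p' then xorb (r d a b) (rpath d b p') else false.

Fixpoint crsp (a b d : V) (q : seq V) : bool :=
  if q is e :: q' then xorb (cr a b d e) (crsp a b e q') else false.

Fixpoint crpp (a : V) (p : seq V) (d : V) (q : seq V) : bool :=
  if p is b :: p' then xorb (crsp a b d q) (crpp b p' d q) else false.

Lemma crspE a b d q : crsp a b d q =
  xorb (xorb (xorb (r d a b) (r (last d q) a b)) (xorb (rpath a d q) (rpath b d q)))
       (xorb (xorb (lt a d) (lt b d)) (xorb (lt a (last d q)) (lt b (last d q)))).
Proof.
elim: q d => [|e q IH] d /=; first by btauto.
by rewrite IH /cr; btauto.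
Qed.

(** In the sum over all pairs of segments every interior vertex of either path is counted twice.
    What is left is [rpath] at the four ends and [lt] between ends. *)
Lemma crppE a p d q : crpp a p d q =
  xorb (xorb (xorb (rpath d a p) (rpath (last d q) a p))
             (xorb (rpath a d q) (rpath (last a p) d q)))
       (xorb (xorb (lt a d) (lt (last a p) d))
             (xorb (lt a (last d q)) (lt (last a p) (last d q)))).
Proof.
elim: p a => [|b p IH] a /=; first by btauto.
by rewrite IH crspE; btauto.
Qed.

(** This is the Hanani-Tutte theorem for K(3,3): [p i j] subdivides the edge from [u i] to [w j],
    and not all pairs of edges without a common end can cross evenly. *)
Lemma K33_parity (u w : nat -> V) (p : nat -> nat -> seq V) :
  (forall i j, i < 3 -> j < 3 -> last (u i) (p i j) = w j) ->
  (forall i k j l, i < k -> k < 3 -> j < 3 -> l < 3 -> j != l ->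
     crpp (u i) (p i j) (u k) (p k l) = false) ->
  (forall j l, j < l -> l < 3 -> lt (w l) (w j) = ~~ lt (w j) (w l)) -> False.
Proof.
move=> L C D.
have E i k j l : i < k -> k < 3 -> j < 3 -> l < 3 -> j != l ->
  xorb (xorb (xorb (rpath (u k) (u i) (p i j)) (rpath (w l) (u i) (p i j)))
             (xorb (rpath (u i) (u k) (p k l)) (rpath (w j) (u k) (p k l))))
       (xorb (xorb (lt (u i) (u k)) (lt (w j) (u k)))
             (xorb (lt (u i) (w l)) (lt (w j) (w l)))) = false.
  move=> ik k3 j3 l3 jl; rewrite -(C i k j l) // crppE !L //; lia.
have D01 := D 0 1 isT isT; have D02 := D 0 2 isT isT; have D12 := D 1 2 isT isT.
(* For fixed [i < k] the six equations add up to [X i + X k = 1], which cannot hold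
   for the three pairs at once. *)
pose G i j l := rpath (w l) (u i) (p i j).
pose X i := xorb (xorb (xorb (G i 0 1) (G i 0 2)) (xorb (G i 1 0) (G i 1 2)))
                 (xorb (G i 2 0) (G i 2 1)).
have F i k : i < k -> k < 3 -> xorb (X i) (X k) = true.
  move=> ik k3.
  pose A j := xorb (rpath (u k) (u i) (p i j)) (lt (w j) (u k)).
  pose B l := xorb (rpath (u i) (u k) (p k l)) (lt (u i) (w l)).
  have Gk j l : j < 3 -> l < 3 -> j != l ->
      xorb (G i j l) (G k l j) = xorb (xorb (A j) (B l)) (xorb (lt (u i) (u k)) (lt (w j) (w l))).
    move=> j3 l3 jl; have := E i k j l ik k3 j3 l3 jl; rewrite /G /A /B.
    by do 4![case: (rpath _ _ _)]; do 4![case: (lt _ _)].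
  have -> : xorb (X i) (X k) =
      xorb (xorb (xorb (xorb (G i 0 1) (G k 1 0)) (xorb (G i 1 0) (G k 0 1)))
                 (xorb (xorb (G i 0 2) (G k 2 0)) (xorb (G i 2 0) (G k 0 2))))
           (xorb (xorb (G i 1 2) (G k 2 1)) (xorb (G i 2 1) (G k 1 2))).
    by rewrite /X; btauto.
  rewrite !Gk // D01 D02 D12; btauto.
move: (F 0 1 isT isT) (F 0 2 isT isT) (F 1 2 isT isT).
by do 3![case: (X _)].
Qed.

Lemma crpp_false (a d : V) (p q : seq V) :
  (forall i j, i < size p -> j < size q ->
     cr (nth a (a :: p) i) (nth a p i) (nth d (d :: q) j) (nth d q j) = false) ->
  crpp a p d q = false.
Proof.
move=> H.
have S i : i < size p -> crsp (nth a (a :: p) i) (nth a p i) d q = false.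
  move=> ip; move: (fun j => H i j ip).
  move: (nth a (a :: p) i) (nth a p i) => x y {H}.
  elim: q d => [|e q IH] d //= H.
  rewrite (H 0) //= (IH e) // => j jq; have := H j.+1 jq; rewrite /=.
  case: j jq => [|j] jq //=; rewrite !(set_nth_default e d) //.
  exact: ltnW.
elim: p a S {H} => [|b p IH] a //= S.
rewrite (S 0) //= (IH b) // => i ip; have := S i.+1 ip; rewrite /=.
case: i ip => [|i] ip //=; rewrite !(set_nth_default b a) //.
exact: ltnW.
Qed.

End CrossingParity.

(** * Segments with odd crossing parity meet *)

Section Segments.
Variable R : realType.
Implicit Types (A B D E : R).
Local Open Scope ring_scope.

(** Intermediate values for the difference of two affine functions, with an explicit root when the
    slopes differ. *)
Lemma affine_meet (a0 a1 b0 b1 l r : R) : l <= r ->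
  a0 + a1 * l <= b0 + b1 * l -> b0 + b1 * r <= a0 + a1 * r ->
  exists2 t, l <= t <= r & a0 + a1 * t = b0 + b1 * t.
Proof.
move=> lr h1 h2; have [e|ne] := eqVneq a1 b1.
  by exists l; [rewrite lexx lr|subst a1; lra].
have [ab|ba] := ltP a1 b1.
  have lE : l = r by nra.
  by exists l; [rewrite lexx lr|subst r; lra].
have c0 : 0 < a1 - b1 by rewrite subr_gt0 lt_neqAle eq_sym ne.
exists ((b0 - a0) / (a1 - b1)).
  by rewrite ler_pdivlMr // ler_pdivrMr //; apply/andP; split; nra.
by field; rewrite gt_eqF.
Qed.

Definition line_at (xa ya xb yb t : R) : R := ya + (yb - ya) / (xb - xa) * (t - xa).

Variable eps : R.
(** Shearing by a generic [eps] does the work of a rotation: distinct points of a finite set get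
    distinct abscissas, so no segment is vertical, while ordinates are kept. *)
Definition absc (p : R * R) : R := p.1 + eps * p.2.
Definition ltx (p q : R * R) : bool := absc p < absc q.
(** In sheared coordinates, the vertical ray upwards from [d] meets the segment [ab]. *)
Definition below (d a b : R * R) : bool :=
  (ltx a d != ltx b d) && (d.2 < line_at (absc a) a.2 (absc b) b.2 (absc d)).

Lemma line_atC xa ya xb yb t : xa != xb -> line_at xa ya xb yb t = line_at xb yb xa ya t.
Proof. by move=> ne; have ne' := ne; rewrite eq_sym in ne'; rewrite /line_at; field;
   rewrite !subr_eq0 ?ne ?ne'. Qed.

Lemma belowC d a b : absc a != absc b -> below d a b = below d b a.
Proof. by move=> ne; rewrite /below line_atC // [in LHS]eq_sym. Qed.

Definition lerp (a b : R * R) (u : R) : R * R :=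
  (a.1 + u * (b.1 - a.1), a.2 + u * (b.2 - a.2)).

Definition meet (a b d e : R * R) :=
  exists u v, [/\ 0 <= u <= 1, 0 <= v <= 1 & lerp a b u = lerp d e v].

Lemma meet_line a b d e t : absc a < absc b -> absc d < absc e ->
  absc a <= t <= absc b -> absc d <= t <= absc e ->
  line_at (absc a) a.2 (absc b) b.2 t = line_at (absc d) d.2 (absc e) e.2 t ->
  meet a b d e.
Proof.
move=> ab de /andP[at_ tb] /andP[dt te] E.
have ab0 : 0 < absc b - absc a by lra.
have de0 : 0 < absc e - absc d by lra.
exists ((t - absc a) / (absc b - absc a)), ((t - absc d) / (absc e - absc d)); split.
- by rewrite ler_pdivlMr // ler_pdivrMr // mul0r mul1r; apply/andP; split; lra.
- by rewrite ler_pdivlMr // ler_pdivrMr // mul0r mul1r; apply/andP; split; lra.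
- have Y : a.2 + (t - absc a) / (absc b - absc a) * (b.2 - a.2) =
           d.2 + (t - absc d) / (absc e - absc d) * (e.2 - d.2).
    by rewrite mulrAC -(mulrC (b.2 - a.2)) mulrAC [in RHS]mulrAC -(mulrC (e.2 - d.2)) [in RHS]mulrAC.
  have X : absc a + (t - absc a) / (absc b - absc a) * (absc b - absc a) =
           absc d + (t - absc d) / (absc e - absc d) * (absc e - absc d).
    by rewrite !divfK ?gt_eqF //; lra.
  move: X Y; set u := _ / (absc b - absc a); set v := _ / (absc e - absc d) => X Y.
  have Y' := congr1 ( *%R eps) Y.
  by congr pair => //; move: u v X Y' {Y}; rewrite /absc => u v X Y'; lra.
Qed.

Lemma line_affine xa ya xb yb t :
  line_at xa ya xb yb t = (ya - (yb - ya) / (xb - xa) * xa) + (yb - ya) / (xb - xa) * t.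
Proof. by rewrite /line_at; lra. Qed.

Lemma line_at_r xa ya xb yb : xa != xb -> line_at xa ya xb yb xb = yb.
Proof. by move=> ne; rewrite /line_at; field; rewrite subr_eq0 eq_sym. Qed.

Lemma line_at_l xa ya xb yb : line_at xa ya xb yb xa = ya.
Proof. by rewrite /line_at subrr mulr0 addr0. Qed.

Lemma meetC a b d e : meet a b d e -> meet d e a b.
Proof. by move=> [u [v [hu hv E]]]; exists v, u. Qed.

Lemma meetS a b d e : meet b a d e -> meet a b d e.
Proof.
move=> [u [v [/andP[h1 h2] hv E]]]; exists (1 - u), v; split=> //; first by apply/andP; split; lra.
by rewrite -E /lerp; congr pair; ring.
Qed.

(** Over the interval of abscissas common to both segments, odd parity means that the two lines
    exchange their order between the ends of the interval, so they meet over it. *)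
Lemma cross_meet_ordered a b d e : absc a < absc b -> absc d < absc e ->
  absc a != absc d -> absc a != absc e -> absc b != absc d -> absc b != absc e ->
  cr below ltx a b d e -> meet a b d e.
Proof.
move=> ab de ad ae bd be.
have meets l r : l <= r -> absc a <= l -> absc d <= l -> r <= absc b -> r <= absc e ->
    (line_at (absc a) a.2 (absc b) b.2 l <= line_at (absc d) d.2 (absc e) e.2 l /\
     line_at (absc d) d.2 (absc e) e.2 r <= line_at (absc a) a.2 (absc b) b.2 r) \/
    (line_at (absc d) d.2 (absc e) e.2 l <= line_at (absc a) a.2 (absc b) b.2 l /\
     line_at (absc a) a.2 (absc b) b.2 r <= line_at (absc d) d.2 (absc e) e.2 r) ->
    meet a b d e.
  move=> lr al dl rb re H.
  have [t /andP[lt tr] Et] : exists2 t, l <= t <= r &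
      line_at (absc a) a.2 (absc b) b.2 t = line_at (absc d) d.2 (absc e) e.2 t.
    case: H => -[]; rewrite !line_affine => h1 h2.
      have [t tlr Et] := affine_meet lr h1 h2.
      by exists t => //; rewrite !line_affine.
    have [t tlr Et] := affine_meet lr h1 h2.
    by exists t => //; rewrite !line_affine Et.
  by apply: (@meet_line _ _ _ _ t) => //; apply/andP; split; lra.
have ne1 : absc a != absc b by rewrite lt_eqF.
have ne2 : absc d != absc e by rewrite lt_eqF.
have ra := line_at_r a.2 b.2 ne1; have rd := line_at_r d.2 e.2 ne2.
have la := line_at_l (absc a) a.2 (absc b) b.2; have ld := line_at_l (absc d) d.2 (absc e) e.2.
have dich (p q : R) : p != q -> [/\ p < q, (p < q) = true & (q < p) = false] \/
    [/\ q < p, (p < q) = false & (q < p) = true].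
  by move=> pq; case: (ltgtP p q) pq => // h _; [left|right].
rewrite /cr /below /ltx.
have close l r : l <= r -> absc a <= l -> absc d <= l -> r <= absc b -> r <= absc e ->
    (line_at (absc a) a.2 (absc b) b.2 l <= line_at (absc d) d.2 (absc e) e.2 l /\
     line_at (absc d) d.2 (absc e) e.2 r <= line_at (absc a) a.2 (absc b) b.2 r) \/
    (line_at (absc d) d.2 (absc e) e.2 l <= line_at (absc a) a.2 (absc b) b.2 l /\
     line_at (absc a) a.2 (absc b) b.2 r <= line_at (absc d) d.2 (absc e) e.2 r) ->
    meet a b d e := meets l r.
(* Of the sixteen orders of the ends, the consistent ones in which the intervals overlap leave four
   shapes for the common interval, tried in turn below. *)
case: (dich _ _ ad) => [[h1 -> ->]|[h1 -> ->]]; case: (dich _ _ bd) => [[h2 -> ->]|[h2 -> ->]];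
case: (dich _ _ ae) => [[h3 -> ->]|[h3 -> ->]]; case: (dich _ _ be) => [[h4 -> ->]|[h4 -> ->]];
rewrite /= ?andbF //; try (exfalso; lra).
all: do ![case: ltP => ? ].
all: move=> //= _.
all: first
  [ apply: (close (absc d) (absc b)); [lra|lra|lra|lra|lra|]
  | apply: (close (absc d) (absc e)); [lra|lra|lra|lra|lra|]
  | apply: (close (absc a) (absc b)); [lra|lra|lra|lra|lra|]
  | apply: (close (absc a) (absc e)); [lra|lra|lra|lra|lra|] ].
all: rewrite ?ra ?rd ?la ?ld; first [by left; split; lra | by right; split; lra].
Qed.

Lemma cr_sym_r a b d e : absc d != absc e -> cr below ltx a b d e = cr below ltx a b e d.
Proof. by move=> de; rewrite /cr (belowC a) // (belowC b) //; btauto. Qed.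

Lemma cr_sym_l a b d e : absc a != absc b -> cr below ltx a b d e = cr below ltx b a d e.
Proof. by move=> ab; rewrite /cr (belowC d) // (belowC e) //; btauto. Qed.

Lemma cross_meet a b d e : absc a != absc b -> absc d != absc e ->
  absc a != absc d -> absc a != absc e -> absc b != absc d -> absc b != absc e ->
  cr below ltx a b d e -> meet a b d e.
Proof.
move=> ab de ad ae bd be.
wlog ab' : a b ab ad ae bd be / absc a < absc b.
  move=> H; case: (ltgtP (absc a) (absc b)) (ab) => // h _; first exact: H.
  by rewrite cr_sym_l // => c; apply: meetS; apply: H => //; rewrite eq_sym.
wlog de' : d e de ad ae bd be / absc d < absc e.
  move=> H; case: (ltgtP (absc d) (absc e)) (de) => // h _; first exact: H.
  by rewrite cr_sym_r // => c; apply/meetC/meetS/meetC; apply: H => //; rewrite eq_sym.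
exact: cross_meet_ordered.
Qed.

End Segments.

(** * Replacing continuous arcs by polygons *)

Section Drawing.
Variable R : realType.
Local Open Scope ring_scope.

Lemma avoid_finite (L : seq R) : exists e : R, e \notin L.
Proof.
pose S := [seq (i%:R : R) | i <- iota 0 (size L).+1].
have uS : uniq S by rewrite map_inj_uniq ?iota_uniq // => i j /eqP; rewrite eqr_nat => /eqP.
have : ~~ all (mem L) S.
  apply/negP => /allP sub; have := uniq_leq_size uS sub.
  by rewrite size_map size_iota ltnn.
by rewrite -has_predC => /hasP[e _ /= eL]; exists e.
Qed.

(** Two distinct points get the same abscissa for at most one value of [eps], and there are finitely
    many pairs to avoid. *)
Lemma generic_direction (L : seq (R * R)) : exists eps : R,
  forall p q, p \in L -> q \in L -> p != q -> absc eps p != absc eps q.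
Proof.
have [e He] := avoid_finite [seq (q.1 - p.1) / (p.2 - q.2) | p <- L, q <- L].
exists e => p q pL qL pq; apply: contra He => /eqP E.
have [e2|ne] := eqVneq p.2 q.2.
  case: p q e2 E pq {pL qL} => [p1 p2] [q1 q2] /= ->.
  by rewrite /absc /= => /addIr ->; rewrite eqxx.
apply/allpairsP; exists (p, q); split=> //=.
apply: (canRL (mulfK _)); first by rewrite subr_eq0.
by move: E; rewrite /absc; lra.
Qed.

Lemma within_continuous_eps (f : R -> R * R) (t eps : R) :
  {within `[0%R, 1%R], continuous f}%classic -> t \in `[0, 1] -> 0 < eps ->
  exists2 d, 0 < d & forall t', t' \in `[0, 1] -> `|t' - t| < d ->
    `|(f t').1 - (f t).1| < eps /\ `|(f t').2 - (f t).2| < eps.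
Proof.
move=> /subspace_continuousP cf tI e0.
have tI' : `[0, 1]%classic t by rewrite /= inE in tI *.
have := cf t tI' (ball (f t) eps) (nbhsx_ballx _ _ e0).
rewrite /= /within /=.
move=> /nbhs_ballP[d /= d0 H]; exists d => // t' t'I t'd.
have [] := H t'; rewrite -?ball_normE //=; first by rewrite distrC.
by rewrite !(distrC (f t).1) !(distrC (f t).2).
Qed.

Lemma conv_close (p q c u eps : R) : 0 <= u <= 1 -> `|p - c| < eps -> `|q - c| < eps ->
  `|p + u * (q - p) - c| < eps.
Proof.
move=> /andP[u0 u1]; rewrite !ltr_norml => /andP[h1 h2] /andP[h3 h4].
have [pq|qp] := lerP p q.
  have k1 : 0 <= u * (q - p) by rewrite mulr_ge0 // subr_ge0.
  have k2 : 0 <= (1 - u) * (q - p) by rewrite mulr_ge0 ?subr_ge0.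
  by apply/andP; split; lra.
have k1 : 0 <= u * (p - q) by rewrite mulr_ge0 // subr_ge0 ltW.
have k2 : 0 <= (1 - u) * (p - q) by rewrite mulr_ge0 ?subr_ge0 // ltW.
by apply/andP; split; lra.
Qed.

Definition separated (f g : R -> R * R) (N : nat) :=
  forall t1 t2 t1' t2', t1 \in `[0, 1] -> t2 \in `[0, 1] ->
    t1' \in `[0, 1] -> t2' \in `[0, 1] ->
    `|t2 - t1| <= N.+1%:R^-1 -> `|t2' - t1'| <= N.+1%:R^-1 ->
    ~ meet (f t1) (f t2) (g t1') (g t2').

(** Near each pair of parameters the two arcs stay in disjoint boxes, which also contain their short
    chords by convexity; compactness of the square of parameters makes the mesh uniform. *)
Lemma arcs_separated (f g : R -> R * R) :
  {within `[0%R, 1%R], continuous f}%classic -> {within `[0%R, 1%R], continuous g}%classic ->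
  (forall t t', t \in `[0, 1] -> t' \in `[0, 1] -> f t <> g t') ->
  exists N0, forall N, (N0 <= N)%N -> separated f g N.
Proof.
move=> cf cg dis.
have cpt : compact (`[0, 1]%classic `*` `[0, 1]%classic : set (R * R)).
  by apply: compact_setX; exact: segment_compact.
pose P (N : nat) (z : R * R) := forall t1 t2 t1' t2', t1 \in `[0, 1] -> t2 \in `[0, 1] ->
    t1' \in `[0, 1] -> t2' \in `[0, 1] ->
    `|t1 - z.1| <= N.+1%:R^-1 -> `|t2 - z.1| <= N.+1%:R^-1 ->
    `|t1' - z.2| <= N.+1%:R^-1 -> `|t2' - z.2| <= N.+1%:R^-1 ->
    ~ meet (f t1) (f t2) (g t1') (g t2').
(* Compactness is used as near covering along the filter at infinity of [nat]: a mesh valid locally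
   for all large [N] is valid globally for all large [N]. *)
have /compact_near_coveringP/(_ nat \oo%classic P _) := cpt.
case.
  move=> [s s'] /= [sI s'I].
  have sI' : s \in `[0, 1] by rewrite inE.
  have s'I' : s' \in `[0, 1] by rewrite inE.
  have [c c0 Hc] : exists2 c, 0 < c & forall p q : R * R,
      `|p.1 - (f s).1| < c -> `|p.2 - (f s).2| < c ->
      `|q.1 - (g s').1| < c -> `|q.2 - (g s').2| < c -> p <> q.
    have [e1|n1] := eqVneq (f s).1 (g s').1; last first.
      exists (`|(f s).1 - (g s').1| / 2).
        by rewrite divr_gt0 // normr_gt0 subr_eq0.
      move=> p q h1 _ h2 _ pq; rewrite -pq in h2.
      have := ler_normB (p.1 - (g s').1) (p.1 - (f s).1).
      have -> : p.1 - (g s').1 - (p.1 - (f s).1) = (f s).1 - (g s').1 by ring.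
      by lra.
    have [e2|n2] := eqVneq (f s).2 (g s').2.
      case: (dis s s' sI' s'I').
      by case: (f s) (g s') e1 e2 => [? ?] [? ?] /= -> ->.
    exists (`|(f s).2 - (g s').2| / 2).
      by rewrite divr_gt0 // normr_gt0 subr_eq0.
    move=> p q _ h1 _ h2 pq; rewrite -pq in h2.
    have := ler_normB (p.2 - (g s').2) (p.2 - (f s).2).
    have -> : p.2 - (g s').2 - (p.2 - (f s).2) = (f s).2 - (g s').2 by ring.
    by lra.
  have [d d0 Hd] := within_continuous_eps cf sI' c0.
  have [d' d'0 Hd'] := within_continuous_eps cg s'I' c0.
  (* One half is for the distance from the centre to the sample parameter, the other for the
     mesh. *)
  pose m := Num.min d d' / 2.
  have m0 : 0 < m by rewrite /m divr_gt0 // lt_min d0 d'0.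
  have md : m + m <= d by rewrite /m -splitr ge_min lexx.
  have md' : m + m <= d' by rewrite /m -splitr ge_min lexx orbT.
  exists (ball (s, s') m, [set N | N.+1%:R^-1 < m]%classic) => /=.
    split; first exact: nbhsx_ballx.
    exact: (near_infty_natSinv_lt (PosNum m0)).
  move=> [z N] /= [[]]; rewrite -!ball_normE /= => zs zs' Nm.
  move=> t1 t2 t1' t2' I1 I2 I1' I2' k1 k2 k1' k2' [u [v [hu hv E]]].
  have Nm' : (N.+1%:R^-1 : R) < m by exact: Nm.
  have close (y z0 s0 D : R) : m + m <= D -> `|s0 - z0| < m -> `|y - z0| <= N.+1%:R^-1 -> `|y - s0| < D.
    move=> mD h1 h2; have := ler_normD (y - z0) (z0 - s0).
    have -> : y - z0 + (z0 - s0) = y - s0 by ring.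
    rewrite (distrC z0); move: h1 h2 Nm' mD; move: `|_| `|y - z0| `|y - s0| => A B C.
    move: (N.+1%:R^-1) => D0 *; lra.
  have [h1 h2] := Hd t1 I1 (close _ _ _ _ md zs k1).
  have [h3 h4] := Hd t2 I2 (close _ _ _ _ md zs k2).
  have [h5 h6] := Hd' t1' I1' (close _ _ _ _ md' zs' k1').
  have [h7 h8] := Hd' t2' I2' (close _ _ _ _ md' zs' k2').
  by apply: (Hc (lerp (f t1) (f t2) u) (lerp (g t1') (g t2') v)) E; apply: conv_close.
move=> N0 _ H; exists N0 => N NN t1 t2 t1' t2' I1 I2 I1' I2' k1 k2.
have hI : 0 <= (N.+1%:R^-1 : R) by rewrite invr_ge0.
apply: (H N NN (t1, t1')) => //=; rewrite ?subrr ?normr0 //.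
Qed.

End Drawing.

(** * Three pairwise crossing chords of a Hamiltonian cycle *)

Section Crossing.
Variables (R : realType) (T : finType) (e : rel T).
Local Open Scope ring_scope.

(** All that is retained of a drawing is parity data on vertices: [r z x y] is the parity of the
    number of segments above [z] in a polygon inscribed in the arc [xy]. Arcs of edges without a
    common end are disjoint, so fine polygons do not cross. *)
Lemma planar_no_cross : planar R e -> exists (r : T -> T -> T -> bool) (lt : T -> T -> bool),
  (forall x y, x != y -> lt y x = ~~ lt x y) /\
  (forall x y x' y', e x y -> e x' y' -> x != x' -> x != y' -> y != x' -> y != y' ->
     cr r lt x y x' y' = false).
Proof.
move=> [pos [arc [pinj parc pvert pcross]]].
have dis x y x' y' : e x y -> e x' y' -> x != x' -> x != y' -> y != x' -> y != y' ->
    forall t t' : R, t \in `[0, 1] -> t' \in `[0, 1] -> arc x y t <> arc x' y' t'.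
  move=> exy exy' n1 n2 n3 n4 t t' tI t'I E.
  have [_ _ a0 a1 _] := parc x y exy; have [_ _ b0 b1 _] := parc x' y' exy'.
  have cases (t0 : R) : t0 \in `[0, 1] -> [\/ t0 = 0, t0 = 1 | t0 \in `]0, 1[].
    rewrite !in_itv /= => /andP[h1 h2].
    have [->|n0] := eqVneq t0 0; first by constructor 1.
    have [->|n1'] := eqVneq t0 1; first by constructor 2.
    by constructor 3; rewrite !lt_neqAle h1 h2 n1' eq_sym n0.
  case: (cases t tI) => [t0|t1|tO].
  - case: (cases t' t'I) => [t'0|t'1|t'O].
    + by move: E; rewrite t0 t'0 a0 b0 => /pinj /eqP; rewrite (negbTE n1).
    + by move: E; rewrite t0 t'1 a0 b1 => /pinj /eqP; rewrite (negbTE n2).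
    + by apply: (pvert x' y' x exy' t' t'O); rewrite -E t0 a0.
  - case: (cases t' t'I) => [t'0|t'1|t'O].
    + by move: E; rewrite t1 t'0 a1 b0 => /pinj /eqP; rewrite (negbTE n3).
    + by move: E; rewrite t1 t'1 a1 b1 => /pinj /eqP; rewrite (negbTE n4).
    + by apply: (pvert x' y' y exy' t' t'O); rewrite -E t1 a1.
  - case: (cases t' t'I) => [t'0|t'1|t'O].
    + by apply: (pvert x y x' exy t tO); rewrite E t'0 b0.
    + by apply: (pvert x y y' exy t tO); rewrite E t'1 b1.
    + have /setP/(_ x) := pcross x y x' y' exy exy' t t' tO t'O E.
      by rewrite !inE eqxx (negbTE n1) (negbTE n2).
pose good (q : T * T * (T * T)) N := e q.1.1 q.1.2 -> e q.2.1 q.2.2 ->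
  q.1.1 != q.2.1 -> q.1.1 != q.2.2 -> q.1.2 != q.2.1 -> q.1.2 != q.2.2 ->
  separated (arc q.1.1 q.1.2) (arc q.2.1 q.2.2) N.
have /choice[N0 HN0] : forall q, exists n0, forall N, (n0 <= N)%N -> good q N.
  move=> q.
  have [[E1 E2 [n1 n2] n3 n4]|no] := pselect [/\ e q.1.1 q.1.2, e q.2.1 q.2.2,
     q.1.1 != q.2.1 /\ q.1.1 != q.2.2, q.1.2 != q.2.1 & q.1.2 != q.2.2].
    have [c1 _ _ _ _] := parc _ _ E1; have [c2 _ _ _ _] := parc _ _ E2.
    have [N1 H1] := arcs_separated c1 c2 (dis _ _ _ _ E1 E2 n1 n2 n3 n4).
    by exists N1 => N NN _ _ _ _ _ _; exact: H1.
  by exists 0%N => N _ E1 E2 n1 n2 n3 n4; case: no.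
(* One mesh serves all pairs of edges, as there are finitely many. *)
pose N := (\max_q N0 q)%N.
have sepN q : good q N by apply: HN0; exact: leq_bigmax.
pose pts x y (i : nat) := arc x y (i%:R / N.+1%:R).
pose line x y := [seq pts x y i.+1 | i <- iota 0 N.+1].
(* The shear must separate the drawn vertices and also all the vertices of the polygons. *)
pose L := [seq pos x | x <- enum T] ++
  [seq pts q.1 q.2 (val i) | q <- enum {: T * T}, i <- enum 'I_N.+2].
have posL x : pos x \in L by rewrite mem_cat map_f ?mem_enum.
have ptsL x y i : (i <= N.+1)%N -> pts x y i \in L.
  move=> iN; rewrite mem_cat; apply/orP; right; apply/allpairsP.
  exists ((x, y), Ordinal (iN : (i < N.+2)%N)); split=> //=; exact: mem_enum.
have [eps Heps] := generic_direction L.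
have pts0 x y : e x y -> pts x y 0%N = pos x.
  by move=> exy; rewrite /pts mul0r; case: (parc x y exy).
have pts1 x y : e x y -> pts x y N.+1 = pos y.
  by move=> exy; rewrite /pts divff ?pnatr_eq0 //; case: (parc x y exy).
have ptI (i : nat) : (i <= N.+1)%N -> (i%:R / N.+1%:R : R) \in `[0, 1].
  move=> iN; rewrite in_itv /= divr_ge0 //= ler_pdivrMr ?ltr0n // mul1r.
  by rewrite ler_nat.
have last_line x y : e x y -> last (pos x) (line x y) = pos y.
  move=> exy; rewrite /line -(addn1 N) iotaD map_cat last_cat /= add0n.
  exact: pts1.
have nth_line x y z i : (i < N.+1)%N -> nth z (line x y) i = pts x y i.+1.
  by move=> iN; rewrite (nth_map 0%N) ?size_iota // nth_iota.
have nth_line' x y i : e x y -> (i < N.+1)%N -> nth (pos x) (pos x :: line x y) i = pts x y i.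
  by move=> exy; case: i => [|i] iN /=; [rewrite pts0|apply: nth_line; apply: ltnW].
pose r z x y := rpath (below eps) (pos z) (pos x) (line x y).
pose lt x y := ltx eps (pos x) (pos y).
exists r, lt; split.
  move=> x y xy; rewrite /lt /ltx.
  have : absc eps (pos x) != absc eps (pos y).
    by apply: Heps => //; apply: contra xy => /eqP/pinj ->.
  by case: ltgtP.
move=> x y x' y' exy exy' n1 n2 n3 n4.
(* After telescoping, the crossing parity of two polygons is the expression [cr] of their edges,
   with [rpath] along a polygon in the role of [below] for a segment. *)
have := @crppE _ (below eps) (ltx eps) (pos x) (line x y) (pos x') (line x' y').
rewrite !last_line // -/(cr r lt x y x' y') => <-.
apply: crpp_false => i j; rewrite !size_map !size_iota => iN jN.
rewrite !nth_line // !nth_line' //.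
apply/negP => /cross_meet H.
have consec a b k : e a b -> (k < N.+1)%N -> absc eps (pts a b k) != absc eps (pts a b k.+1).
  move=> eab kN; apply: Heps; [apply: ptsL; exact: ltnW|exact: ptsL|].
  have [_ inj _ _ _] := parc a b eab; apply/negP => /eqP /inj E.
  have := E (ptI _ (ltnW kN)) (ptI _ kN).
  move=> /(divIf _); rewrite pnatr_eq0 => /(_ isT) /eqP.
  by rewrite eqr_nat ltn_eqF.
have cross k l : (k <= N.+1)%N -> (l <= N.+1)%N ->
    absc eps (pts x y k) != absc eps (pts x' y' l).
  move=> kN lN; apply: Heps; [exact: ptsL|exact: ptsL|].
  by apply/negP => /eqP; apply: dis => //; apply: ptI.
have gap (k : nat) : `|k.+1%:R / N.+1%:R - k%:R / N.+1%:R| <= (N.+1%:R^-1 : R).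
  by rewrite -mulrBl -natrB ?leqnSn // subSnn mul1r ger0_norm // invr_ge0.
apply: (sepN ((x, y), (x', y')) exy exy' n1 n2 n3 n4 _ _ _ _ (ptI i (ltnW iN)) (ptI i.+1 iN)
  (ptI j (ltnW jN)) (ptI j.+1 jN) (gap i) (gap j)).
have [iN' jN'] := (ltnW iN, ltnW jN).
by apply: H; rewrite ?consec ?cross.
Qed.

Lemma crpp_disjoint (V : eqType) r lt (E : rel V) a p d q :
  (forall x y x' y', E x y -> E x' y' -> x != x' -> x != y' -> y != x' -> y != y' ->
     cr r lt x y x' y' = false) ->
  path E a p -> path E d q -> (forall k, k \in a :: p -> k \in d :: q -> False) ->
  crpp r lt a p d q = false.
Proof.
move=> H /(pathP a) Pp /(pathP d) Pq D; apply: crpp_false => i j ip jq.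
have ne (x y : V) : x \in a :: p -> y \in d :: q -> x != y.
  by move=> xp yq; apply/eqP => xy; apply: (D x); rewrite // xy.
apply: H; rewrite ?ne ?mem_nth //=; try exact: ltnW.
- exact: Pp.
- exact: Pq.
- by rewrite inE mem_nth ?orbT.
- by rewrite inE mem_nth ?orbT.
- by rewrite inE mem_nth ?orbT.
- by rewrite inE mem_nth ?orbT.
Qed.

Local Close Scope ring_scope.

Fixpoint up (k m : nat) : seq nat := if m is m'.+1 then k.+1 :: up k.+1 m' else [::].
Fixpoint down (k m : nat) : seq nat := if m is m'.+1 then k.-1 :: down k.-1 m' else [::].

Lemma last_up k m : last k (up k m) = k + m.
Proof. by elim: m k => [|m IH] k /=; rewrite ?addn0 // IH addSnnS. Qed.

Lemma last_down k m : m <= k -> last k (down k m) = k - m.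
Proof. by elim: m k => [|m IH] k mk /=; rewrite ?subn0 // IH; lia. Qed.

Lemma mem_up k m i : i \in up k m -> k < i <= k + m.
Proof. by elim: m k => [|m IH] k //=; rewrite inE => /orP[/eqP ->|/IH]; lia. Qed.

Lemma mem_down k m i : m <= k -> i \in down k m -> k - m <= i < k.
Proof. by elim: m k => [|m IH] k //= mk; rewrite inE => /orP[/eqP ->|/IH]; lia. Qed.

Section PathsAlong.
Variables (n : nat) (E : rel nat).
Hypotheses (Esym : symmetric E) (E1 : forall k, k.+1 < n -> E k k.+1).

Lemma path_up k m : k + m < n -> path E k (up k m).
Proof.
elim: m k => [|m IH] k //= km; rewrite E1 ?IH //; lia.
Qed.

Lemma path_down k m : m <= k -> k < n -> path E k (down k m).
Proof.
elim: m k => [|m IH] k //= mk kn; rewrite IH ?andbT; try lia.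
by case: k mk kn => // k _ kn; rewrite Esym E1.
Qed.

Hypothesis E0 : E 0 n.-1.

(** Along the cycle the six ends belong alternately to the two sides of K(3,3). Its nine subdivided
    edges are the three chords and the six arcs between consecutive ends. *)
Lemma hexagon_not_planar r lt a1 a2 a3 b1 b2 b3 :
  (forall x y, x < n -> y < n -> x != y -> lt y x = ~~ lt x y) ->
  (forall x y x' y', E x y -> E x' y' -> x != x' -> x != y' -> y != x' -> y != y' ->
     cr r lt x y x' y' = false) ->
  a1 < a2 -> a2 < a3 -> a3 < b1 -> b1 < b2 -> b2 < b3 -> b3 < n ->
  E a1 b1 -> E a2 b2 -> E a3 b3 -> False.
Proof.
move=> Hlt Hcr l1 l2 l3 l4 l5 l6 e1 e2 e3.
pose u := nth 0 [:: a1; a3; b2]; pose w := nth 0 [:: a2; b1; b3].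
(* The arc between [a1] and [b3] goes down to 0, takes the closing edge to [n.-1] and comes down to
   [b3]. *)
pose p i j := nth [::] (nth [::] [::
  [:: up a1 (a2 - a1); [:: b1]; down a1 a1 ++ n.-1 :: down n.-1 (n.-1 - b3)];
  [:: down a3 (a3 - a2); up a3 (b1 - a3); [:: b3]];
  [:: [:: a2]; down b2 (b2 - b1); up b2 (b3 - b2)]] i) j.
(* Arithmetic conditions satisfied by the vertices of each path: disjointness of paths becomes a
   matter of inequalities. *)
pose M i j k := nth false (nth [::] [::
  [:: a1 <= k <= a2; (k == a1) || (k == b1); (k <= a1) || (b3 <= k)];
  [:: a2 <= k <= a3; a3 <= k <= b1; (k == a3) || (k == b3)];
  [:: (k == b2) || (k == a2); b1 <= k <= b2; b2 <= k <= b3]] i) j.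
have P i j : i < 3 -> j < 3 -> [/\ path E (u i) (p i j), last (u i) (p i j) = w j &
    forall k, k \in u i :: p i j -> M i j k].
  case: i => [|[|[|//]]] _; case: j => [|[|[|//]]] _; rewrite /u /w /p /M /=; split.
  all: try by rewrite ?last_up ?last_down; lia.
  all: try by rewrite ?path_up ?path_down //=; lia.
  all: try by move=> k; rewrite inE => /orP[/eqP ->|/mem_up]; lia.
  all: try by move=> k; rewrite !inE.
  all: try by rewrite /= andbT // Esym.
  - rewrite cat_path path_down //=; try lia; rewrite last_down // subnn E0 path_down //; lia.
  - by rewrite last_cat /= last_down; lia.
  - move=> k; rewrite inE mem_cat => /orP[/eqP ->|/orP[/mem_down|]]; try lia.
    by rewrite inE => /orP[/eqP ->|/mem_down]; lia.
  - by move=> k; rewrite inE => /orP[/eqP ->|/mem_down]; lia.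
  - by move=> k; rewrite inE => /orP[/eqP ->|/mem_down]; lia.
apply: (@K33_parity _ r lt u w p).
- by move=> i j i3 j3; case: (P i j i3 j3).
- move=> i k j l ik k3 j3 ll3 jl.
  have [|Pp _ Mp] := P i j _ j3; first lia.
  have [Pq _ Mq] := P k l k3 ll3.
  apply: (crpp_disjoint Hcr Pp Pq) => z /Mp m1 /Mq m2; move: m1 m2 {Pp Pq Mp Mq}.
  move: ik k3 j3 ll3 jl; rewrite /M.
  by case: i => [|[|i]]; case: k => [|[|[|//]]] //; case: j => [|[|[|//]]] //;
    case: l => [|[|[|//]]] //=; lia.
- move=> j l jl ll3; apply: Hlt; rewrite /w; case: l jl ll3 => [|[|[|//]]] //;
    case: j => [|[|//]] //=; lia.
Qed.

End PathsAlong.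
End Crossing.

Lemma planar_no_three_crossing (R : realType) (T : finType) (e : rel T) (s : seq T) x0
    a1 a2 a3 b1 b2 b3 :
  planar R e -> symmetric e -> uniq s ->
  (forall k, k.+1 < size s -> e (nth x0 s k) (nth x0 s k.+1)) ->
  e (nth x0 s 0) (nth x0 s (size s).-1) ->
  a1 < a2 -> a2 < a3 -> a3 < b1 -> b1 < b2 -> b2 < b3 -> b3 < size s ->
  e (nth x0 s a1) (nth x0 s b1) -> e (nth x0 s a2) (nth x0 s b2) ->
  e (nth x0 s a3) (nth x0 s b3) -> False.
Proof.
move=> /planar_no_cross[r [lt [Hlt Hcr]]] esym us E1 E0 l1 l2 l3 l4 l5 l6 e1 e2 e3.
pose E i j := [&& i < size s, j < size s & e (nth x0 s i) (nth x0 s j)].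
apply: (@hexagon_not_planar (size s) E _ _ _
  (fun z x y => r (nth x0 s z) (nth x0 s x) (nth x0 s y))
  (fun x y => lt (nth x0 s x) (nth x0 s y)) _ _ _ _ _ _ _ _ l1 l2 l3 l4 l5 l6).
- by move=> i j; rewrite /E esym andbCA.
- by move=> k kn; rewrite /E E1 // kn ltnW.
- by rewrite /E E0; lia.
- by move=> x y xs ys xy; apply: Hlt; rewrite nth_uniq.
- move=> x y x' y' /and3P[xs ys exy] /and3P[xs' ys' exy'] *.
  by apply: Hcr; rewrite ?nth_uniq.
- by rewrite /E e1; lia.
- by rewrite /E e2; lia.
- by rewrite /E e3; lia.
Qed.

(** * Drawing a graph on two pages *)

Section TwoPages.
Variables (R : realType) (T : finType) (e : rel T) (s : seq T) (col : T -> T -> bool).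
Hypotheses (alls : forall x, x \in s).
Hypotheses (esym : symmetric e) (eirr : irreflexive e) (csym : forall x y, col x y = col y x).
Local Open Scope ring_scope.

Let ix (x : T) : R := (index x s)%:R.

Let ix_inj x y : ix x = ix y -> x = y.
Proof. by move=> /eqP; rewrite eqr_nat => /eqP; apply: index_inj. Qed.

(** Vertices are placed on a line, edges are drawn as arcs of parabolas above or below it. *)
Let page x y : R := if col x y then 1 else -1.

(** With this factor the height over the abscissa [X] is [(X - a) * (b - X)], where [a] and [b] are
    the abscissas of the ends. All arcs of a page are then translates of one parabola, and two
    different ones meet at most once. *)
Definition parabola x y (t : R) : R * R :=
  (ix x + (ix y - ix x) * t, page x y * ((ix y - ix x) ^+ 2 * (t * (1 - t)))).

(** When one interval strictly contains the other, its arc is strictly higher at every common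
    abscissa; so arcs meet only if the intervals coincide or interlace. *)
Lemma parabola_meet (a b a' b' : nat) (X : R) : a%:R < X < b%:R -> a'%:R < X < b'%:R ->
  (X - a%:R) * (b%:R - X) = (X - a'%:R) * (b'%:R - X) ->
  [\/ (a = a' /\ b = b')%N, (a < a' < b)%N && (b < b')%N | (a' < a < b')%N && (b' < b)%N].
Proof.
move=> /andP[h1 h2] /andP[h3 h4] E.
have k1 : (a < b')%N by rewrite -(ltr_nat R); lra.
have k2 : (a' < b)%N by rewrite -(ltr_nat R); lra.
have strict (p q p' q' : R) : 0 < p' -> 0 < q' -> p' <= p -> q' <= q -> p' + q' < p + q ->
    p' * q' < p * q.
  move=> p0 q0 pp qq pq; have [p1|p1] := ltP p' p.
    have := mulr_gt0 (_ : 0 < p - p') (_ : 0 < q).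
    rewrite subr_gt0 => /(_ p1) /(_ (lt_le_trans q0 qq)).
    by have := mulr_ge0 (ltW p0) (_ : 0 <= q - q'); rewrite subr_ge0 => /(_ qq); lra.
  have -> : p = p' by lra.
  by rewrite ltr_pM2l //; lra.
have [ab|ab|ab] := ltngtP a a'; have [bb|bb|bb] := ltngtP b b'.
all: try (by constructor 2; rewrite k2).
all: try (by constructor 3; rewrite k1).
all: try (by constructor 1).
all: exfalso.
all: have := E; have ab' := ab; have bb' := bb.
all: rewrite -?(ltr_nat R) in ab' bb'.
all: try have ab2 : (a%:R : R) = a'%:R by [rewrite ab'].
all: try have bb2 : (b%:R : R) = b'%:R by [rewrite bb'].
- have := @strict (X - a%:R) (b%:R - X) (X - a'%:R) (b'%:R - X).
  by do 5![move=> /(_ ltac:(lra))]; lra.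
- have := @strict (X - a%:R) (b%:R - X) (X - a'%:R) (b'%:R - X).
  by do 5![move=> /(_ ltac:(lra))]; lra.
- have := @strict (X - a'%:R) (b'%:R - X) (X - a%:R) (b%:R - X).
  by do 5![move=> /(_ ltac:(lra))]; lra.
- have := @strict (X - a'%:R) (b'%:R - X) (X - a%:R) (b%:R - X).
  by do 5![move=> /(_ ltac:(lra))]; lra.
- have := @strict (X - a'%:R) (b'%:R - X) (X - a%:R) (b%:R - X).
  by do 5![move=> /(_ ltac:(lra))]; lra.
- have := @strict (X - a%:R) (b%:R - X) (X - a'%:R) (b'%:R - X).
  by do 5![move=> /(_ ltac:(lra))]; lra.
Qed.

Lemma two_page_planar :
  (forall x y x' y', e x y -> e x' y' -> col x y = col x' y' ->
     (index x s < index x' s)%N -> (index x' s < index y s)%N ->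
     (index y s < index y' s)%N -> False) ->
  planar R e.
Proof.
move=> nox; exists (fun x => (ix x, 0)), parabola; split.
- by move=> x y [] /ix_inj.
- move=> x y exy; split.
  + apply: continuous_subspaceT => t; rewrite /parabola.
    have c1 : (ix x + (ix y - ix x) * u @[u --> t] --> ix x + (ix y - ix x) * t)%classic.
      by apply: cvgD; [exact: cvg_cst|apply: cvgM; [exact: cvg_cst|exact: cvg_id]].
    have c2 : (page x y * ((ix y - ix x) ^+ 2 * (u * (1 - u))) @[u --> t] -->
        page x y * ((ix y - ix x) ^+ 2 * (t * (1 - t))))%classic.
      apply: cvgM; first exact: cvg_cst.
      apply: cvgM; first exact: cvg_cst.
      apply: cvgM; first exact: cvg_id.
      by apply: cvgB; [exact: cvg_cst|exact: cvg_id].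
    exact: (cvg_pair c1 c2).
  + move=> t t' _ _ [] /addrI /(mulfI _) E _; apply: E.
    by rewrite subr_eq0; apply/eqP => /ix_inj E; rewrite E eirr in exy.
  + by rewrite /parabola; congr pair; ring.
  + by rewrite /parabola; congr pair; ring.
  + by move=> t _; rewrite /parabola /page csym; congr pair; ring.
- move=> x y z exy t; rewrite in_itv /= => /andP[t0 t1] [] _ /eqP.
  have ne : ix y - ix x != 0.
    by rewrite subr_eq0; apply/eqP => /ix_inj E; rewrite E eirr in exy.
  rewrite !mulf_eq0 ?expf_eq0 /= ?(negbTE ne) (gt_eqF t0) subr_eq0 (gt_eqF t1) !orbF.
  by rewrite /page; case: (col x y); rewrite ?oppr_eq0 oner_eq0.
- move=> x y x' y' exy exy' t t'; rewrite !in_itv /= => t01 t01'.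
  pose pt (a b : T) (u : R) := parabola a b u.
  (* Every arc is read from left to right, reversed if necessary, so that only orders of indices
     remain to be compared. *)
  have order (a b : T) (u : R) : e a b -> 0 < u < 1 -> exists a0 b0, exists2 u0, e a0 b0 &
      [/\ 0 < u0 < 1, parabola a0 b0 u0 = parabola a b u, (index a0 s < index b0 s)%N &
        [set a0; b0]%SET = [set a; b]%SET].
    move=> eab /andP[u0 u1].
    have [ab|ba|/index_inj E] := ltngtP (index a s) (index b s).
    - by exists a, b, u => //; split=> //; rewrite u0 u1.
    - exists b, a, (1 - u); first by rewrite esym.
      split=> //; last by rewrite finset.setUC.
        by apply/andP; split; lra.
      by rewrite /parabola /page csym; congr pair; ring.
    - by move: eab; rewrite E // eirr.
  have [a [b [u eab [u01 <- ab <-]]]] := order x y t exy t01.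
  have [a' [b' [u' eab' [u01' <- ab' <-]]]] := order x' y' t' exy' t01'.
  rewrite /parabola => -[] X Y.
  have lab : ix a < ix b by rewrite ltr_nat.
  have lab' : ix a' < ix b' by rewrite ltr_nat.
  (* Inside an arc the height is nonzero and its sign tells the page. *)
  have colE : col a b = col a' b'.
    have p1 : 0 < (ix b - ix a) ^+ 2 * (u * (1 - u)).
      case/andP: u01 => h1 h2; rewrite mulr_gt0 // ?exprn_gt0 ?subr_gt0 // mulr_gt0 // subr_gt0 //.
    have p2 : 0 < (ix b' - ix a') ^+ 2 * (u' * (1 - u')).
      case/andP: u01' => h1 h2; rewrite mulr_gt0 // ?exprn_gt0 ?subr_gt0 // mulr_gt0 // subr_gt0 //.
    by move: Y; rewrite /page; case: (col a b); case: (col a' b') => // Y; lra.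
  have pn : page a b != 0 by rewrite /page; case: (col a b); rewrite ?oppr_eq0 oner_eq0.
  have page_eq : page a b = page a' b' by rewrite /page colE.
  rewrite -page_eq in Y; move/(mulfI pn): Y => Y.
  have [] := @parabola_meet (index a s) (index b s) (index a' s) (index b' s)
     (ix a + (ix b - ix a) * u).
  + by case/andP: u01 => h1 h2; rewrite -!/(ix _); apply/andP; split; nra.
  + by rewrite X; case/andP: u01' => h1 h2; rewrite -!/(ix _); apply/andP; split; nra.
  + rewrite -!/(ix _) {3 4}X.
    transitivity ((ix b - ix a) ^+ 2 * (u * (1 - u))); first by ring.
    by rewrite Y; ring.
  + by move=> [/index_inj -> // /index_inj -> //].
  + by move=> /andP[/andP[h1 h2] h3]; case: (nox a b a' b').
  + by move=> /andP[/andP[h1 h2] h3]; case: (nox a' b' a b).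
Qed.

End TwoPages.

(** * Planarity of linked instances *)

Lemma index_next (T : eqType) (s : seq T) x : uniq s -> x \in s ->
  index (next s x) s = if (index x s).+1 < size s then (index x s).+1 else 0.
Proof.
case: s => [//|y s] us xs; rewrite next_nth xs.
set i := index x (y :: s).
have is_ : i < (size s).+1 by rewrite /i -[(size s).+1]/(size (y :: s)) index_mem.
rewrite [size (y :: s)]/= ltnS; case: ltnP => h.
  by rewrite -[nth y s i]/(nth y (y :: s) i.+1) index_uniq.
by rewrite nth_default //= eqxx.
Qed.

Section Linked.
Variables (R : realType) (phi : cnf) (E : {set 'I_(nclauses phi) * 'I_(nvars phi)}).
Variables (cs : seq 'I_(nclauses phi)) (vs : seq 'I_(nvars phi)).

Let s : seq (vertex phi) := map inl cs ++ map inr vs.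
Let e : rel (vertex phi) := fun x y => graph_adj E x y || cycle_adj s x y.

Hypotheses (us : uniq s) (alls : forall x, x \in s) (s2 : 2 < size s).

Let size_s : size s = size cs + size vs.
Proof. by rewrite size_cat !size_map. Qed.

Let mem_cs c : c \in cs.
Proof.
have := alls (inl c); rewrite mem_cat => /orP[|/mapP[v _ //]].
by rewrite mem_map // => a b [].
Qed.

Let mem_vs v : v \in vs.
Proof.
have := alls (inr v); rewrite mem_cat => /orP[/mapP[c _ //]|].
by rewrite mem_map // => a b [].
Qed.

Let index_l c : index (inl c) s = index c cs.
Proof. by rewrite index_cat map_f ?mem_cs // index_map // => a b []. Qed.

Let index_r v : index (inr v) s = size cs + index v vs.
Proof.
rewrite index_cat size_map; case: ifP => [/mapP[c _ //]|_].
by rewrite index_map // => a b [].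
Qed.

Let graph_sym x y : graph_adj E x y = graph_adj E y x.
Proof. by case: x y => [c|v] [c'|v']. Qed.

Let cyc_sym x y : cycle_adj s x y = cycle_adj s y x.
Proof. by rewrite /cycle_adj andbCA orbC. Qed.

Let esym : symmetric e.
Proof. by move=> x y; rewrite /e graph_sym cyc_sym. Qed.

Let cyc_index x y : cycle_adj s x y ->
  [\/ index y s = (index x s).+1, index x s = (index y s).+1,
      index x s = 0 /\ index y s = (size s).-1 |
      index y s = 0 /\ index x s = (size s).-1].
Proof.
have lt z : index z s < size s by rewrite index_mem.
move=> /and3P[xs ys /orP[/eqP|/eqP]] <-; rewrite index_next //; case: ifP => H.
- by constructor 1.
- by constructor 4; split=> //; move: (lt x) H; move: (index x s) (size s) => i n; lia.
- by constructor 2.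
- by constructor 3; split=> //; move: (lt y) H; move: (index y s) (size s) => i n; lia.
Qed.

Let eirr : irreflexive e.
Proof.
move=> x; rewrite /e; have -> : graph_adj E x x = false by case: x.
by apply/negP => /cyc_index; move: (index x s) (size s) s2 => i n s2n; case; lia.
Qed.

(** Clauses precede variables on the cycle, so edges whose ends increase on both sides are pairwise
    interlaced chords. *)
Lemma linked_planar_cross : planar R e ->
  forall c1 c2 c3 v1 v2 v3, (c1, v1) \in E -> (c2, v2) \in E -> (c3, v3) \in E ->
     index c1 cs < index c2 cs -> index c2 cs < index c3 cs ->
     index v1 vs < index v2 vs -> index v2 vs < index v3 vs -> False.
Proof.
move=> pl c1 c2 c3 v1 v2 v3 e1 e2 e3 k12 k23 l12 l23.
pose x0 : vertex phi := inl c1.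
have idx i : i < size s -> index (nth x0 s i) s = i by move=> h; rewrite index_uniq.
have k3 : index c3 cs < size cs by rewrite index_mem mem_cs.
have l3 : index v3 vs < size vs by rewrite index_mem mem_vs.
have inj x y : index x s = index y s -> x = y.
  by move=> h; rewrite -[x](nth_index x0 (alls x)) h nth_index ?alls.
apply: (@planar_no_three_crossing R _ e s x0 (index (inl c1) s) (index (inl c2) s)
   (index (inl c3) s) (index (inr v1) s) (index (inr v2) s) (index (inr v3) s) pl esym us).
- move=> k ks; rewrite /e /cycle_adj !alls; apply/orP; right.
  apply/orP; left; apply/eqP; apply: inj.
  by rewrite index_next // !idx ?ks // ltnW.
- rewrite /e /cycle_adj !alls; apply/orP; right.
  apply/orP; right; apply/eqP; apply: inj; rewrite index_next //.
  have [h0 h1] : 0 < size s /\ (size s).-1.+1 = size s by move: (size s) s2 => n; lia.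
  by rewrite !idx ?h1 ?ltnn // -h1.
all: rewrite ?nth_index ?alls ?index_l ?index_r ?size_s ?ltn_add2l //.
- by rewrite (leq_trans k3) // leq_addr.
- by rewrite /e /= e1.
- by rewrite /e /= e2.
- by rewrite /e /= e3.
Qed.

Lemma linked_planar_draw :
  (forall c1 c2 c3 v1 v2 v3, (c1, v1) \in E -> (c2, v2) \in E -> (c3, v3) \in E ->
     index c1 cs < index c2 cs -> index c2 cs < index c3 cs ->
     index v1 vs < index v2 vs -> index v2 vs < index v3 vs -> False) ->
  planar R e.
Proof.
move=> no3.
(* An edge goes on the second page when it crosses an edge with smaller endpoints;
   two crossing edges on one page would then yield three pairwise crossing ones. *)
pose second c v := [exists c', exists v', [&& (c', v') \in E, index c' cs < index c cs &
  index v' vs < index v vs]].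
pose col (x y : vertex phi) := match x, y with
  | inl c, inr v | inr v, inl c => second c v | _, _ => false end.
apply: (@two_page_planar R _ e s col alls esym eirr).
  by move=> [c|v] [c'|v'].
move=> x y x' y' exy exy' cE h1 h2 h3.
have lt z : index z s < size s by rewrite index_mem.
have g1 : graph_adj E x y.
  move: exy; rewrite /e => /orP[//|/cyc_index]; move: (lt y') h1 h2 h3.
  move: (index x s) (index y s) (index x' s) (index y' s) (size s) => i j i' j' n ? ? ? ?; case; lia.
have g2 : graph_adj E x' y'.
  move: exy'; rewrite /e => /orP[//|/cyc_index]; move: (lt y') h1 h2 h3.
  move: (index x s) (index y s) (index x' s) (index y' s) (size s) => i j i' j' n ? ? ? ?; case; lia.
case: x y g1 {exy} cE h1 h2 h3 => [c|v] [c'|v'] //= g1 cE; last first.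
  rewrite index_r index_l => h1 h2 h3; have h4 : index c' cs < size cs by rewrite index_mem mem_cs.
  have := ltn_trans (ltn_trans h1 h2) h4; rewrite ltnNge leq_addr //.
case: x' y' g2 {exy'} cE => [d|w] [d'|w'] //= g2 cE; rewrite !index_l !index_r; last first.
  move=> h1 h2 h3; have h4 : index d' cs < size cs by rewrite index_mem mem_cs.
  by have := ltn_trans (ltn_trans h2 h3) h4; rewrite ltnNge leq_addr.
move=> h1 _; rewrite ltn_add2l => h3.
have sec : second d w'.
  by apply/existsP; exists c; apply/existsP; exists v'; rewrite g1 h1 h3.
move: cE; rewrite sec => /existsP[c0 /existsP[v0 /and3P[g0 k1 k2]]].
exact: (no3 c0 c d v0 v' w').
Qed.

End Linked.

(** * Instances given by a clause/literal matrix *)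

Section MatrixInstance.
Variables (nv nc : nat) (lit : nat -> nat -> bool -> bool).

Definition matrix_cnf : cnf :=
  @Cnf nv nc [ffun c : 'I_nc => [set l : literal nv | lit c l.1 l.2]%SET].

(** Variables come backwards on the cycle, so that edges whose clauses and variables increase
    together are nested instead of crossing. *)
Definition matrix_instance : instance :=
  @Instance matrix_cnf (incidence_edges matrix_cnf)
    (map inl (enum 'I_nc) ++ map inr (rev (enum 'I_nv))).

Definition occ c v := lit c v true || lit c v false.

Lemma occursE (c : 'I_nc) (v : 'I_nv) : @occurs matrix_cnf v c = occ c v.
Proof.
rewrite /occurs /occ; apply/existsP/orP => [[b]|[] h].
- by rewrite ffunE inE /=; case: b; [left|right].
- by exists true; rewrite ffunE inE.
- by exists false; rewrite ffunE inE.
Qed.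

Lemma enum_prod (A B : finType) : enum {: A * B} = [seq (a, b) | a <- enum A, b <- enum B].
Proof. by transitivity (prod_enum A B); rewrite // enumT unlock. Qed.

Lemma enum_boolE : enum {: bool} = [:: true; false].
Proof. by rewrite enumT unlock. Qed.

Lemma encode_matrix_cycle s : encode (@Instance matrix_cnf (incidence_edges matrix_cnf) s) =
  unary nv ++ unary nc ++
  flatten [seq flatten [seq [:: lit c v true; lit c v false] | v <- iota 0 nv] | c <- iota 0 nc] ++
  flatten [seq [seq occ c v | v <- iota 0 nv] | c <- iota 0 nc] ++
  flatten [seq encode_vertex x | x <- s].
Proof.
rewrite /encode /=; do 2!congr cat; congr cat; last congr cat.
- rewrite enum_prod map_allpairs -(val_enum_ord nc) -[in RHS]map_comp.
  congr flatten; apply: eq_map => c /=.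
  rewrite enum_prod enum_boolE -(val_enum_ord nv) -[in RHS]map_comp map_flatten -map_comp.
  by congr flatten; apply: eq_map => v /=; rewrite !ffunE !inE.
- rewrite enum_prod map_allpairs -(val_enum_ord nc) -[in RHS]map_comp.
  congr flatten; apply: eq_map => c /=.
  rewrite -(val_enum_ord nv) -[in RHS]map_comp; apply: eq_map => v /=.
  by rewrite inE occursE.
Qed.

(** The enumerations are turned into nested loops over [iota], the form in which words are
    generated. *)
Lemma encode_matrix : encode matrix_instance =
  unary nv ++ unary nc ++
  flatten [seq flatten [seq [:: lit c v true; lit c v false] | v <- iota 0 nv] | c <- iota 0 nc] ++
  flatten [seq [seq occ c v | v <- iota 0 nv] | c <- iota 0 nc] ++
  flatten [seq true :: unary c | c <- iota 0 nc] ++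
  flatten [seq false :: unary (nv - i.+1) | i <- iota 0 nv].
Proof.
rewrite encode_matrix_cycle; do 4!congr cat.
rewrite map_cat flatten_cat; congr cat.
  rewrite -(val_enum_ord nc) -!map_comp; congr flatten; exact: eq_map.
congr flatten.
apply: (@eq_from_nth _ [::]); rewrite !size_map size_rev size_enum_ord ?size_iota // => i ilt.
have i2 : nv - i.+1 < nv by lia.
rewrite (nth_map (inr (Ordinal i2))) ?size_map ?size_rev ?size_enum_ord //.
rewrite (nth_map (Ordinal i2)) ?size_rev ?size_enum_ord // (nth_map 0) ?size_iota //.
by rewrite nth_rev size_enum_ord // nth_iota // add0n /= nth_enum_ord.
Qed.

Definition msat (a : nat -> bool) c := has (fun v => lit c v (a v)) (iota 0 nv).

Lemma satisfies_matrix (a : {ffun 'I_nv -> bool}) (a' : nat -> bool) :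
  (forall i : 'I_nv, a i = a' i) ->
  @satisfies matrix_cnf a = all (msat a') (iota 0 nc).
Proof.
move=> aa; apply/forallP/allP => H.
- move=> c; rewrite mem_iota add0n => /= cn; have /existsP[[v b]] := H (Ordinal cn).
  rewrite ffunE inE /= => /andP[h /eqP ab].
  by apply/hasP; exists (val v); rewrite ?mem_iota ?add0n //= -aa ab.
- move=> c; have /hasP[v] : msat a' c by apply: H; rewrite mem_iota add0n /=.
  rewrite mem_iota add0n /= => vn h.
  apply/existsP; exists (Ordinal vn, a' v); rewrite ffunE inE /= h.
  by rewrite aa eqxx.
Qed.

Hypothesis lit_inj : forall c c', c < nc -> c' < nc ->
  (forall v b, v < nv -> lit c v b = lit c' v b) -> c = c'.
Variable vars : nat -> seq nat.
Hypothesis size_vars : forall c, size (vars c) <= 3.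
Hypothesis occ_vars : forall c v, c < nc -> v < nv -> occ c v -> v \in vars c.

Lemma matrix_3SAT : is_3SAT matrix_cnf.
Proof.
split.
  move=> c c' /=; rewrite !ffunE => E; apply: val_inj; apply: (lit_inj (ltn_ord c) (ltn_ord c')) => v b vn.
  by move/setP: E => /(_ (Ordinal vn, b)); rewrite !inE.
move=> c; apply: leq_trans (size_vars c).
rewrite cardE -(size_map val); apply: uniq_leq_size.
  by rewrite map_inj_uniq ?enum_uniq //; exact: val_inj.
move=> v /mapP[w]; rewrite mem_enum inE occursE => h ->.
exact: (occ_vars (ltn_ord c) (ltn_ord w) h).
Qed.

Lemma matrix_linked R : 2 < nc + nv ->
  (forall c1 c2 c3 v1 v2 v3, c1 < c2 -> c2 < c3 -> c3 < nc -> v3 < v2 -> v2 < v1 -> v1 < nv ->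
     occ c1 v1 -> occ c2 v2 -> occ c3 v3 -> False) ->
  linked_planar_3SAT R matrix_instance.
Proof.
move=> n2 no3.
have us : uniq (cycle_seq matrix_instance).
  rewrite cat_uniq; apply/and3P; split.
  - by rewrite map_inj_uniq ?enum_uniq // => a b [].
  - by apply/hasPn => x /mapP[v _ ->]; apply/negP => /mapP[c _].
  - by rewrite map_inj_uniq ?rev_uniq ?enum_uniq // => a b [].
have alls x : x \in cycle_seq matrix_instance.
  rewrite mem_cat; apply/orP.
  by case: x => x; [left|right]; apply: map_f; rewrite ?mem_rev mem_enum.
have s2 : 2 < size (cycle_seq matrix_instance).
  by rewrite /matrix_instance /= size_cat !size_map size_rev -?enumT !size_enum_ord.
split=> //.
- exact: matrix_3SAT.
- by exists (enum 'I_nc), (rev (enum 'I_nv)).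
- apply: linked_planar_draw => // c1 c2 c3 v1 v2 v3.
  rewrite !inE !occursE /= => o1 o2 o3.
  have idx (v : 'I_nv) : index v (rev (enum 'I_nv)) = nv - v.+1.
    have := nth_rev v (n := nv - v.+1) (s := enum 'I_nv).
    rewrite size_enum_ord => /(_ _) E.
    have vn := ltn_ord v.
    have {}E : nth v (rev (enum 'I_nv)) (nv - v.+1) = v.
      rewrite E; last lia.
      by apply: val_inj; rewrite /= nth_enum_ord; lia.
    rewrite -{1}E index_uniq ?rev_uniq ?enum_uniq // size_rev size_enum_ord; lia.
  have idc (c : 'I_nc) : index c (enum 'I_nc) = c by exact: index_enum_ord.
  rewrite !idx !idc => h1 h2 h3 h4.
  have flip (a b : nat) : nv - a.+1 < nv - b.+1 -> b < a by lia.
  by apply: (no3 c1 c2 c3 v1 v2 v3 h1 h2 (ltn_ord c3) (flip _ _ h4) (flip _ _ h3) (ltn_ord v1)).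
Qed.

End MatrixInstance.

(** * Chains of gates as linked formulas *)

(** Gate [g] computes variable [g + W] from the variables [g - 1], [g] and [g + 1]:
    codes 0, 1, 2 copy [g], [g - 1], [g + 1], and code [3 + al + 2 be + 4 o] computes
    [o + (g - 1 + al) * (g + be)] over the two-element field. *)
Definition g_al c := nth false [:: false; false; false; false; true; false; true; false; true; false; true] c.
Definition g_be c := nth false [:: false; false; false; false; false; true; true; false; false; true; true] c.
Definition g_o c := nth false [:: false; false; false; false; false; false; false; true; true; true; true] c.

Definition gatev (c : nat) (l m r : bool) : bool :=
  match c with
  | 0 => m | 1 => l | 2 => r
  | _ => g_o c (+) ((l (+) g_al c) && (m (+) g_be c))
  end.

Section Gates.
Variables (W G : nat) (op ini : nat -> nat).

(** Status of an initial variable: 0 and 1 fix it, 2 leaves it free. *)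
Definition init_lit c (v : nat) (b : bool) :=
  (v == c) && (if b then 0 < ini c else ini c != 1).

(** The offsets are increased by one so that -1 can be expressed with natural numbers. *)
Definition copy_src g k := g + nth 0 [:: 1; 0; 2] k - 1.

(** Clauses 0 and 1 express equality. Clause 2 is a tautology that brings every gate to three
    clauses, so that gate and clause are found by division by 3. *)
Definition copy_lit g k e (v : nat) (b : bool) :=
  if e == 0 then ((v == copy_src g k) && b) || ((v == g + W) && ~~ b)
  else if e == 1 then ((v == copy_src g k) && ~~ b) || ((v == g + W) && b)
  else v == g + W.

(** The order of the clauses matters for the drawing: the first has the input [g - 1], the second
    both inputs, the third the input [g], so that inputs never decrease. *)
Definition and_lit g k e (v : nat) (b : bool) :=
  if e == 0 then ((v == g - 1) && (b == ~~ g_al k)) || ((v == g + W) && (b == g_o k))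
  else if e == 1 then ((v == g - 1) && (b == g_al k)) ||
    (((v == g) && (b == g_be k)) || ((v == g + W) && (b == ~~ g_o k)))
  else ((v == g) && (b == ~~ g_be k)) || ((v == g + W) && (b == g_o k)).

Definition gate_lit g e v b :=
  if op g < 3 then copy_lit g (op g) e v b else and_lit g (op g) e v b.

(** A clause for each initial variable, tautological if that variable is free, then three for each
    gate, then a unit clause that makes the output true. *)
Definition glit c v b :=
  if c < W then init_lit c v b
  else if c < W + 3 * G then gate_lit ((c - W) %/ 3) ((c - W) %% 3) v b
  else (v == (W + G).-1) && b.

Definition gnv := W + G.
Definition gnc := W + 3 * G + 1.

Hypotheses (W2 : 2 <= W) (G0 : 0 < G).
Hypothesis op0 : op 0 = 0.
(** After a gate that reads [g.+1], a gate reading [g] would make the staircase of inputs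
    decrease. *)
Hypothesis op_left : forall g, op g = 2 -> op g.+1 = 0.
Hypothesis op_le : forall g, op g <= 10.

Let opP g : op g = 0 \/ 0 < g.
Proof. by case: g => [|g]; [left|right]. Qed.

Lemma glit_gate g e v b : g < G -> e < 3 -> glit (W + 3 * g + e) v b = gate_lit g e v b.
Proof.
move=> gG e3; rewrite /glit ifN; last by lia.
rewrite ifT; last by lia.
have -> : W + 3 * g + e - W = g * 3 + e by lia.
by rewrite divnMDl // divn_small // addn0 modnMDl modn_small.
Qed.

Variant gate_index_spec : nat -> Prop :=
  | GInit c of c < W : gate_index_spec c
  | GGate g e of g < G & e < 3 : gate_index_spec (W + 3 * g + e)
  | GLast : gate_index_spec (W + 3 * G).

Lemma gate_indexP c : c < gnc -> gate_index_spec c.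
Proof.
rewrite /gnc => cn; case: (ltnP c W) => cW; first exact: GInit.
case: (ltnP c (W + 3 * G)) => cG.
  have -> : c = W + 3 * ((c - W) %/ 3) + (c - W) %% 3.
    by have := divn_eq (c - W) 3; lia.
  by apply: GGate; [rewrite ltn_divLR //; lia|rewrite ltn_mod].
have -> : c = W + 3 * G by lia.
exact: GLast.
Qed.

Lemma has_point n s (P : nat -> bool) : s < n -> has (fun v => (v == s) && P v) (iota 0 n) = P s.
Proof.
move=> sn; apply/hasP/idP => [[v _ /andP[/eqP -> //]]|Ps].
by exists s; rewrite ?mem_iota ?add0n //= eqxx.
Qed.

Lemma has_orE (T : Type) (p q : pred T) s : has (fun v => p v || q v) s = has p s || has q s.
Proof. exact: has_predU. Qed.

Lemma msat_gate a g : g < G ->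
  [&& msat gnv glit a (W + 3 * g + 0), msat gnv glit a (W + 3 * g + 1) &
      msat gnv glit a (W + 3 * g + 2)] = (a (g + W) == gatev (op g) (a (g - 1)) (a g) (a g.+1)).
Proof.
move=> gG; rewrite /msat.
have E e : e < 3 -> has (fun v => glit (W + 3 * g + e) v (a v)) (iota 0 gnv) =
    has (fun v => gate_lit g e v (a v)) (iota 0 gnv).
  by move=> e3; apply: eq_has => v; rewrite glit_gate.
rewrite !E //; have := op_le g; rewrite /gate_lit.
have gW : g + W < gnv by rewrite /gnv; lia.
have g0 : g < gnv by rewrite /gnv; lia.
have g1 : g - 1 < gnv by rewrite /gnv; lia.
have g2 : g.+1 < gnv by rewrite /gnv; lia.
move: (op g) => k; case: ltnP => k3 k10.
- have sk : copy_src g k < gnv by rewrite /copy_src; case: k k3 k10 => [|[|[|//]]] /=; lia.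
  rewrite /copy_lit /=.
  have H2 : has (fun v : nat => v == g + W) (iota 0 gnv).
    by apply/hasP; exists (g + W); rewrite ?mem_iota ?add0n.
  rewrite !has_orE !(has_point _ sk) !(has_point _ gW) H2.
  have -> : gatev k (a (g - 1)) (a g) (a g.+1) = a (copy_src g k).
    by rewrite /copy_src; case: k k3 {k10 sk} => [|[|[|//]]] _ /=; congr a; lia.
  by case: (a (copy_src g k)); case: (a (g + W)).
- rewrite /and_lit /= !has_orE !(has_point _ g1) !(has_point _ gW) !(has_point _ g0).
  have -> : gatev k (a (g - 1)) (a g) (a g.+1) =
      g_o k (+) ((a (g - 1) (+) g_al k) && (a g (+) g_be k)) by case: k k3 {k10} => [|[|[|]]].
  by case: (a (g - 1)); case: (a g); case: (a (g + W)); case: (g_al k); case: (g_be k); case: (g_o k).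
Qed.

Lemma all_msat a : all (msat gnv glit a) (iota 0 gnc) =
  [&& all (fun c => (0 < ini c) && a c || (ini c != 1) && ~~ a c) (iota 0 W),
      all (fun g => a (g + W) == gatev (op g) (a (g - 1)) (a g) (a g.+1)) (iota 0 G) &
      a gnv.-1].
Proof.
have Einit c : c < W -> msat gnv glit a c = ((0 < ini c) && a c || (ini c != 1) && ~~ a c).
  move=> cW; rewrite /msat /glit cW /init_lit has_point; last by rewrite /gnv; lia.
  by case: (a c); rewrite ?andbT ?andbF ?orbF.
have Elast : msat gnv glit a (W + 3 * G) = a gnv.-1.
  have nW : (W + 3 * G < W) = false by lia.
  by rewrite /msat /glit nW ltnn (has_point a) //; rewrite /gnv; lia.
apply/allP/and3P => [H|[/allP H1 /allP H2 H3] c].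
- have {}H c : c < gnc -> msat gnv glit a c by move=> cn; apply: H; rewrite mem_iota add0n.
  split.
  + apply/allP => c; rewrite mem_iota add0n => /= cW; rewrite -Einit //.
    by apply: H; rewrite /gnc; lia.
  + apply/allP => g; rewrite mem_iota add0n => /= gG; rewrite -msat_gate //.
    by rewrite !H // /gnc; lia.
  + by rewrite -Elast; apply: H; rewrite /gnc; lia.
- rewrite mem_iota add0n => /= cn; case: (gate_indexP cn) => [c0 cW|g e gG e3|].
  + by rewrite Einit //; apply: H1; rewrite mem_iota add0n.
  + have := H2 g; rewrite mem_iota add0n => /(_ gG); rewrite -msat_gate // => /and3P[].
    by case: e e3 => [|[|[|]]].
  + by rewrite Elast.
Qed.

Definition topv c := if c < W then c else if c < W + 3 * G then (c - W) %/ 3 + W else gnv.-1.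

Definition inlo c := (c - W) %/ 3.

(** When the gate copies its right neighbour, adding 2 turns the first entry into [g.+1]. *)
Definition gvars c : seq nat := [:: (inlo c - 1) + (op (inlo c) == 2) * 2; inlo c; topv c].

Lemma topv_gate g e : g < G -> e < 3 -> topv (W + 3 * g + e) = g + W.
Proof.
move=> gG e3; rewrite /topv ifN; last by lia.
rewrite ifT; last by lia.
have -> : W + 3 * g + e - W = g * 3 + e by lia.
by rewrite divnMDl // divn_small // addn0.
Qed.

Lemma inlo_gate g e : e < 3 -> inlo (W + 3 * g + e) = g.
Proof.
move=> e3; rewrite /inlo; have -> : W + 3 * g + e - W = g * 3 + e by lia.
by rewrite divnMDl // divn_small // addn0.
Qed.

(** Variables of a clause other than the last one. *)
Definition is_input c v := exists g e, [/\ g < G, e < 3, c = W + 3 * g + e &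
  [\/ [/\ op g = 0 & v = g], [/\ op g = 1, 0 < g & v = g - 1], [/\ op g = 2 & v = g.+1] |
      [/\ 2 < op g, 0 < g & (v = g - 1 /\ e < 2) \/ (v = g /\ 0 < e)]]].

Lemma occ_split c v : c < gnc -> occ glit c v -> v = topv c \/ is_input c v.
Proof.
move=> cn; case: (gate_indexP cn) => [c0 cW|g e gG e3|].
- by rewrite /occ /glit /topv cW /init_lit; case: eqP => //= ->; left.
- rewrite topv_gate // /occ !glit_gate // => H.
  case: (eqVneq v (g + W)) => vW; first by left.
  right; exists g, e; split=> //; move: H; rewrite /gate_lit.
  have := op_le g; case: (opP g) => [p0|g0].
    rewrite p0 /copy_lit /copy_src /= (negbTE vW) /=.
    case: (v =P g) => [->|ne] _; first by constructor 1.
    have -> : (v == g + 1 - 1) = false by lia.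
    by do 2?case: ifP.
  case: ltnP => k3 k10.
    move=> H; have : v == copy_src g (op g).
      by move: H; rewrite /copy_lit (negbTE vW); case: (v == _) => //; do 2?case: ifP.
    rewrite /copy_src; case: (op g) k3 {k10 H} => [|[|[|//]]] _ /= /eqP ->.
    - by constructor 1; split=> //; lia.
    - by constructor 2; split=> //; lia.
    - by constructor 3; split=> //; lia.
  rewrite /and_lit (negbTE vW) /=.
  case: e e3 => [|[|[|//]]] _ /=; rewrite ?orbF.
  + by case: (v =P g - 1) => //= -> _; constructor 4; split=> //; left.
  + case: (v =P g - 1) => /= [-> _|_]; first by constructor 4; split=> //; left.
    by case: (v =P g) => //= -> _; constructor 4; split=> //; right.
  + by case: (v =P g) => //= -> _; constructor 4; split=> //; right.
- rewrite /occ /glit /topv !ifN ?ltnn //; try lia.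
  by rewrite andbF orbF andbT => /eqP ->; left.
Qed.

Lemma topv_mono c c' : c <= c' -> c' < gnc -> topv c <= topv c'.
Proof.
rewrite /topv /gnc /gnv => cc cn; do 2![case: ltnP => ?]; do 2?[case: ltnP => ?]; lia.
Qed.

(** Inside one gate this rests on the order of its clauses, and from one gate to the next on
    [op_left]. *)
Lemma input_mono c c' v v' : c < c' -> is_input c v -> is_input c' v' -> v <= v'.
Proof.
move=> cc [g [e [gG e3 cE H]]] [g' [e' [gG' e3' cE' H']]].
have gg : g < g' \/ (g = g' /\ e < e') by lia.
case: gg => [gg|[gg ee]]; last first.
  by subst g'; case: H => -[]; case: H' => -[]; lia.
have K : op g = 2 -> g' = g.+1 -> op g' = 0 by move=> /op_left <- ->.
by case: H => -[]; case: H' => -[]; lia.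
Qed.

(** Two of the three edges lie on the same staircase, and a monotone staircase contains no such
    pair. *)
Lemma gates_no3 c1 c2 c3 v1 v2 v3 : c1 < c2 -> c2 < c3 -> c3 < gnc -> v3 < v2 -> v2 < v1 ->
  v1 < gnv -> occ glit c1 v1 -> occ glit c2 v2 -> occ glit c3 v3 -> False.
Proof.
move=> c12 c23 c3n v32 v21 v1n.
have T c c' v v' : c < c' -> c' < gnc -> v' < v -> v = topv c -> v' = topv c' -> False.
  by move=> cc cn vv e e'; have := topv_mono (ltnW cc) cn; lia.
have I c c' v v' : c < c' -> v' < v -> is_input c v -> is_input c' v' -> False.
  by move=> cc vv i i'; have := input_mono cc i i'; lia.
have c2n := ltn_trans c23 c3n; have c1n := ltn_trans c12 c2n.
have c13 := ltn_trans c12 c23; have v31 := ltn_trans v32 v21.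
move=> /(occ_split c1n) [h1|h1] /(occ_split c2n) [h2|h2] /(occ_split c3n) [h3|h3].
all: first [by apply: (T c1 c2 v1 v2)|by apply: (T c2 c3 v2 v3)|by apply: (T c1 c3 v1 v3)
  |by apply: (I c1 c2 v1 v2)|by apply: (I c2 c3 v2 v3)|by apply: (I c1 c3 v1 v3)].
Qed.

Lemma gates_vars c v : c < gnc -> v < gnv -> occ glit c v -> v \in gvars c.
Proof.
move=> cn vn /(occ_split cn) [->|]; first by rewrite !inE eqxx !orbT.
move=> [g [e [gG e3 -> H]]]; rewrite !inE inlo_gate //.
case: H => -[].
- by move=> _ ->; rewrite eqxx !orbT.
- by move=> -> _ ->; rewrite addn0 eqxx.
- move=> o2 ->; have : 0 < g by case: (opP g) => //; rewrite o2.
  by rewrite o2 => g0; apply/orP; left; apply/eqP => /=; lia.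
- move=> o3 g0 [[-> _]|[-> _]]; last by rewrite eqxx orbT.
  by rewrite (gtn_eqF o3) addn0 eqxx.
Qed.

(** A clause determines its largest variable, hence its gate, and the clauses of one gate differ in
    their literals on [g] or [g + W]. The output clause has a single literal, unlike those of the
    last gate, with which it shares its largest variable. *)
Lemma gates_inj c c' : c < gnc -> c' < gnc ->
  (forall v b, v < gnv -> glit c v b = glit c' v b) -> c = c'.
Proof.
move=> cn cn' E.
have top c0 : c0 < gnc -> occ glit c0 (topv c0) /\ topv c0 < gnv.
  move=> c0n; case: (gate_indexP c0n) => [c1 cW|g e gG e3|].
  - rewrite /occ /glit /topv cW /init_lit eqxx /gnv; split; last lia.
    by case: (ini c1) => [|[|]].
  - rewrite topv_gate // /occ !glit_gate // /gate_lit /copy_lit /and_lit eqxx /= !andbT.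
    split; last by rewrite /gnv; lia.
    by case: ltnP => _; case: e e3 => [|[|[|]]] //= _; case: (g_o _); rewrite ?orbT.
  - rewrite /occ /glit /topv !ifN ?ltnn; try lia.
    by rewrite eqxx /gnv; split=> //; lia.
have le_top c0 v : c0 < gnc -> occ glit c0 v -> v <= topv c0.
  move=> c0n /(occ_split c0n) [-> //|[g [e [gG e3 cE H]]]].
  by rewrite cE topv_gate //; case: H => -[]; lia.
have occE v : v < gnv -> occ glit c v = occ glit c' v by move=> vn; rewrite /occ !E.
have tE : topv c = topv c'.
  have [h1 l1] := top c cn; have [h2 l2] := top c' cn'.
  apply/eqP; rewrite eqn_leq (le_top c') ?(le_top c) //; first by rewrite occE.
  by rewrite -occE.
wlog cc : c c' cn cn' E tE {occE} / c <= c'.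
  move=> H; case: (leqP c c') => h; first exact: H.
  by apply/esym; apply: H => //; [move=> v b vn; rewrite E|exact: ltnW].
move: tE E; case: (gate_indexP cn) cc => [c1 cW|g e gG e3|]; last first.
- by move=> h _ _; apply/eqP; rewrite eqn_leq h; move: cn'; rewrite /gnc; lia.
- case: (gate_indexP cn') => [c2 cW|g' e' gG' e3'|]; first by lia.
    rewrite !topv_gate // => _ tE; have gg : g = g' by lia.
    subst g' => E; congr (_ + _).
    have Eo b : gate_lit g e (g + W) b = gate_lit g e' (g + W) b.
      by rewrite -!glit_gate // E // /gnv; lia.
    have Ei b : gate_lit g e g b = gate_lit g e' g b.
      by rewrite -!glit_gate // E // /gnv; lia.
    move: (Eo true) (Eo false) (Ei true) (Ei false); rewrite /gate_lit; case: ltnP => k3.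
      have ns : (g + W == copy_src g (op g)) = false.
        by rewrite /copy_src; case: (op g) k3 => [|[|[|]]] //= _; lia.
      by rewrite /copy_lit ns eqxx; case: e e3 {E Eo Ei} => [|[|[|]]] //; case: e' e3' => [|[|[|]]].
    have g0 : 0 < g by case: (opP g) => // h; rewrite h in k3.
    have n1 : (g + W == g - 1) = false by lia.
    have n2 : (g + W == g) = false by lia.
    have n3 : (g == g - 1) = false by lia.
    have n4 : (g == g + W) = false by lia.
    rewrite /and_lit n1 n2 n3 n4 !eqxx /=.
    by case: e e3 {E Eo Ei} => [|[|[|]]] //; case: e' e3' => [|[|[|]]] //=; case: (g_o _); case: (g_be _).
  move=> _; rewrite topv_gate // {1}/topv !ifN ?ltnn; try lia.
  rewrite /gnv => tE E; exfalso.
  have gE : g = G.-1 by lia.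
  have El v b : v < W + G -> gate_lit g e v b = (v == (W + G).-1) && b.
    by move=> vn; rewrite -glit_gate // E // /glit !ifN ?ltnn //; lia.
  have b1 : g + W < W + G by lia.
  have b2 : g < W + G by lia.
  have b3 : g - 1 < W + G by lia.
  have b4 : g.+1 < W + G by lia.
  move: (El _ true b1) (El _ false b1) (El _ true b2) (El _ false b2)
    (El _ true b3) (El _ false b3) (El _ true b4) (El _ false b4).
  have -> : (g == (W + G).-1) = false by lia.
  have -> : (g - 1 == (W + G).-1) = false by lia.
  have -> : (g.+1 == (W + G).-1) = false by lia.
  have -> : g + W == (W + G).-1 by lia.
  have n4 : (g == g + W) = false by lia.
  have n5 : (g - 1 == g + W) = false by lia.
  have n6 : (g.+1 == g + W) = false by lia.
  have n7 : (g + W == g) = false by lia.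
  have n8 : (g + W == g - 1) = false by lia.
  have n9 : (g + W == g.+1) = false by lia.
  rewrite /gate_lit /copy_lit /and_lit n4 n5 n6 n7 n8 !eqxx /=.
  case: ltnP => k3.
    have : [\/ copy_src g (op g) = g, copy_src g (op g) = g - 1 | copy_src g (op g) = g.+1].
      by rewrite /copy_src; case: (op g) k3 => [|[|[|]]] //= _; [constructor 1|constructor 2|constructor 3]; lia.
    by case: e e3 {E El} => [|[|[|]]] //= _; case=> sE; rewrite ?sE ?n7 ?n8 ?n9 ?eqxx /=.
  by case: e e3 {E El} => [|[|[|]]] //= _; case: (g_al _); case: (g_be _); rewrite ?orbT ?eqxx /=.
case: (gate_indexP cn') => [c2 cW2|g' e' gG' e3'|] _.
- by rewrite /topv cW cW2.
- by rewrite topv_gate // /topv cW; lia.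
- by rewrite /topv cW !ifN ?ltnn; rewrite /gnv; lia.
Qed.

Definition gate_instance := matrix_instance gnv gnc glit.

Lemma gate_instance_linked R : linked_planar_3SAT R gate_instance.
Proof.
apply: (@matrix_linked gnv gnc glit gates_inj gvars) => //.
- exact: gates_vars.
- by rewrite /gnc /gnv; lia.
- exact: gates_no3.
Qed.

(** The values forced on all variables by those of the free ones. *)
Fixpoint gval_rec (f : nat -> bool) (fuel n : nat) : bool :=
  if fuel is k.+1 then
    if n < W then (if ini n == 2 then f n else ini n == 1)
    else gatev (op (n - W)) (gval_rec f k (n - W - 1)) (gval_rec f k (n - W))
           (gval_rec f k (n - W).+1)
  else false.

Definition gval f n := gval_rec f n.+1 n.

Lemma gval_recE f k n : n < k -> gval_rec f k n = gval f n.
Proof.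
rewrite /gval; elim/ltn_ind: n k => n IH [|k] // nk /=; case: ifP => // /negbT; rewrite -leqNgt => Wn.
have [l1 l2 l3] : [/\ n - W - 1 < n, n - W < n & (n - W).+1 < n] by split; lia.
congr gatev.
- by rewrite (IH _ l1 k) ?(IH _ l1 n) //; lia.
- by rewrite (IH _ l2 k) ?(IH _ l2 n) //; lia.
- by rewrite (IH _ l3 k) ?(IH _ l3 n) //; lia.
Qed.

Lemma gval_init f n : n < W -> gval f n = if ini n == 2 then f n else ini n == 1.
Proof. by move=> nW; rewrite /gval /= nW. Qed.

Lemma gval_gate f g : gval f (g + W) = gatev (op g) (gval f (g - 1)) (gval f g) (gval f g.+1).
Proof.
rewrite {1}/gval /= ifN -?leqNgt ?leq_addl // addnK.
by rewrite !gval_recE //; lia.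
Qed.

Hypothesis ini_le : forall n, ini n <= 2.

(** Since [W] is at least 2, a gate reads only variables before its own, so its clauses leave no
    choice. The assignment [a] serves as its own table of values for the free variables. *)
Lemma gval_sat (a : nat -> bool) :
  all (msat gnv glit a) (iota 0 gnc) <->
  (forall n, n < gnv -> a n = gval a n) /\ gval a gnv.-1.
Proof.
rewrite all_msat; split.
- move=> /and3P[/allP H1 /allP H2 H3].
  have E : forall n, n < gnv -> a n = gval a n.
    elim/ltn_ind => n IH nn; case: (ltnP n W) => nW.
      rewrite gval_init //; have := H1 n; rewrite mem_iota add0n => /(_ nW).
      by have := ini_le n; case: (ini n) => [|[|[|]]] //= _; case: (a n).
    rewrite -(subnK nW) gval_gate; have := H2 (n - W); rewrite mem_iota add0n => /(_ _) /eqP ->.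
      by rewrite -!IH //; lia.
    by move: nn; rewrite /gnv /=; lia.
  by split=> //; rewrite -E // /gnv; lia.
- move=> [E H]; apply/and3P; split; last by rewrite E // /gnv; lia.
  + apply/allP => n; rewrite mem_iota add0n /= => nW; rewrite E ?gval_init //; last by rewrite /gnv; lia.
    by have := ini_le n; case: (ini n) => [|[|[|]]] //= _; case: (a n).
  + apply/allP => g; rewrite mem_iota add0n /= => gG.
    by rewrite !E ?gval_gate // /gnv; lia.
Qed.

End Gates.

(** * NOR circuits as chains of gates *)

Section NorCircuit.
Variables (q N : nat) (wire : nat -> nat -> bool).

Fixpoint nor_rec (y : nat -> bool) (fuel g : nat) : bool :=
  if fuel is k.+1 then
    if g < q then y g else ~~ has (fun i => wire g i && nor_rec y k i) (iota 0 g)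
  else false.

Definition nor y g := nor_rec y g.+1 g.

Lemma nor_recE y k g : g < k -> nor_rec y k g = nor y g.
Proof.
rewrite /nor; elim/ltn_ind: g k => g IH [|k] // gk /=; case: ifP => // _.
congr (~~ _); apply: eq_in_has => i; rewrite mem_iota add0n /= => ig.
by rewrite (IH i ig k) ?(IH i ig g) //; lia.
Qed.

Lemma nor_input y g : g < q -> nor y g = y g.
Proof. by rewrite /nor /= => ->. Qed.

Lemma nor_gate y g : q <= g -> nor y g = ~~ has (fun i => wire g i && nor y i) (iota 0 g).
Proof.
move=> qg; rewrite /nor /= ifN -?leqNgt //; congr (~~ _); apply: eq_in_has => i.
by rewrite mem_iota add0n /= => ig; rewrite nor_recE.
Qed.

(** Layout: a row has [W] slots, register [i] sits in slot [5 i + 1].  In sweep [g] an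
    accumulator travels from slot 0 (constantly true) to slot [5 g]; six rows move it past
    register [i], by the usual crossing through exclusive or, which also lets it become
    [acc && ~~ R_i] when [i] is wired to [g].  For [i >= g] it is written to register [i].
    Modes: 0 idle, 1 pass, 2 absorb, 3 write.  Table entries are gate codes, indexed by
    mode, row and slot relative to [5 i]. *)
Definition nor_W := 5 * N - 3.

Definition nor_table : seq nat :=
  [:: 0;0;0;0;0;0; 0;0;0;0;0;0; 0;0;0;0;0;0; 0;0;0;0;0;0; 0;0;0;0;0;0; 0;0;0;0;0;0;
      0;7;1;0;0;0; 0;3;3;1;0;0; 0;0;10;1;1;0; 0;5;4;5;4;0; 0;0;10;0;10;0; 0;2;0;0;0;1;
      0;7;1;0;0;0; 0;3;3;1;0;0; 0;0;10;1;1;0; 0;5;4;5;4;0; 0;0;10;0;1;0; 0;2;0;0;0;1;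
      0;1;0;0;0;0; 0;0;0;0;0;0; 0;0;0;0;0;0; 0;0;0;0;0;0; 0;0;0;0;0;0; 0;0;0;0;0;0].

Definition cell_op (m l k : nat) := if k < 6 then nth 0 nor_table (m * 36 + l * 6 + k) else 0.

Definition nor_mode g i :=
  if g < q then 0 else if i < g then (if wire g i then 2 else 1) else 3.

Definition nor_op n :=
  let t := n %/ nor_W in let k := n %% nor_W in
  let i := (t %/ 6) %% N in let g := t %/ (6 * N) in
  cell_op (nor_mode g i) (t %% 6) (k - 5 * i).

Definition nor_ini n :=
  if n == 0 then 1 else if (n %% 5 == 1) && (n %/ 5 < q) then 2 else 0.

Definition nor_G := nor_W * (6 * N * N).

Hypotheses (N1 : 2 <= N) (qN : q < N).

Lemma nor_table_le k : nth 0 nor_table k <= 10.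
Proof.
case: (ltnP k (size nor_table)) => h; last by rewrite nth_default.
have /allP : all (fun x => x <= 10) nor_table by [].
by apply; apply: mem_nth.
Qed.

Lemma cell_op_le m l k : cell_op m l k <= 10.
Proof. by rewrite /cell_op; case: ifP => // _; exact: nor_table_le. Qed.

(** Truncated subtraction sends all slots to the left of [5 * i] to column 0 of the table, which
    must therefore be idle. *)
Lemma cell_op0 m l : m < 4 -> l < 6 -> cell_op m l 0 = 0.
Proof. by case: m => [|[|[|[|]]]] //; case: l => [|[|[|[|[|[|]]]]]]. Qed.

(** The table is arranged so that copies from the right satisfy the planarity condition
    [op_left]. *)
Lemma cell_op_left m l k : m < 4 -> l < 6 -> cell_op m l k = 2 -> k = 1 /\ cell_op m l 2 = 0.
Proof.
by case: m => [|[|[|[|]]]] //; case: l => [|[|[|[|[|[|]]]]]] //;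
  case: k => [|[|[|[|[|[|k]]]]]].
Qed.

Lemma nor_mode_lt g i : nor_mode g i < 4.
Proof. by rewrite /nor_mode; do 3?case: ifP. Qed.

Lemma nor_op_row t k : k < nor_W ->
  nor_op (t * nor_W + k) =
  cell_op (nor_mode (t %/ (6 * N)) ((t %/ 6) %% N)) (t %% 6) (k - 5 * ((t %/ 6) %% N)).
Proof.
move=> kW; have W0 : 0 < nor_W by apply: leq_ltn_trans kW.
by rewrite /nor_op divnMDl // (divn_small kW) addn0 modnMDl (modn_small kW).
Qed.

Lemma nor_op0 : nor_op 0 = 0.
Proof.
have W0 : 0 < nor_W by rewrite /nor_W; lia.
by have := @nor_op_row 0 0 W0; rewrite mul0n addn0 => ->; rewrite sub0n cell_op0 ?nor_mode_lt.
Qed.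

Lemma nor_op_le n : nor_op n <= 10.
Proof. exact: cell_op_le. Qed.

Lemma nor_op_left n : nor_op n = 2 -> nor_op n.+1 = 0.
Proof.
have W0 : 0 < nor_W by rewrite /nor_W; lia.
rewrite {1}(divn_eq n nor_W) nor_op_row ?ltn_mod //.
set t := n %/ nor_W; set k := n %% nor_W; set i := (t %/ 6) %% N.
have iN : i < N by rewrite ltn_mod; lia.
move=> /cell_op_left; rewrite nor_mode_lt ltn_mod => /(_ isT isT) [kE o2].
(* The gate after the last slot of a row belongs to slot 0 of the next row, which is idle. *)
case: (ltnP k.+1 nor_W) => kW.
  have -> : n.+1 = t * nor_W + k.+1 by rewrite {1}(divn_eq n nor_W) addnS.
  by rewrite nor_op_row // -/i; have -> : k.+1 - 5 * i = 2 by lia.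
have kW' : k < nor_W by rewrite ltn_mod.
have -> : n.+1 = t.+1 * nor_W + 0 by rewrite {1}(divn_eq n nor_W) -/t -/k; lia.
by rewrite nor_op_row // sub0n cell_op0 ?nor_mode_lt // ltn_mod.
Qed.

Definition row f t k := gval nor_W nor_op nor_ini f (t * nor_W + k).

Definition layer (op : nat -> nat) (a : nat -> bool) : nat -> bool :=
  fun k => gatev (op k) (a (k - 1)) (a k) (a k.+1).

Let W2 : 1 < nor_W. Proof. by rewrite /nor_W; lia. Qed.
Let G0 : 0 < nor_G. Proof. by rewrite /nor_G !muln_gt0 /= ltnW //; lia. Qed.

Lemma row_step f t k : k < nor_W ->
  row f t.+1 k = layer (fun k => cell_op (nor_mode (t %/ (6 * N)) ((t %/ 6) %% N)) (t %% 6)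
     (k - 5 * ((t %/ 6) %% N))) (row f t) k.
Proof.
move=> kW; rewrite /row /layer mulSn -addnA addnC (gval_gate _ W2 G0 nor_op0).
rewrite nor_op_row // -addnS; case: k kW => [|k] kW.
  by rewrite sub0n cell_op0 ?nor_mode_lt ?ltn_mod.
by congr gatev; congr gval; lia.
Qed.

Section SixLayers.
Variables (m i : nat) (r : nat -> nat -> bool).
Hypotheses (m4 : m < 4) (iW : 5 * i + 1 < nor_W).
Hypothesis rS : forall l k, l < 6 -> k < nor_W ->
  r l.+1 k = layer (fun k => cell_op m l (k - 5 * i)) (r l) k.

Lemma layers_keep k : k < nor_W ->
  k <= 5 * i \/ 5 * i + 5 < k \/ (m = 3 /\ k != 5 * i + 1) \/ m = 0 -> r 6 k = r 0 k.
Proof.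
move=> kW H; have : forall l, l <= 6 -> r l k = r 0 k; last by apply.
elim=> [//|l IH] l6; rewrite rS // -(IH (ltnW l6)).
suff c0 : cell_op m l (k - 5 * i) = 0 by rewrite /layer c0.
case: H => [h|[h|[[-> h]|->]]].
- by have -> : k - 5 * i = 0 by [lia]; rewrite cell_op0.
- by rewrite /cell_op ifN //; lia.
- have : k - 5 * i != 1 by lia.
  by case: (k - 5 * i) => [|[|[|[|[|[|j]]]]]] //= _; case: l l6 {IH} => [|[|[|[|[|[|]]]]]].
- by case: (k - 5 * i) => [|[|[|[|[|[|j]]]]]] //=; case: l l6 {IH} => [|[|[|[|[|[|]]]]]].
Qed.

Let R l j := r l (5 * i + j).

Let RS l j : l < 6 -> 5 * i + j.+1 < nor_W ->
  R l.+1 j.+1 = gatev (cell_op m l j.+1) (R l j) (R l j.+1) (R l j.+2).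
Proof.
by move=> l6 jW; rewrite /R rS // /layer addKn; congr gatev; congr r; lia.
Qed.

Let R0 l : l <= 6 -> R l 0 = R 0 0.
Proof.
elim: l => [//|l IH] l6; rewrite -(IH (ltnW l6)) /R addn0 rS //; last lia.
by rewrite /layer subnn cell_op0.
Qed.

Lemma layers_write : m = 3 -> r 6 (5 * i + 1) = r 0 (5 * i).
Proof.
move=> m3; rewrite -[LHS]/(R 6 1) -[5 * i in RHS]addn0 -/(R 0 0).
by do 5![rewrite RS // m3 [gatev _ _ _ _]/=]; rewrite RS // m3.
Qed.

(** Write [a] for the accumulator and [b] for the register. Slots 1 to 4 of [R 3] hold [a && ~~ b],
    the exclusive or, [b && ~~ a] and [b]. Those of [R 4] hold [a && b], [b && ~~ a], [a && ~~ b]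
    and [a && b]; the first two join to [b], the last two to [a]. In mode 2 only the third is kept
    for the accumulator. *)
Lemma layers_cross : m = 1 \/ m = 2 -> 5 * i + 5 < nor_W ->
  r 6 (5 * i + 1) = r 0 (5 * i + 1) /\
  r 6 (5 * i + 5) = (if m == 1 then r 0 (5 * i) else r 0 (5 * i) && ~~ r 0 (5 * i + 1)).
Proof.
move=> m12 W5; have -> : r 0 (5 * i) = R 0 0 by rewrite /R addn0.
rewrite -/(R 0 1) -/(R 6 1) -/(R 6 5).
have S l j : l < 6 -> j < 5 ->
    R l.+1 j.+1 = gatev (cell_op m l j.+1) (R l j) (R l j.+1) (R l j.+2).
  by move=> l6 j5; apply: RS => //; lia.
have r11 : R 1 1 = ~~ (R 0 0 && R 0 1).
  by rewrite S //; case: m12 => ->; rewrite /gatev /cell_op /g_o /g_al /g_be /=; case: (R 0 0); case: (R 0 1).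
have r12 : R 1 2 = R 0 1 by rewrite S //; case: m12 => ->.
have r21 : R 2 1 = R 0 0 && R 1 1.
  by rewrite S // (R0 (l := 1)) //; case: m12 => ->; rewrite /gatev /cell_op /g_o /g_al /g_be /=; case: (R 0 0); case: (R 1 1).
have r22 : R 2 2 = R 1 1 && R 1 2.
  by rewrite S //; case: m12 => ->; rewrite /gatev /cell_op /g_o /g_al /g_be /=; case: (R 1 1); case: (R 1 2).
have r23 : R 2 3 = R 1 2 by rewrite S //; case: m12 => ->.
have r31 : R 3 1 = R 2 1 by rewrite S //; case: m12 => ->.
have r32 : R 3 2 = R 2 1 || R 2 2.
  by rewrite S //; case: m12 => ->; rewrite /gatev /cell_op /g_o /g_al /g_be /=; case: (R 2 1); case: (R 2 2).
have r33 : R 3 3 = R 2 2 by rewrite S //; case: m12 => ->.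
have r34 : R 3 4 = R 2 3 by rewrite S //; case: m12 => ->.
have r41 : R 4 1 = R 0 0 && ~~ R 3 1.
  by rewrite S // (R0 (l := 3)) //; case: m12 => ->; rewrite /gatev /cell_op /g_o /g_al /g_be /=; case: (R 0 0); case: (R 3 1).
have r42 : R 4 2 = ~~ R 3 1 && R 3 2.
  by rewrite S //; case: m12 => ->; rewrite /gatev /cell_op /g_o /g_al /g_be /=; case: (R 3 1); case: (R 3 2).
have r43 : R 4 3 = R 3 2 && ~~ R 3 3.
  by rewrite S //; case: m12 => ->; rewrite /gatev /cell_op /g_o /g_al /g_be /=; case: (R 3 2); case: (R 3 3).
have r44 : R 4 4 = ~~ R 3 3 && R 3 4.
  by rewrite S //; case: m12 => ->; rewrite /gatev /cell_op /g_o /g_al /g_be /=; case: (R 3 3); case: (R 3 4).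
have r52 : R 5 2 = R 4 1 || R 4 2.
  by rewrite S //; case: m12 => ->; rewrite /gatev /cell_op /g_o /g_al /g_be /=; case: (R 4 1); case: (R 4 2).
have r54 : R 5 4 = if m == 1 then R 4 3 || R 4 4 else R 4 3.
  by rewrite S //; case: m12 => ->; rewrite /gatev /cell_op /g_o /g_al /g_be /=; case: (R 4 3); case: (R 4 4).
have r61 : R 6 1 = R 5 2 by rewrite S //; case: m12 => ->.
have r65 : R 6 5 = R 5 4 by rewrite S //; case: m12 => ->.
rewrite r61 r65 r52 r54 r41 r42 r43 r44 r31 r32 r33 r34 r21 r22 r23 r11 r12.
by case: (m == 1); case: (R 0 0); case: (R 0 1).
Qed.

End SixLayers.

Section Sweep.
Variable f : nat -> bool.
Let y i := f (5 * i + 1).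

(** During sweep [g], after [i] registers: inputs, earlier gates and, once written, gate [g] are in
    their registers. The accumulator is described only up to the point where it is written, hence
    [i <= g]. *)
Definition sweep_inv g i := let t := 6 * (g * N + i) in
  [/\ row f t 0,
      forall r, r < N -> [|| r < q, r < g | (r == g) && (g < i)] -> row f t (5 * r + 1) = nor y r &
      q <= g -> i <= g -> row f t (5 * i) = ~~ has (fun r => wire g r && nor y r) (iota 0 i)].

Lemma sweep_init : sweep_inv 0 0.
Proof.
have gi n : n < nor_W -> row f 0 n = if nor_ini n == 2 then f n else nor_ini n == 1.
  by move=> nW; rewrite /row mul0n add0n gval_init.
split; rewrite mul0n addn0 muln0.
- by rewrite gi //; lia.
- move=> r rN; rewrite ltn0 ltnn andbF !orbF => rq.
  rewrite gi; last by rewrite /nor_W; lia.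
  have d5 : (5 * r + 1) %% 5 = 1 by rewrite mulnC modnMDl.
  have q5 : (5 * r + 1) %/ 5 = r by rewrite mulnC divnMDl // addn0.
  have z5 : (5 * r + 1 == 0) = false by lia.
  by rewrite /nor_ini z5 d5 q5 rq nor_input.
- by move=> _ _; rewrite gi //; lia.
Qed.

Lemma sweep_step g i : g < N -> i < N -> sweep_inv g i -> sweep_inv g i.+1.
Proof.
move=> gN iN [I0 IR IA].
pose t := 6 * (g * N + i); pose r l := row f (t + l).
have dec l : l < 6 -> [/\ (t + l) %/ (6 * N) = g, ((t + l) %/ 6) %% N = i & (t + l) %% 6 = l].
  move=> l6; have q6 : (t + l) %/ 6 = g * N + i.
    by rewrite /t mulnC divnMDl // divn_small // addn0.
  rewrite divnMA q6 divnMDl; last lia.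
  by rewrite divn_small // addn0 modnMDl modn_small // /t mulnC modnMDl modn_small.
have iW : 5 * i + 1 < nor_W by rewrite /nor_W; lia.
have rS l k : l < 6 -> k < nor_W ->
    r l.+1 k = layer (fun k => cell_op (nor_mode g i) l (k - 5 * i)) (r l) k.
  by move=> l6 kW; rewrite /r addnS row_step //; have [-> -> ->] := dec l l6.
have m4 := nor_mode_lt g i.
have tE : 6 * (g * N + i.+1) = t + 6 by rewrite /t; lia.
have r0 : r 0 = row f t by rewrite /r addn0.
have r6 : r 6 = row f (t + 6) by [].
have keep := layers_keep m4 iW rS; rewrite r0 r6 in keep.
rewrite -/t in I0 IR IA.
have W0 : 0 < nor_W by lia.
rewrite /sweep_inv tE; split.
- by rewrite keep //; left.
- move=> j jN jH; have jW : 5 * j + 1 < nor_W by rewrite /nor_W; lia.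
  case: (ltnP g q) => gq.
    rewrite keep //; last by right; right; right; rewrite /nor_mode gq.
    have jq : j < q by lia.
    by apply: IR => //; rewrite jq.
  case: (ltnP i g) => ig.
    have mE : nor_mode g i = 1 \/ nor_mode g i = 2.
      by rewrite /nor_mode ltnNge gq ig /=; case: ifP; [right|left].
    have [|c1 _] := layers_cross m4 iW rS mE; first by rewrite /nor_W; lia.
    have {}jH : [|| j < q, j < g | (j == g) && (g < i)] by lia.
    case: (eqVneq j i) => [-> |ji]; last by rewrite keep ?IR //; lia.
    by rewrite -r6 c1 r0 IR // ig orbT.
  (* For [i > g] the write mode also alters register [i], about which the invariant says nothing
     yet; the sweep of that register will set it. *)
  have mE : nor_mode g i = 3 by rewrite /nor_mode ltnNge gq /= ltnNge ig.
  case: (eqVneq j i) => [ji|ji]; last first.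
    rewrite keep ?IR //; first by lia.
    by right; right; left; split=> //; lia.
  have jg : j = g by lia.
  have ig' : i = g by lia.
  have ig2 : i <= g by rewrite ig'.
  by rewrite ji -r6 (layers_write m4 iW rS mE) r0 (IA gq ig2) ig' [RHS]nor_gate.
- move=> gq ig.
  have mE : nor_mode g i = 1 \/ nor_mode g i = 2.
    by rewrite /nor_mode ltnNge gq ig /=; case: ifP; [right|left].
  have [|_ c2] := layers_cross m4 iW rS mE; first by rewrite /nor_W; lia.
  have -> : 5 * i.+1 = 5 * i + 5 by lia.
  rewrite -r6 c2 r0 IA ?(ltnW ig) // IR //; last by rewrite ig orbT.
  rewrite -[i.+1]addn1 iotaD has_cat /= orbF negb_or.
  by rewrite /nor_mode ltnNge gq ig /=; case: (wire g i); rewrite /= ?andbT.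
Qed.

(** The width [5 * N - 3] makes the last slot of a row that of register [N - 1], so the output
    variable is the last variable of all. *)
Lemma nor_output : gval nor_W nor_op nor_ini f (gnv nor_W nor_G).-1 = nor y N.-1.
Proof.
have S g i : g < N -> sweep_inv g 0 -> i <= N -> sweep_inv g i.
  by move=> gN H; elim: i => [//|i IH] iN; apply: sweep_step => //; apply: IH; apply: ltnW.
have T : forall g, g <= N -> sweep_inv g 0.
  elim=> [|g IH] gN; first exact: sweep_init.
  have [I0 IR IA] := S g N gN (IH (ltnW gN)) (leqnn _).
  have tE : 6 * (g.+1 * N + 0) = 6 * (g * N + N) by lia.
  rewrite /sweep_inv tE; split=> //.
  by move=> j jN jH; apply: IR => //; lia.
have [_ IR _] := T N (leqnn _).
have := IR N.-1; rewrite addn0 => <-; try lia.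
rewrite /row /gnv /nor_G; congr gval; rewrite /nor_W; nia.
Qed.

End Sweep.

Definition nor_instance := gate_instance nor_W nor_G nor_op nor_ini.

Lemma nor_instance_linked R : linked_planar_3SAT R nor_instance.
Proof.
apply: gate_instance_linked => //; [exact: nor_op0|exact: nor_op_left|exact: nor_op_le].
Qed.

Lemma gval_ext f f' : (forall n, n < nor_W -> nor_ini n = 2 -> f n = f' n) ->
  forall n, gval nor_W nor_op nor_ini f n = gval nor_W nor_op nor_ini f' n.
Proof.
move=> E; elim/ltn_ind => n IH; case: (ltnP n nor_W) => nW.
  by rewrite !gval_init //; case: eqP => // e2; apply: E.
rewrite -(subnK nW) !(gval_gate _ W2 G0 nor_op0).
by congr gatev; apply: IH; lia.
Qed.

Lemma nor_ini_le n : nor_ini n <= 2.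
Proof. by rewrite /nor_ini; do 2?case: ifP. Qed.

(** The bijection completes an input word, placed in the free slots, by the forced values. *)
Lemma nb_satisfying_nor : nb_satisfying (formula nor_instance) =
  #|[set w : q.-tuple bool | nor (nth false w) N.-1]%SET|.
Proof.
pose n := gnv nor_W nor_G.
have n0 : 0 < n by rewrite /n /gnv; lia.
(* Register [i] sits in slot [5 * i + 1], so dividing by 5 recovers [i]. *)
pose fw (w : q.-tuple bool) k := nth false w (k %/ 5).
pose F (w : q.-tuple bool) : {ffun 'I_n -> bool} := [ffun k : 'I_n => gval nor_W nor_op nor_ini (fw w) k].
have fwi (w : q.-tuple bool) i : fw w (5 * i + 1) = nth false w i.
  by rewrite /fw mulnC divnMDl // addn0.
have slot_lt i : i < q -> 5 * i + 1 < nor_W by rewrite /nor_W; lia.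
have gfree f i : i < q -> gval nor_W nor_op nor_ini f (5 * i + 1) = f (5 * i + 1).
  move=> iq; rewrite gval_init ?slot_lt //.
  have d5 : (5 * i + 1) %% 5 = 1 by rewrite mulnC modnMDl.
  have q5 : (5 * i + 1) %/ 5 = i by rewrite mulnC divnMDl // addn0.
  by rewrite /nor_ini d5 q5 iq addn1.
have Finj : injective F.
  move=> w w' /ffunP E; apply: val_inj; apply: (@eq_from_nth _ false); rewrite ?size_tuple // => i iq.
  have ln : 5 * i + 1 < n by rewrite /n /gnv (leq_trans (slot_lt _ iq)) // leq_addr.
  by have := E (Ordinal ln); rewrite !ffunE /= !gfree // !fwi.
have norE f w : (forall i, i < q -> f (5 * i + 1) = nth false w i) ->
    nor (fun i => f (5 * i + 1)) N.-1 = nor (nth false w) N.-1.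
  move=> E; elim/ltn_ind: N.-1 => g IH; case: (ltnP g q) => gq.
    by rewrite !nor_input // E.
  rewrite !nor_gate //; congr (~~ _); apply: eq_in_has => i; rewrite mem_iota add0n /= => ig.
  by rewrite IH.
have satP (a : {ffun 'I_n -> bool}) (a' : nat -> bool) : (forall i : 'I_n, a i = a' i) ->
    @satisfies (formula nor_instance) a <->
    (forall k, k < n -> a' k = gval nor_W nor_op nor_ini a' k) /\
    gval nor_W nor_op nor_ini a' n.-1.
  move=> aa; rewrite (@satisfies_matrix n (gnc nor_W nor_G) _ a a' aa).
  by apply: gval_sat => //; [exact: nor_op0|exact: nor_op_le|exact: nor_ini_le].
rewrite -(card_imset _ Finj); apply: eq_card => a; rewrite inE.
pose a' k := if insub k is Some j then a (j : 'I_n) else false.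
have aa (i : 'I_n) : a i = a' i by rewrite /a' valK.
apply/idP/imsetP.
- move=> /(satP a a' aa) [E H].
  pose w : q.-tuple bool := [tuple a' (5 * i + 1) | i < q].
  have wi i : i < q -> a' (5 * i + 1) = nth false w i.
    by move=> iq; rewrite -[i]/(val (Ordinal iq)) -tnth_nth tnth_mktuple.
  have ext k : gval nor_W nor_op nor_ini a' k = gval nor_W nor_op nor_ini (fw w) k.
    apply: gval_ext => j jW; rewrite /nor_ini; case: eqP => // _; case: andP => // -[/eqP j1 jq] _.
    have -> : j = 5 * (j %/ 5) + 1 by have := divn_eq j 5; lia.
    by rewrite fwi wi.
  exists w; first by rewrite inE -(norE a') // -nor_output.
  by apply/ffunP => k; rewrite ffunE aa E // ext.
- move=> [w]; rewrite inE => acc aE; apply/(satP a (gval nor_W nor_op nor_ini (fw w))).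
    by move=> k; rewrite aE ffunE.
  (* Completion is idempotent, because completed values agree with the given ones in the free
     slots. *)
  have ext k : gval nor_W nor_op nor_ini (gval nor_W nor_op nor_ini (fw w)) k =
      gval nor_W nor_op nor_ini (fw w) k.
    apply: gval_ext => j jW; rewrite /nor_ini; case: eqP => // _; case: andP => // -[/eqP j1 jq] _.
    have -> : j = 5 * (j %/ 5) + 1 by have := divn_eq j 5; lia.
    by rewrite gfree.
  split=> [k kn|]; first by rewrite ext.
  by rewrite ext nor_output (norE _ w) // => i iq; rewrite fwi.
Qed.

End NorCircuit.

(** * Cellular automata as NOR circuits *)

Section CA.
(** Cells [0 .. 2T] with states below [m]; the next state of cell [p] is a function [Ft] of the
    (coded) states of the cells [T], [p - 1], [p] and [p + 1].  The cells from [off] on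
    receive the [q] input bits; [v0] and [v1] give the initial states. *)
Variables (q T off m : nat) (v0 v1 Ft : nat -> nat) (good : nat -> bool).

Definition ca_P := 2 * T + 1.
Definition ca_Z := m * (m * (m * m)).
(** All layers have the width required by neighbourhood codes, although states use only the codes
    below [m]: layer, cell and code are then digits of the gate number. The last gate is the
    output. *)
Definition ca_N := q + (2 * T + 2) * ca_P * ca_Z + 1.

Definition ca_z g := (g - q) %% ca_Z.
Definition ca_p g := ((g - q) %/ ca_Z) %% ca_P.
Definition ca_l g := ((g - q) %/ ca_Z) %/ ca_P.

Definition dig0 z := z %% m.
Definition dig1 z := (z %/ m) %% m.
Definition dig2 z := (z %/ m %/ m) %% m.
Definition dig3 z := z %/ m %/ m %/ m.

Definition ca_next p := if p < 2 * T then p.+1 else p.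

(** Layer 0 holds the negated inputs, layer [2 t + 1] the states at time [t] and layer
    [2 t + 2] the neighbourhoods at time [t], all in one-hot encoding: a one-hot bit is the
    NOR of the bits excluded by it. *)
Definition ca_wire g i : bool :=
  if g == ca_N - 1 then
    [&& q <= i, ca_l i == 2 * T + 1, ca_p i == T, ca_z i < m & ~~ good (ca_z i)]
  else if ca_l g == 0 then (i < q) && (off + i == ca_p g)
  else if ca_l g == 1 then
    if i < q then (off + i == ca_p g) && (ca_z g != v1 (ca_p g))
    else [&& ca_l i == 0, ca_p i == ca_p g, ca_z i == 0 & ca_z g != v0 (ca_p g)]
  else if ca_l g %% 2 == 1 then
    [&& q <= i, ca_l i + 1 == ca_l g, ca_p i == ca_p g & Ft (ca_z i) != ca_z g]
  else [&& q <= i, ca_l i + 1 == ca_l g, ca_z i < m &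
    [|| (ca_p i == T) && (ca_z i != dig0 (ca_z g)),
        (ca_p i == ca_p g - 1) && (ca_z i != dig1 (ca_z g)),
        (ca_p i == ca_p g) && (ca_z i != dig2 (ca_z g)) |
        (ca_p i == ca_next (ca_p g)) && (ca_z i != dig3 (ca_z g))]].

Hypotheses (m0 : 0 < m) (v0m : forall p, v0 p < m) (v1m : forall p, v1 p < m)
  (Ftm : forall z, Ft z < m).

Definition ca_code a b c d := a + m * (b + m * (c + m * d)).

Variable y : nat -> bool.

Fixpoint cv t p :=
  if t is t'.+1 then Ft (ca_code (cv t' T) (cv t' (p - 1)) (cv t' p) (cv t' (ca_next p)))
  else if [&& off <= p, p - off < q & y (p - off)] then v1 p else v0 p.

Let nory := nor q ca_wire y.

Definition ridx l p z := q + (l * ca_P + p) * ca_Z + z.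

Let P0 : 0 < ca_P. Proof. by rewrite /ca_P; lia. Qed.
Let Z0 : 0 < ca_Z. Proof. by rewrite /ca_Z !muln_gt0 m0. Qed.

Lemma ridxK l p z : p < ca_P -> z < ca_Z ->
  [/\ ca_l (ridx l p z) = l, ca_p (ridx l p z) = p & ca_z (ridx l p z) = z].
Proof.
move=> pP zZ; rewrite /ca_l /ca_p /ca_z /ridx -addnA addKn.
rewrite modnMDl (modn_small zZ) divnMDl // (divn_small zZ) addn0.
by rewrite divnMDl // (divn_small pP) addn0 modnMDl (modn_small pP).
Qed.

Lemma ridx_dec g : q <= g -> g = ridx (ca_l g) (ca_p g) (ca_z g).
Proof.
move=> qg; rewrite /ridx /ca_l /ca_p /ca_z -divn_eq -addnA -divn_eq; lia.
Qed.

Let pP g : ca_p g < ca_P. Proof. by rewrite ltn_mod. Qed.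
Let zZ g : ca_z g < ca_Z. Proof. by rewrite ltn_mod. Qed.

Lemma ridx_lt l p z p' z' : p < ca_P -> z < ca_Z -> ridx l p z < ridx l.+1 p' z'.
Proof.
move=> pP' zZ'.
suff h : (l * ca_P + p) * ca_Z + z < (l.+1 * ca_P + p') * ca_Z + z' by rewrite /ridx; lia.
apply: (@leq_trans ((l * ca_P + p).+1 * ca_Z)); first by rewrite mulSn addnC ltn_add2r.
apply: (@leq_trans ((l.+1 * ca_P + p') * ca_Z)); last exact: leq_addr.
rewrite leq_mul2r; apply/orP; right; apply: (@leq_trans (l * ca_P + ca_P)).
  by rewrite -addnS leq_add2l.
by rewrite mulSn [ca_P + _]addnC leq_addr.
Qed.

Lemma ridx_N l p z : l < 2 * T + 2 -> p < ca_P -> z < ca_Z -> ridx l p z < ca_N - 1.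
Proof.
move=> lT pP' zZ'; have := @ridx_lt l p z 0 0 pP' zZ'.
have : ridx l.+1 0 0 <= ca_N - 1; last lia.
rewrite /ridx /ca_N !addn0 addnK leq_add2l !leq_mul2r; apply/orP; right; apply/orP; right; lia.
Qed.

Lemma cv_lt t p : cv t p < m.
Proof. by case: t => [|t] /=; [case: ifP|]. Qed.

Let mZ : m <= ca_Z.
Proof. by rewrite /ca_Z leq_pmulr // !muln_gt0 m0. Qed.

Let cvZ t p : cv t p < ca_Z. Proof. exact: leq_trans (cv_lt t p) mZ. Qed.

Lemma code_dig a b c d : a < m -> b < m -> c < m -> d < m ->
  [/\ dig0 (ca_code a b c d) = a, dig1 (ca_code a b c d) = b, dig2 (ca_code a b c d) = c &
      dig3 (ca_code a b c d) = d].
Proof.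
move=> am bm cm dm.
have E1 u w : u < m -> (u + m * w) %% m = u /\ (u + m * w) %/ m = w.
  by move=> um; rewrite addnC mulnC modnMDl modn_small // divnMDl // divn_small // addn0.
rewrite /dig0 /dig1 /dig2 /dig3 /ca_code.
have [-> ->] := E1 a (b + m * (c + m * d)) am.
have [-> ->] := E1 b (c + m * d) bm.
by have [-> ->] := E1 c d cm.
Qed.

Let dig_code z : ca_code (dig0 z) (dig1 z) (dig2 z) (dig3 z) = z.
Proof.
have E u : u %% m + m * (u %/ m) = u by rewrite mulnC addnC -divn_eq.
by rewrite /ca_code /dig0 /dig1 /dig2 /dig3 !E.
Qed.

Let code_lt a b c d : a < m -> b < m -> c < m -> d < m -> ca_code a b c d < ca_Z.
Proof.
have E u w k : u < m -> w < k -> u + m * w < m * k.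
  by move=> um wk; apply: (@leq_trans (m * w.+1)); rewrite ?leq_mul2l ?wk ?orbT // mulnS ltn_add2r.
by move=> am bm cm dm; rewrite /ca_code /ca_Z; do 3!apply: (E _ _ _) => //.
Qed.

Let nor_at l p z : l < 2 * T + 2 -> p < ca_P -> z < ca_Z ->
  nory (ridx l p z) = ~~ has (fun i => ca_wire (ridx l p z) i && nory i) (iota 0 (ridx l p z)).
Proof. by move=> *; rewrite /nory nor_gate // /ridx -addnA leq_addr. Qed.

Let notlast l p z : l < 2 * T + 2 -> p < ca_P -> z < ca_Z -> (ridx l p z == ca_N - 1) = false.
Proof. by move=> *; rewrite ltn_eqF // ridx_N. Qed.

Let layer0 p : p < ca_P ->
  nory (ridx 0 p 0) = ~~ [&& off <= p, p - off < q & y (p - off)].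
Proof.
move=> pP'; rewrite nor_at //; try lia; congr (~~ _).
have [El Ep Ez] := ridxK 0 pP' Z0.
apply/hasP/and3P => [[i _]|[op pq yp]].
  rewrite /ca_wire notlast //; last lia.
  rewrite El Ep eqxx => /andP[/andP[iq /eqP oi]].
  by rewrite /nory nor_input // -oi addKn leq_addr.
exists (p - off); first by rewrite mem_iota add0n /= /ridx; lia.
rewrite /ca_wire notlast //; last lia.
by rewrite El Ep eqxx pq subnKC // eqxx /nory nor_input.
Qed.

(** A true input bit rules out the codes other than [v1 p]; its negation in layer 0, which is true
    also at cells without input, rules out those other than [v0 p]. *)
Let state0 p a : p < ca_P -> a < m -> nory (ridx 1 p a) = (a == cv 0 p).
Proof.
move=> pP' am; have aZ := leq_trans am mZ.
have [El Ep Ez] := ridxK 1 pP' aZ.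
rewrite nor_at //; try lia; apply/idP/idP; last first.
  move=> /eqP aE; apply/hasPn => i _; apply/negP.
  rewrite /ca_wire notlast //; last lia.
  rewrite El Ep Ez /= aE; case: ifP => iq.
    move=> /andP[/andP[/eqP oi]]; rewrite /nory nor_input // => ne yi.
    by move: ne; rewrite -oi /= leq_addr addKn iq yi eqxx.
  move=> /andP[/and4P[/eqP l0 /eqP pE /eqP z0 ne]].
  have qi : q <= i by lia.
  rewrite (ridx_dec qi) l0 pE z0 layer0 // => h.
  by move: ne; rewrite /= (negbTE h) eqxx.
apply: contraR => ne; apply/hasP.
case: (boolP [&& off <= p, p - off < q & y (p - off)]) => h.
  have /and3P[op pq yp] := h.
  exists (p - off); first by rewrite mem_iota add0n /= /ridx; lia.
  rewrite /ca_wire notlast //; last lia.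
  rewrite El Ep Ez /= pq subnKC // eqxx /nory nor_input // yp andbT.
  by move: ne; rewrite /= h.
exists (ridx 0 p 0); first by rewrite mem_iota add0n ridx_lt.
have [El0 Ep0 Ez0] := ridxK 0 pP' Z0.
rewrite /ca_wire notlast //; last lia.
rewrite El Ep Ez El0 Ep0 Ez0 /= ifN; last by rewrite -leqNgt /ridx; lia.
by rewrite !eqxx layer0 // h andbT; move: ne; rewrite /= (negbTE h).
Qed.

Let nextP p : p < ca_P -> ca_next p < ca_P.
Proof. by rewrite /ca_next /ca_P; case: ifP; lia. Qed.

Let TP : T < ca_P. Proof. by rewrite /ca_P; lia. Qed.

Definition nbcode t p := ca_code (cv t T) (cv t (p - 1)) (cv t p) (cv t (ca_next p)).

Let nbcode_lt t p : nbcode t p < ca_Z.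
Proof. by apply: code_lt; exact: cv_lt. Qed.

Let nbhd t p u : t < T -> p < ca_P -> u < ca_Z ->
  (forall p a, p < ca_P -> a < m -> nory (ridx (2 * t + 1) p a) = (a == cv t p)) ->
  nory (ridx (2 * t + 2) p u) = (u == nbcode t p).
Proof.
move=> tT pP' uZ IH; have [El Ep Ez] := ridxK (2 * t + 2) pP' uZ.
have W i : ca_wire (ridx (2 * t + 2) p u) i =
  [&& q <= i, ca_l i == 2 * t + 1, ca_z i < m &
    [|| (ca_p i == T) && (ca_z i != dig0 u),
        (ca_p i == p - 1) && (ca_z i != dig1 u),
        (ca_p i == p) && (ca_z i != dig2 u) |
        (ca_p i == ca_next p) && (ca_z i != dig3 u)]].
  rewrite /ca_wire notlast //; last lia.
  rewrite El Ep Ez.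
  have -> : (2 * t + 2 == 0) = false by lia.
  have -> : (2 * t + 2 == 1) = false by lia.
  have -> : ((2 * t + 2) %% 2 == 1) = false by lia.
  by have -> : (ca_l i + 1 == 2 * t + 2) = (ca_l i == 2 * t + 1) by lia.
have [c0 c1 c2 c3] := code_dig (cv_lt t T) (cv_lt t (p - 1)) (cv_lt t p) (cv_lt t (ca_next p)).
rewrite nor_at //; try lia; apply/idP/idP; last first.
  move=> /eqP uE; apply/hasPn => i _; apply/negP; rewrite W => /andP[/and4P[qi /eqP li zi H]].
  rewrite (ridx_dec qi) li IH // => /eqP zE; move: H.
  rewrite uE c0 c1 c2 c3 zE.
  by move=> /or4P[] /andP[/eqP ->]; rewrite eqxx.
apply: contraR => ne; apply/hasP.
(* A code with a wrong digit is ruled out by the true state bit of the cell that this digit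
   describes. *)
have K p' : p' < ca_P ->
    [|| (p' == T) && (cv t p' != dig0 u), (p' == p - 1) && (cv t p' != dig1 u),
        (p' == p) && (cv t p' != dig2 u) | (p' == ca_next p) && (cv t p' != dig3 u)] ->
    exists2 i, i \in iota 0 (ridx (2 * t + 2) p u) & ca_wire (ridx (2 * t + 2) p u) i && nory i.
  move=> p'P H; exists (ridx (2 * t + 1) p' (cv t p')).
    by rewrite mem_iota add0n /= [2 * t + 2]addnS ridx_lt.
  have [El' Ep' Ez'] := ridxK (2 * t + 1) p'P (cvZ t p').
  rewrite W El' Ep' Ez' H IH ?cv_lt // !eqxx !andbT.
  by rewrite /ridx -addnA leq_addr.
case: (eqVneq (cv t T) (dig0 u)) => [e0|n0]; last by apply: (K T) => //; rewrite eqxx n0.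
case: (eqVneq (cv t (p - 1)) (dig1 u)) => [e1|n1]; last by apply: (K (p - 1)); rewrite ?eqxx ?n1 ?orbT //; lia.
case: (eqVneq (cv t p) (dig2 u)) => [e2|n2]; last by apply: (K p) => //; rewrite eqxx n2 !orbT.
case: (eqVneq (cv t (ca_next p)) (dig3 u)) => [e3|n3]; last by apply: (K (ca_next p)); rewrite ?nextP // eqxx n3 !orbT.
by move: ne; rewrite /nbcode e0 e1 e2 e3 dig_code eqxx.
Qed.

Let stateS t p a : t < T -> p < ca_P -> a < m ->
  (forall p u, p < ca_P -> u < ca_Z -> nory (ridx (2 * t + 2) p u) = (u == nbcode t p)) ->
  nory (ridx (2 * t.+1 + 1) p a) = (a == cv t.+1 p).
Proof.
move=> tT pP' am IH; have aZ := leq_trans am mZ.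
have [El Ep Ez] := ridxK (2 * t.+1 + 1) pP' aZ.
have W i : ca_wire (ridx (2 * t.+1 + 1) p a) i =
    [&& q <= i, ca_l i == 2 * t + 2, ca_p i == p & Ft (ca_z i) != a].
  rewrite /ca_wire notlast //; last lia.
  rewrite El Ep Ez.
  have -> : (2 * t.+1 + 1 == 0) = false by lia.
  have -> : (2 * t.+1 + 1 == 1) = false by lia.
  have -> : (2 * t.+1 + 1) %% 2 == 1 by lia.
  by have -> : (ca_l i + 1 == 2 * t.+1 + 1) = (ca_l i == 2 * t + 2) by lia.
rewrite nor_at //; try lia; apply/idP/idP; last first.
  move=> /eqP aE; apply/hasPn => i _; apply/negP; rewrite W => /andP[/and4P[qi /eqP li /eqP pi ne]].
  rewrite (ridx_dec qi) li pi IH // => /eqP zE; move: ne.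
  by rewrite zE aE eqxx.
apply: contraR => ne; apply/hasP.
exists (ridx (2 * t + 2) p (nbcode t p)).
  have -> : 2 * t.+1 + 1 = (2 * t + 2).+1 by lia.
  by rewrite mem_iota add0n /= ridx_lt.
have [El' Ep' Ez'] := ridxK (2 * t + 2) pP' (nbcode_lt t p).
rewrite W El' Ep' Ez' IH ?nbcode_lt // !eqxx /= andbT eq_sym ne andbT.
by rewrite /ridx -addnA leq_addr.
Qed.

Lemma ca_states t p a : t <= T -> p < ca_P -> a < m -> nory (ridx (2 * t + 1) p a) = (a == cv t p).
Proof.
elim: t p a => [|t IH] p a tT pP' am; first exact: state0.
apply: stateS => // p' u p'P uZ; apply: nbhd => // p2 a2 h1 h2.
by apply: IH => //; apply: ltnW.
Qed.

Lemma ca_output : nor q ca_wire y (ca_N - 1) = good (cv T T).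
Proof.
have qN : q <= ca_N - 1 by rewrite /ca_N; lia.
rewrite nor_gate // -[RHS]negbK; congr (~~ _); apply/hasP/idP => [[i _]|ng].
  rewrite /ca_wire eqxx => /andP[/and5P[qi /eqP li /eqP pi zi ng]].
  by rewrite (ridx_dec qi) li pi -/(nory _) ca_states // => /eqP <-.
have [El Ep Ez] := ridxK (2 * T + 1) TP (cvZ T T).
exists (ridx (2 * T + 1) T (cv T T)).
  by rewrite mem_iota add0n /= ridx_N //; lia.
rewrite /ca_wire eqxx El Ep Ez !eqxx cv_lt ng /= -/(nory _) ca_states ?cv_lt // eqxx !andbT.
by rewrite /ridx -addnA leq_addr.
Qed.

End CA.

(** * Simulation of a Turing machine *)

Section Simulation.
Variables (M : machine) (T : nat).
Hypothesis noq : forall s : state M, query s = None.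

Local Notation msym := (symbol (work_symbol M)).
Local Notation ntape := ('I_(extra_tapes M).+3).

(** Is the cell scanned, the state, and the contents of the tapes relative to their heads. *)
Definition cell : finType := (bool * state M * {ffun ntape -> msym})%type.

(** A halted machine idles: the default action writes back the scanned symbols without moving, in
    accordance with [run]. *)
Definition cell_act (h : cell) : state M * (ntape -> msym * direction) :=
  odflt (h.1.2, fun i => (h.2 i, Stay)) (delta h.1.2 h.2).

(** Several heads move independently, so the tapes are shifted instead and all heads stay at cell
    [T]. Each cell must then know the action, which is why cell [T] is among its neighbours. *)
Definition cell_step (h l c r : cell) : cell :=
  let a := cell_act h in
  let w i (b : cell) := if b.1.1 then (a.2 i).1 else b.2 i in
  (c.1.1, a.1, [ffun i => match (a.2 i).2 with
     | GoLeft => w i l | Stay => w i c | GoRight => w i r end]).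

Definition tcell (t : tape (work_symbol M)) (p : nat) : msym :=
  if T <= p then nth None t.2 (p - T) else nth None t.1 (T - p.+1).

Definition cell_at (c : config M) (p : nat) : cell :=
  (p == T, c.1, [ffun i => tcell (c.2 i) p]).

Lemma tcell_move a d t p : 0 < p ->
  tcell (write_move a d t) p =
  (let w p := if p == T then a else tcell t p in
   match d with GoLeft => w (p - 1) | Stay => w p | GoRight => w p.+1 end).
Proof.
case: t => l r p0; rewrite /write_move /tcell; case: d => /=.
- case: (leqP T p) => Tp.
    case: (eqVneq (p - 1) T) => [e|ne]; first by rewrite (_ : p - T = 1) //=; lia.
    case: (ltngtP T p) Tp ne => // [lt _ ne|-> _ ne].
      rewrite ifT; last lia.
      case E : (p - T) => [|[|k]]; try lia.
      by rewrite /= nth_behead; congr nth; lia.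
    by rewrite subnn ifN /=; [rewrite -nth0; congr nth; lia|lia].
  rewrite ifN; last lia.
  by rewrite ifN; [rewrite nth_behead; congr nth; lia|lia].
- case: (ltngtP T p) => [lt|lt|->]; [|by []|by rewrite subnn].
  by case E : (p - T) => [|k]; [lia|rewrite /= nth_behead].
- case: (leqP T p) => Tp.
    by rewrite ifN; [rewrite ifT; [rewrite nth_behead subSn|lia]|lia].
  case: (eqVneq p.+1 T) => [<-|ne]; first by rewrite subnn.
  by rewrite ifN; [case E : (T - p.+1) => [|k]; [lia|rewrite /=; congr nth; lia]|lia].
Qed.

Lemma cell_at_step (c : config M) p : 0 < p ->
  cell_at (odflt c (step id c)) p =
  cell_step (cell_at c T) (cell_at c (p - 1)) (cell_at c p) (cell_at c p.+1).
Proof.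
move=> p0; rewrite /step noq /cell_step /cell_act /=.
have -> : [ffun i => tcell (c.2 i) T] = [ffun i => scanned (c.2 i)].
  by apply/ffunP => i; rewrite !ffunE /tcell leqnn subnn /scanned nth0.
case: (delta _ _) => [[s act]|] /=.
  congr (_, _, _); apply/ffunP => i; rewrite !ffunE /= tcell_move //.
congr (_, _, _); apply/ffunP => i; rewrite !ffunE /=; case: eqP => // ->.
by rewrite /tcell leqnn subnn /scanned nth0.
Qed.

(** Initial contents of the input tape around cell [p] for the input [pair_word x w], an input
    bit [b] being substituted for the bits of [w]: 0 for blank, 1 and 2 for the bits. *)
Definition in_code (q : nat) (x : seq bool) (b : bool) (p : nat) : nat :=
  if p < T then 0 else
  if p - T < 2 * size x then
    (if (p - T) %% 2 == 0 then 2 else if nth false x ((p - T) %/ 2) then 2 else 1)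
  else if p - T == 2 * size x then 1
  else if p - T < 2 * size x + 1 + q then (if b then 2 else 1) else 0.

Definition in_sym (c : nat) : msym := nth None [:: None; bit _ false; bit _ true] c.

Definition init_cell (fl : bool) (c : nat) : cell :=
  (fl, start M, [ffun i : ntape => if i == input_tape M then in_sym c else None]).

Definition rank (a : cell) : nat := enum_rank a.
Definition unrank (k : nat) : cell := nth (init_cell false 0) (enum cell) k.

Lemma rankK a : unrank (rank a) = a.
Proof. by rewrite /unrank /rank nth_enum_rank. Qed.

(** Initial states are looked up in a table fixed by the machine, which makes them definable from
    the input. *)
Definition init_table : seq nat :=
  [seq rank (init_cell fl c) | fl <- [:: false; true], c <- iota 0 3].

Definition init_rank q x b p :=
  nth 0 init_table ((if p == T then 3 else 0) + in_code q x b p).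

Lemma in_code_lt q x b p : in_code q x b p < 3.
Proof. by rewrite /in_code; do 7?case: ifP. Qed.

Lemma init_rankE q x b p : init_rank q x b p = rank (init_cell (p == T) (in_code q x b p)).
Proof.
rewrite /init_rank; move: (in_code_lt q x b p); move: (in_code q x b p) => c.
by case: (p == T); case: c => [|[|[|]]].
Qed.

Definition step_rank (m z : nat) : nat :=
  rank (cell_step (unrank (dig0 m z)) (unrank (dig1 m z)) (unrank (dig2 m z)) (unrank (dig3 m z))).

Definition good_rank (k : nat) : bool :=
  (unrank k).2 (output_tape M) == Some (inl true).

Lemma nth_pair_word x w j : nth None (map (@bit (work_symbol M)) (pair_word x w)) j =
  in_sym (if j < 2 * size x then
    (if j %% 2 == 0 then 2 else if nth false x (j %/ 2) then 2 else 1)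
  else if j == 2 * size x then 1
  else if j < 2 * size x + 1 + size w then (if nth false w (j - (2 * size x + 1)) then 2 else 1) else 0).
Proof.
rewrite /pair_word; elim: x j => [|b x IH] j /=.
  rewrite ?muln0 ?ltn0; case: j => [|j] //=; rewrite ?subn1 /= ?add0n ?add1n ?ltnS.
  case: ltnP => jw; last by rewrite nth_default // size_map.
  by rewrite (nth_map false) //; case: (nth _ _ _).
have -> : 2 * (size x).+1 = (2 * size x).+2 by lia.
case: j => [|[|j]] //=; first by case: b.
rewrite IH.
have -> : (j.+2 < (2 * size x).+2) = (j < 2 * size x) by lia.
have -> : j.+2 %% 2 = j %% 2 by rewrite -addn2 modnDr.
have -> : j.+2 %/ 2 = (j %/ 2).+1 by rewrite -addn2 divnDr // addn1.
rewrite !eqSS; have -> : j.+2 - ((2 * size x).+2 + 1) = j - (2 * size x + 1) by lia.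
by have -> : (j.+2 < (2 * size x).+2 + 1 + size w) = (j < 2 * size x + 1 + size w) by lia.
Qed.

Let m := #|cell|.

Lemma rank_lt a : rank a < m. Proof. exact: ltn_ord. Qed.

(** The cells at the border are not updated faithfully, and the error advances by one cell per step.
    At time [T] the centre is still correct, and it contains the output bit. *)
Lemma simulation x (w : seq bool) (q := size w) t p : t <= p -> p + t <= 2 * T -> t <= T ->
  cv q T (T + 2 * size x + 1) m (init_rank q x false) (init_rank q x true) (step_rank m)
    (nth false w) t p =
  rank (cell_at (run id t (init_config M (pair_word x w))) p).
Proof.
elim: t p => [|t IH] p tp pt tT.
  rewrite [LHS]/= -[RHS]/(rank (cell_at (init_config M (pair_word x w)) p)).
  have -> : cell_at (init_config M (pair_word x w)) p =
      init_cell (p == T) (in_code q x (nth false w (p - (T + 2 * size x + 1))) p).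
    congr (_, _, _); apply/ffunP => i; rewrite !ffunE /tcell /=.
    case: eqP => _; last by case: ifP; rewrite nth_nil.
    rewrite /in_code /= leqNgt; case: ltnP => Tp /=; first by rewrite nth_nil.
    by rewrite nth_pair_word; have -> : p - T - (2 * size x + 1) = p - (T + 2 * size x + 1) by lia.
  case: ifP => [/and3P[h1 h2 ->]|h]; rewrite init_rankE //.
  congr rank; congr init_cell; case wn : (nth false w _) => //; move: h; rewrite wn andbT => h.
  rewrite /in_code; case: ltnP => // h1; case: ltnP => // h2; case: eqP => // h3.
  by have -> : (p - T < 2 * size x + 1 + q) = false by lia.
have nx : ca_next T p = p.+1 by rewrite /ca_next ifT //; lia.
rewrite [LHS]/= nx !IH; try lia.
have m0 : 0 < m by apply: leq_ltn_trans (rank_lt (init_cell false 0)).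
rewrite /step_rank; set c := run id t _.
have [|||||-> -> -> ->] := @code_dig m _ (rank (cell_at c T)) (rank (cell_at c (p - 1)))
  (rank (cell_at c p)) (rank (cell_at c p.+1)) => //; try exact: rank_lt.
rewrite !rankK -cell_at_step; last lia.
by rewrite /c /run iterS.
Qed.

Lemma simulation_output V x (w : seq bool) (q := size w) :
  step id (run id T (init_config M (pair_word x w))) = None ->
  word_of_tape ((run id T (init_config M (pair_word x w))).2 (output_tape M)) = [:: V] ->
  nor q (ca_wire q T (T + 2 * size x + 1) m (init_rank q x false) (init_rank q x true) (step_rank m)
     good_rank) (nth false w) (ca_N q T m - 1) = V.
Proof.
move=> _ E; rewrite ca_output; first last.
- by move=> z; exact: rank_lt.
- by move=> p; rewrite init_rankE rank_lt.
- by move=> p; rewrite init_rankE rank_lt.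
- by apply: leq_ltn_trans (rank_lt (init_cell false 0)).
rewrite simulation //; try lia.
rewrite /good_rank rankK /cell_at ffunE /tcell leqnn subnn.
move: E; rewrite /word_of_tape; case: (_ (output_tape M)) => l [|[[b|]|] r] //= [<- _].
by case: b.
Qed.

End Simulation.

(** * Hardness *)

Lemma Db_true : Db (fun _ _ => true). Proof. exact: (Df_cst 1). Qed.
Lemma Db_false : Db (fun _ _ => false). Proof. exact: (Df_cst 0). Qed.

Ltac df_step :=
  first
  [ assumption
  | match goal with
    | |- Df (fun x s => nth 0 s ?k) => exact: (Df_var k)
    | |- Df (fun x s => size x) => exact: Df_len
    | |- Df (fun x s => _ + _) => apply: Df_add
    | |- Df (fun x s => _ - _) => apply: Df_sub
    | |- Df (fun x s => _ * _) => apply: Df_mul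
    | |- Df (fun x s => _ %/ _) => apply: Df_div
    | |- Df (fun x s => _ %% _) => apply: Df_mod
    | |- Df (fun x s => if _ then _ else _) => apply: Df_if
    | |- Df (fun x s => nth 0 ?L _) => apply: Df_nth
    | |- Df (fun x s => poly_bound ?p _) => apply: Df_poly
    | |- Df (fun x s => ?c) => exact: (Df_cst c)
    | |- Db (fun x s => true) => exact: Db_true
    | |- Db (fun x s => false) => exact: Db_false
    | |- Db (fun x s => ~~ _) => apply: Db_neg
    | |- Db (fun x s => _ && _) => apply: Db_and
    | |- Db (fun x s => _ || _) => apply: Db_or
    | |- Db (fun x s => _ ==> _) => apply: Db_imp
    | |- Db (fun x s => if _ then _ else _) => apply: Db_if
    | |- Db (fun x s => _ < _) => apply: Db_ltn
    | |- Db (fun x s => _ <= _) => apply: Db_leq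
    | |- Db (fun x s => @eq_op bool _ _) => apply: Db_eqb
    | |- Db (fun x s => _ == _) => first [apply: Db_eqn | apply: Db_eqb]
    | |- Db (fun x s => nth false x _) => apply: Db_bit
    | |- Db (fun x s => nth false ?L _) => apply: Db_nth
    end ].

Ltac df := repeat df_step.

Section Definable.
Variables (lit : seq bool -> nat -> nat -> bool -> bool) (nv nc : seq bool -> nat).
Hypotheses (Dnv : Df (fun x s => nv x)) (Dnc : Df (fun x s => nc x)).
Hypothesis Dlit : forall b, Db (fun x s => lit x (nth 0 s 0) (nth 0 s 1) b).

(** For the reduction it remains to define the literals from clause number, variable number and
    sign. *)
Lemma Dg_encode_matrix : Dg (fun x s => encode (matrix_instance (nv x) (nc x) (lit x))).
Proof.
apply: Dg_eq; last by move=> x s; rewrite encode_matrix.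
apply: Dg_cat; first exact: Dg_unary.
apply: Dg_cat; first exact: Dg_unary.
have Dl b : Db (fun x s => lit x (nth 0 s 1) (nth 0 s 0) b).
  by apply: (Db_app2 (f := fun x c v => lit x c v b)) => //; [exact: (Df_var 1)|exact: (Df_var 0)].
apply: Dg_cat.
  apply: (Dg_for (g := fun x s => flatten [seq [:: lit x (nth 0 s 0) v true; lit x (nth 0 s 0) v false] | v <- iota 0 (nv x)])) => //.
  apply: (Dg_for (g := fun x s => [:: lit x (nth 0 s 1) (nth 0 s 0) true; lit x (nth 0 s 1) (nth 0 s 0) false])) => //.
  exact: (Dg_cat (Dg_emit (Dl true)) (Dg_emit (Dl false))).
apply: Dg_cat.
  apply: (Dg_for (g := fun x s => [seq occ (lit x) (nth 0 s 0) v | v <- iota 0 (nv x)])) => //.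
  apply: (Dg_map (b := fun x s => occ (lit x) (nth 0 s 1) (nth 0 s 0))) => //.
  exact: Db_or.
apply: Dg_cat.
  apply: (Dg_for (g := fun x s => true :: unary (nth 0 s 0))) => //.
  exact: (Dg_cat (Dg_emit Db_true) (Dg_unary (Df_var 0))).
apply: (Dg_for (g := fun x s => false :: unary (nv x - (nth 0 s 0).+1))) => //.
apply: (Dg_cat (Dg_emit Db_false)); apply: Dg_unary.
by apply: (Df_eq (g := fun x s => nv x - (1 + nth 0 s 0))) => //; df.
Qed.

End Definable.

Lemma size_binary n k : n < 2 ^ k -> size (binary n) <= k.
Proof.
rewrite /binary; suff H f : forall n k, n < 2 ^ k -> size (binary_rec f n) <= k by exact: H.
elim: f => [|f IH] {}n {}k //; case: n => [|n] //; case: k => [|k] //.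
rewrite expnS => h /=; rewrite ltnS; apply: IH; lia.
Qed.

Lemma size_pair_word x y : size (pair_word x y) = 2 * size x + 1 + size y.
Proof.
rewrite /pair_word size_cat /=.
have -> : size (flatten [seq [:: true; b] | b <- x]) = 2 * size x; last lia.
by elim: x => //= b r ->; lia.
Qed.

Theorem count_hard (R : realType) : sharpP_hard (count_linked_planar_3SAT R).
Proof.
move=> g [V [pq [[M [pT [noq HM]]] gE]]].
pose q (x : seq bool) := poly_bound pq (size x).
pose T (x : seq bool) := poly_bound pT (2 * size x + 1 + q x).
pose m := #|cell M|.
pose wire (x : seq bool) := ca_wire (q x) (T x) (T x + 2 * size x + 1) m
  (init_rank M (T x) (q x) x false) (init_rank M (T x) (q x) x true) (step_rank M m) (@good_rank M).
pose N (x : seq bool) := ca_N (q x) (T x) m.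
pose I (x : seq bool) := nor_instance (q x) (N x) (wire x).
have m0 : 0 < m by apply/card_gt0P; exists (init_cell M false 0).
have N2 x : 2 <= N x.
  have : 0 < ca_Z m by rewrite /ca_Z !muln_gt0 m0.
  by rewrite /N /ca_N /ca_P; nia.
have qN x : q x < N x.
  have : 0 < ca_Z m by rewrite /ca_Z !muln_gt0 m0.
  by rewrite /N /ca_N /ca_P; nia.
have IL x : linked_planar_3SAT R (I x) by exact: nor_instance_linked.
have cnt x : count_linked_planar_3SAT R (encode (I x)) = g x.
  rewrite count_linked_planar_3SAT_encode // nb_satisfying_nor // gE.
  apply: eq_card => w; rewrite !inE.
  have sw : size w = q x by rewrite size_tuple.
  have sz : size (pair_word x w) = 2 * size x + 1 + q x.
    by rewrite size_pair_word sw.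
  have [h1 h2] := HM (pair_word x w); rewrite sz -/(T x) in h1 h2.
  have := @simulation_output M (T x) noq _ x w h1 h2.
  by rewrite sw -/(wire x) -subn1 => ->.
have Dq : Df (fun x s => q x) by rewrite /q; df.
have DT : Df (fun x s => T x) by rewrite /T; df.
have DN : Df (fun x s => N x) by rewrite /N /ca_N /ca_P /ca_Z; df.
have Dz k : Df (fun x s => ca_z (q x) m (nth 0 s k)) by rewrite /ca_z /ca_Z; df.
have Dp k : Df (fun x s => ca_p (q x) (T x) m (nth 0 s k)) by rewrite /ca_p /ca_P /ca_Z; df.
have Dl k : Df (fun x s => ca_l (q x) (T x) m (nth 0 s k)) by rewrite /ca_l /ca_P /ca_Z; df.
(* The number [m] depends on the machine only, so the transition function is a fixed finite table;
   the guard gives it a value past its end. *)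
have Dstep f : Df f -> Df (fun x s => if f x s < ca_Z m then step_rank M m (f x s) else 0).
  move=> Hf; pose L := [seq step_rank M m z | z <- iota 0 (ca_Z m)].
  apply: Df_eq (Df_nth L Hf) _ => x s; case: ltnP => h.
    by rewrite (nth_map 0) ?size_iota // nth_iota.
  by rewrite nth_default // size_map size_iota.
have Dgood f : Df f -> Db (fun x s => (f x s < m) && good_rank M (f x s)).
  move=> Hf; pose L := [seq @good_rank M z | z <- iota 0 m].
  apply: Db_eq (Db_nth L Hf) _ => x s; case: ltnP => h.
    by rewrite (nth_map 0) ?size_iota // nth_iota.
  by rewrite nth_default // size_map size_iota.
have Dini b f : Df f -> Df (fun x s => init_rank M (T x) (q x) x b (f x s)).
  move=> Hf; rewrite /init_rank; apply: Df_nth; apply: Df_add; first by df.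
  by rewrite /in_code; case: b; df.
have Dwire : Db (fun x s => wire x (nth 0 s 0) (nth 0 s 1)).
  (* The wires with guarded tables. The guards change nothing, because [ca_z] is always below
     [ca_Z m] and [good_rank] is consulted only below [m]. *)
  pose W2 (x : seq bool) (s : seq nat) := let g := nth 0 s 0 in let i := nth 0 s 1 in
    let ci := ca_z (q x) m i in let cg := ca_z (q x) m g in
    let pi := ca_p (q x) (T x) m i in let pg := ca_p (q x) (T x) m g in
    let li := ca_l (q x) (T x) m i in let lg := ca_l (q x) (T x) m g in
  if g == N x - 1 then
    [&& q x <= i, li == 2 * T x + 1, pi == T x, ci < m & ~~ ((ci < m) && @good_rank M ci)]
  else if lg == 0 then (i < q x) && (T x + 2 * size x + 1 + i == pg)
  else if lg == 1 then
    if i < q x then (T x + 2 * size x + 1 + i == pg) && (cg != init_rank M (T x) (q x) x true pg)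
    else [&& li == 0, pi == pg, ci == 0 & cg != init_rank M (T x) (q x) x false pg]
  else if lg %% 2 == 1 then
    [&& q x <= i, li + 1 == lg, pi == pg & (if ci < ca_Z m then step_rank M m ci else 0) != cg]
  else [&& q x <= i, li + 1 == lg, ci < m &
    [|| (pi == T x) && (ci != dig0 m cg), (pi == pg - 1) && (ci != dig1 m cg),
        (pi == pg) && (ci != dig2 m cg) |
        (pi == (if pg < 2 * T x then 1 + pg else pg)) && (ci != dig3 m cg)]].
  apply: (Db_eq (g := W2)).
    have Dz0 := Dz 0; have Dz1 := Dz 1; have Dp0 := Dp 0; have Dp1 := Dp 1.
    have Dl0 := Dl 0; have Dl1 := Dl 1.
    have Dg1 := Dgood _ Dz1; have Ds1 := Dstep _ Dz1.
    have Di0 := Dini false _ Dp0; have Di1 := Dini true _ Dp0.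
    by rewrite /W2 /dig0 /dig1 /dig2 /dig3; cbv zeta; df.
  move=> x s; rewrite /W2 /wire /ca_wire -/(N x) /ca_next; cbv zeta.
  set ci := ca_z _ _ (nth 0 s 1).
  have cZ : ci < ca_Z m by rewrite ltn_mod /ca_Z !muln_gt0 m0.
  by rewrite cZ; case: (ci < m).
have DW : Df (fun x s => nor_W (N x)) by rewrite /nor_W; df.
have DG : Df (fun x s => nor_G (N x)) by rewrite /nor_G /nor_W; df.
have Dmode f h : Df f -> Df h -> Df (fun x s => nor_mode (q x) (wire x) (f x s) (h x s)).
  move=> Hf Hh; have Hw := Db_app2 Dwire Hf Hh.
  by rewrite /nor_mode; df.
have Dop f : Df f -> Df (fun x s => nor_op (q x) (N x) (wire x) (f x s)).
  move=> Hf; rewrite /nor_op /cell_op; cbv zeta.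
  have Hm : Df (fun x s => nor_mode (q x) (wire x) (f x s %/ nor_W (N x) %/ (6 * N x))
      ((f x s %/ nor_W (N x) %/ 6) %% N x)) by apply: Dmode; df.
  by df.
have Dini2 f : Df f -> Df (fun x s => nor_ini (q x) (f x s)) by move=> Hf; rewrite /nor_ini; df.
pose lit (x : seq bool) := glit (nor_W (N x)) (nor_G (N x)) (nor_op (q x) (N x) (wire x)) (nor_ini (q x)).
have Dlit b : Db (fun x s => lit x (nth 0 s 0) (nth 0 s 1) b).
  pose gg (x : seq bool) (s : seq nat) := (nth 0 s 0 - nor_W (N x)) %/ 3.
  have Hg : Df gg by rewrite /gg; df.
  have Ho := Dop _ Hg; have Hi := Dini2 _ (Df_var 0).
  have Hal := Db_nth [:: false; false; false; false; true; false; true; false; true; false; true] Ho.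
  have Hbe := Db_nth [:: false; false; false; false; false; true; true; false; false; true; true] Ho.
  have Hoo := Db_nth [:: false; false; false; false; false; false; false; true; true; true; true] Ho.
  have Hpred : Df (fun x s => (nor_W (N x) + nor_G (N x)).-1).
    by apply: (Df_eq (g := fun x s => nor_W (N x) + nor_G (N x) - 1)); [df|move=> x s; rewrite subn1].
  rewrite /lit /glit /gate_lit /init_lit /copy_lit /and_lit /copy_src /g_al /g_be /g_o -/(gg _ _).
  by case: b; df.
have DI : Dg (fun x s => encode (I x)).
  apply: (@Dg_encode_matrix lit (fun x => gnv (nor_W (N x)) (nor_G (N x)))
     (fun x => gnc (nor_W (N x)) (nor_G (N x)))) => //; first by rewrite /gnv; df.
  by rewrite /gnc; df.
(* The answer is the number of accepted witnesses, at most [2 ^ q x], so it has polynomially many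
   bits. *)
have B x : size (binary (count_linked_planar_3SAT R (encode (I x)))) <= poly_bound pq (size x) + 1.
  rewrite cnt; apply: size_binary; rewrite gE addn1.
  apply: (@leq_ltn_trans (2 ^ q x)); last by rewrite ltn_exp2l.
  by apply: leq_trans (max_card _) _; rewrite card_tuple card_bool.
have pD : polyb (fun n => poly_bound pq n + 1) by polyb_tac.
have [M' [p' H]] := Dg_in_FP_oracle (O := fun w => binary (count_linked_planar_3SAT R w)) DI pD B.
by exists M', p' => x; have := H x; rewrite cnt.
Qed.

(** * Parsing encoded instances *)

Lemma count_ltn k n : k <= n -> count (fun i => i < k) (iota 0 n) = k.
Proof.
move=> kn; rewrite -(subnKC kn) iotaD count_cat add0n.
rewrite (@eq_in_count _ _ predT) => [|i]; last by rewrite mem_iota add0n /= => ->.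
rewrite count_predT size_iota (@eq_in_count _ _ pred0) ?count_pred0 ?addn0 // => i.
by rewrite mem_iota => /andP[ki _]; rewrite ltnNge ki.
Qed.

Lemma flatten_iota (T : Type) (F : nat -> T) m w :
  flatten [seq [seq F (c * w + j) | j <- iota 0 w] | c <- iota 0 m] = [seq F i | i <- iota 0 (m * w)].
Proof.
elim: m => [|m IH] //; rewrite -[m.+1]addn1 iotaD map_cat flatten_cat IH mulnDl mul1n iotaD map_cat.
by congr cat; rewrite /= cats0 !add0n -[in RHS](addn0 (m * w)) iotaDl -map_comp.
Qed.

Lemma map_nth_iota_drop (x : seq bool) o k : o + k <= size x ->
  [seq nth false x (o + i) | i <- iota 0 k] = take k (drop o x).
Proof.
move=> h; apply: (@eq_from_nth _ false); rewrite size_map size_iota ?size_takel // ?size_drop; try lia.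
by move=> i ik; rewrite (nth_map 0) ?size_iota // nth_iota // nth_take // nth_drop.
Qed.

Section Parse.
Variables (n : nat) (B : nat -> bool).

(** The length of the run of ones that starts at [o], written as a count so as to be definable. *)
Definition lead o := count (fun i => all (fun j => B (o + j)) (iota 0 (1 + i))) (iota 0 n).
Definition p_nv := lead 0.
Definition p_nc := lead (p_nv + 1).
Definition p_o1 := p_nv + p_nc + 2.
Definition p_o2 := p_o1 + p_nc * (p_nv * 2).
Definition p_o3 := p_o2 + p_nc * p_nv.
(** The positive literal comes first because [true] comes first in the enumeration of booleans. *)
Definition p_lit c v b := B (p_o1 + (c * (p_nv * 2) + (v * 2 + (if b then 0 else 1)))).
Definition p_edge c v := B (p_o2 + (c * p_nv + v)).
(** The encoding of the cycle is cut into runs of ones ended by a zero, [p_r k] being the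
    length of run [k]: a clause [c] gives the run [c + 1], a variable [v] the runs [0] and [v]. *)
Definition p_zeros i := count (fun j => ~~ B (p_o3 + j)) (iota 0 i).
Definition p_r k := count (fun i => B (p_o3 + i) && (p_zeros i == k)) (iota 0 (n - p_o3)).
Definition p_c k := p_r k - 1.
Definition p_v l := p_r (p_nc + (l * 2 + 1)).

Definition valid_clauses :=
  [&& all (fun c => all (fun c' => (c == c') || has (fun v => (p_lit c v true != p_lit c' v true) ||
        (p_lit c v false != p_lit c' v false)) (iota 0 p_nv)) (iota 0 p_nc)) (iota 0 p_nc),
      all (fun c => count (fun v => p_lit c v true || p_lit c v false) (iota 0 p_nv) <= 3) (iota 0 p_nc) &
      all (fun c => all (fun v => p_edge c v == (p_lit c v true || p_lit c v false)) (iota 0 p_nv))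
        (iota 0 p_nc)].

Definition valid_cycle :=
  [&& all (fun k => (0 < p_r k) && (p_r k <= p_nc)) (iota 0 p_nc),
      all (fun k => all (fun k' => (k == k') || (p_r k != p_r k')) (iota 0 p_nc)) (iota 0 p_nc),
      all (fun l => (p_r (p_nc + l * 2) == 0) && (p_v l < p_nv)) (iota 0 p_nv) &
      all (fun l => all (fun l' => (l == l') || (p_v l != p_v l')) (iota 0 p_nv)) (iota 0 p_nv)].

(** Edges whose positions increase on both sides of the cycle cross pairwise. *)
Definition valid_planar :=
  all (fun k1 => all (fun k2 => all (fun k3 => all (fun l1 => all (fun l2 => all (fun l3 =>
    ~~ [&& k1 < k2, k2 < k3, l1 < l2, l2 < l3, p_edge (p_c k1) (p_v l1),
           p_edge (p_c k2) (p_v l2) & p_edge (p_c k3) (p_v l3)])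
    (iota 0 p_nv)) (iota 0 p_nv)) (iota 0 p_nv)) (iota 0 p_nc)) (iota 0 p_nc)) (iota 0 p_nc).

(** The final zero makes the last block a concatenation of unary words, and counting zeros gives
    their number. *)
Definition valid := [&& p_o3 < n, ~~ B (n - 1), 2 < p_nc + p_nv,
  p_zeros (n - p_o3) == p_nc + p_nv * 2, valid_clauses, valid_cycle & valid_planar].

Definition p_sat (y : nat -> bool) :=
  all (fun c => has (fun v => (p_lit c v true && y v) || (p_lit c v false && ~~ y v)) (iota 0 p_nv))
    (iota 0 p_nc) && all (fun j => (p_nv <= j) ==> ~~ y j) (iota 0 n).

(** The condition counted by [lead] can only change from true to false as [i] grows, so it holds on
    an initial segment. *)
Lemma lead_spec o : exists k, [/\ lead o = k, k <= n, forall j, j < k -> B (o + j) &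
  k < n -> ~~ B (o + k)].
Proof.
pose P i := all (fun j => B (o + j)) (iota 0 (1 + i)).
have PS i : P i.+1 = P i && B (o + i.+1).
  by rewrite /P addnS -addn1 iotaD all_cat /= andbT add0n add1n.
have [k [kn H]] : exists k, k <= n /\ forall i, i < n -> P i = (i < k).
  elim: (n) => [|m [k [km H]]]; first by exists 0.
  case: (ltnP k m) => kl.
    have Pm : P m = false.
      case: m H kl {km} => // m H kl; rewrite PS H // ltnNge.
      by move: kl; rewrite ltnS => ->.
    exists k; split; first exact: leqW.
    move=> i; rewrite ltnS leq_eqVlt => /orP[/eqP ->|/H //].
    by rewrite Pm ltnNge (ltnW kl).
  have {km kl} kE : k = m by apply/eqP; rewrite eqn_leq km kl.
  subst m; case: (boolP (P k)) => Pk.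
    exists k.+1; split=> // i; rewrite ltnS leq_eqVlt => /orP[/eqP ->|ik]; first by rewrite Pk eqxx.
    by rewrite H // ik orbT.
  exists k; split=> // i; rewrite ltnS leq_eqVlt => /orP[/eqP ->|ik]; last by rewrite H.
  by rewrite (negbTE Pk) ltnn.
exists k; split=> //.
- rewrite /lead -[RHS](count_ltn kn); apply: eq_in_count => i; rewrite mem_iota add0n /=.
  exact: H.
- move=> j jk; have : P j by rewrite H // (leq_trans jk).
  by move=> /allP; apply; rewrite mem_iota add0n /= add1n.
- move=> kn'; have : ~~ P k by rewrite H // ltnn.
  apply: contra => Bk; apply/allP => j; rewrite mem_iota add0n /= add1n ltnS leq_eqVlt => /orP[/eqP -> //|jk].
  have : P j by rewrite H // (ltn_trans jk).
  by move=> /allP; apply; rewrite mem_iota add0n /= add1n.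
Qed.

End Parse.

Lemma lead_unary (pre suf : seq bool) k (x := pre ++ unary k ++ suf) :
  lead (size x) (nth false x) (size pre) = k.
Proof.
have bit_lt j : j < k -> nth false x (size pre + j).
  move=> jk; rewrite /x nth_cat ltnNge leq_addr /= addKn nth_cat /unary size_cat size_nseq /=.
  by rewrite ltn_addr // nth_cat size_nseq jk nth_nseq jk.
have bit_k : nth false x (size pre + k) = false.
  rewrite /x nth_cat ltnNge leq_addr /= addKn nth_cat /unary size_cat size_nseq /= addn1 ltnSn.
  by rewrite nth_cat size_nseq ltnn subnn.
have kx : k < size x by rewrite /x !size_cat size_nseq /=; lia.
have [k' [-> k'n H1 H2]] := lead_spec (size x) (nth false x) (size pre).
case: (ltngtP k k') => // h.
  by have := H1 k h; rewrite bit_k.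
by have := H2 (ltn_trans h kx); rewrite bit_lt.
Qed.

Section Runs.
Implicit Type rs : seq nat.

Definition runs rs := flatten [seq unary r | r <- rs].
Definition zeros_before (F : seq bool) i := count (fun j => ~~ nth false F j) (iota 0 i).

Lemma runs_exists (F : seq bool) : ~~ last false F -> exists rs, F = runs rs.
Proof.
elim: F => [|b F IH] /=; first by exists [::].
case: b => /= h.
  case: F IH h => //= c F IH h; have [[|r rs]] := IH h; first by [].
  by move=> E; exists (r.+1 :: rs); rewrite E.
have [|rs ->] := IH; last by exists (0 :: rs).
by case: F h {IH}.
Qed.

Lemma zeros_before_cons a (F : seq bool) i :
  (i <= a -> zeros_before (unary a ++ F) i = 0) /\
  zeros_before (unary a ++ F) (a.+1 + i) = (zeros_before F i).+1.
Proof.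
have low j : j < a -> nth false (unary a ++ F) j.
  by move=> ja; rewrite nth_cat size_cat size_nseq ltn_addr // nth_cat size_nseq ja nth_nseq ja.
have mid : nth false (unary a ++ F) a = false.
  by rewrite nth_cat size_cat size_nseq /= addn1 ltnSn nth_cat size_nseq ltnn subnn.
have high j : nth false (unary a ++ F) (a.+1 + j) = nth false F j.
  by rewrite nth_cat size_cat size_nseq /= addn1 ltnNge leq_addr /= addKn.
have zlow k : k <= a -> zeros_before (unary a ++ F) k = 0.
  move=> ka; rewrite /zeros_before (@eq_in_count _ _ pred0) ?count_pred0 // => j.
  by rewrite mem_iota add0n /= => jk; rewrite low // (leq_trans jk).
split; first exact: zlow.
rewrite /zeros_before iotaD count_cat -[a.+1]addn1 iotaD count_cat /= mid add0n /=.
rewrite -/(zeros_before (unary a ++ F) a) zlow // addn0 add0n addn1 -[in iota a.+1 i](addn0 a.+1).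
rewrite iotaDl count_map add1n; congr _.+1; apply: eq_count => j /=.
by rewrite high.
Qed.

Lemma size_runs_count rs : zeros_before (runs rs) (size (runs rs)) = size rs.
Proof.
elim: rs => [|r rs IH] //; rewrite /runs /= -/(runs rs) size_cat.
have -> : size (unary r) = r.+1 by rewrite size_cat size_nseq /= addn1.
by have [_ ->] := zeros_before_cons r (runs rs) (size (runs rs)); rewrite IH.
Qed.

Lemma runs_nth rs k :
  count (fun i => nth false (runs rs) i && (zeros_before (runs rs) i == k)) (iota 0 (size (runs rs)))
    = nth 0 rs k.
Proof.
elim: rs k => [|r rs IH] k; first by rewrite nth_nil.
have E : runs (r :: rs) = unary r ++ runs rs by [].
rewrite E size_cat.
have -> : size (unary r) = r.+1 by rewrite size_cat size_nseq /= addn1.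
have low j : j < r -> nth false (unary r ++ runs rs) j.
  by move=> ja; rewrite nth_cat size_cat size_nseq ltn_addr // nth_cat size_nseq ja nth_nseq ja.
have mid : nth false (unary r ++ runs rs) r = false.
  by rewrite nth_cat size_cat size_nseq /= addn1 ltnSn nth_cat size_nseq ltnn subnn.
have high j : nth false (unary r ++ runs rs) (r.+1 + j) = nth false (runs rs) j.
  by rewrite nth_cat size_cat size_nseq /= addn1 ltnNge leq_addr /= addKn.
have -> : iota 0 (r.+1 + size (runs rs)) = iota 0 r ++ r :: iota r.+1 (size (runs rs)).
  by rewrite addSnnS iotaD add0n.
rewrite count_cat /= mid /= add0n.
rewrite (@eq_in_count _ _ (fun=> 0 == k)) => [|i]; last first.
  rewrite mem_iota add0n /= => ir; rewrite low //=.
  by have [-> //] := zeros_before_cons r (runs rs) i; apply: ltnW.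
rewrite -[in iota r.+1 _](addn0 r.+1) iotaDl count_map.
rewrite (@eq_count _ _ (fun i => nth false (runs rs) i && ((zeros_before (runs rs) i).+1 == k))); last first.
  by move=> i /=; rewrite high; have [_ ->] := zeros_before_cons r (runs rs) i.
case: k => [|k].
  rewrite (@eq_count _ _ predT) // count_predT size_iota (@eq_count _ _ pred0) ?count_pred0 ?addn0 // => i.
  by rewrite andbF.
rewrite (@eq_count _ _ pred0) // count_pred0 add0n -[RHS]/(nth 0 rs k) -IH.
by apply: eq_count => i; rewrite eqSS.
Qed.

End Runs.

(** Stated for arbitrary blocks, so that it applies both to the encoding of an instance and to a
    valid word cut into blocks. *)
Lemma parse_spec a c (m1 m2 : seq bool) rs (x := unary a ++ unary c ++ m1 ++ m2 ++ runs rs) :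
  size m1 = c * (a * 2) -> size m2 = c * a ->
  let n := size x in let B := nth false x in
  [/\ p_nv n B = a, p_nc n B = c,
      (forall i, i < size m1 -> B (p_o1 n B + i) = nth false m1 i) /\
      (forall i, i < size m2 -> B (p_o2 n B + i) = nth false m2 i),
      n = p_o3 n B + size (runs rs) &
      p_zeros n B (n - p_o3 n B) = size rs /\ forall k, p_r n B k = nth 0 rs k].
Proof.
move=> s1 s2 n B.
have nvE : p_nv n B = a by exact: (lead_unary [::] _ a).
have su k : size (unary k) = k.+1 by rewrite size_cat size_nseq addn1.
have ncE : p_nc n B = c.
  rewrite /p_nc nvE addn1 -su.
  exact: (lead_unary (unary a) (m1 ++ m2 ++ runs rs) c).
have o1E : p_o1 n B = a.+1 + c.+1 by rewrite /p_o1 nvE ncE; lia.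
have o2E : p_o2 n B = a.+1 + (c.+1 + size m1) by rewrite /p_o2 o1E nvE ncE s1; lia.
have o3E : p_o3 n B = a.+1 + (c.+1 + (size m1 + size m2)) by rewrite /p_o3 o2E nvE ncE s2; lia.
have skip (u v : seq bool) i : nth false (u ++ v) (size u + i) = nth false v i.
  by rewrite nth_cat ltnNge leq_addr /= addKn.
have B1 i : B (p_o1 n B + i) = nth false (m1 ++ m2 ++ runs rs) i.
  by rewrite o1E -addnA -{1}su /B /x skip -{1}su skip.
have B3 i : B (p_o3 n B + i) = nth false (runs rs) i.
  have -> : p_o3 n B + i = p_o1 n B + (size m1 + (size m2 + i)) by rewrite o3E o1E; lia.
  by rewrite B1 !skip.
have nE : n = p_o3 n B + size (runs rs).
  transitivity (a.+1 + (c.+1 + (size m1 + (size m2 + size (runs rs))))); last by rewrite o3E; lia.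
  by rewrite /n /x; do 2![rewrite size_cat su]; rewrite !size_cat.
split=> //.
- split=> i h; first by rewrite B1 nth_cat h.
  have -> : p_o2 n B + i = p_o1 n B + (size m1 + i) by rewrite o2E o1E; lia.
  by rewrite B1 skip nth_cat h.
have zE i : p_zeros n B i = zeros_before (runs rs) i.
  by apply: eq_count => j; rewrite B3.
have sE : n - p_o3 n B = size (runs rs) by rewrite {1}nE addKn.
split; first by rewrite zE sE size_runs_count.
by move=> k; rewrite -runs_nth /p_r sE; apply: eq_count => i; rewrite B3 zE.
Qed.

(** * Membership *)

Lemma ord_list m (L : seq nat) : all (fun i => i < m) L -> exists cs : seq 'I_m, map val cs = L.
Proof.
elim: L => [|i L IH] /=; first by exists [::].
by move=> /andP[im /IH [cs <-]]; exists (Ordinal im :: cs).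
Qed.

Lemma ord_list_full m (cs : seq 'I_m) : uniq cs -> size cs = m -> forall c, c \in cs.
Proof.
move=> us sz c.
have sub : {subset cs <= enum 'I_m} by move=> i _; rewrite mem_enum.
have le : size (enum 'I_m) <= size cs by rewrite size_enum_ord sz.
by have [_ E] := uniq_min_size us sub le; rewrite E mem_enum.
Qed.

Lemma card_count n (P : pred nat) : #|[set v : 'I_n | P v]%SET| = count P (iota 0 n).
Proof.
have -> : iota 0 n = index_iota 0 n by rewrite /index_iota subn0.
by rewrite -sum1_count -sum1_card big_mkord; apply: eq_bigl => v; rewrite inE.
Qed.

Lemma nth_flatten_pairs (V : Type) (f : V -> nat) v0 (r : seq V) l : l < size r ->
  nth 0 (flatten [seq [:: 0; f v] | v <- r]) (l * 2) = 0 /\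
  nth 0 (flatten [seq [:: 0; f v] | v <- r]) (l * 2 + 1) = f (nth v0 r l).
Proof.
by elim: r l => [//|v r IH] [|l] //= ln; exact: (IH l ln).
Qed.

Lemma size_flatten_pairs (V : Type) (f : V -> nat) (r : seq V) :
  size (flatten [seq [:: 0; f v] | v <- r]) = size r * 2.
Proof. by elim: r => //= v r ->; rewrite mulSn. Qed.

Lemma runs_vertices (phi : cnf) (cs : seq 'I_(nclauses phi)) (vs : seq 'I_(nvars phi)) :
  flatten [seq encode_vertex x | x <- map inl cs ++ map inr vs] =
  runs ([seq (val c).+1 | c <- cs] ++ flatten [seq [:: 0; val v] | v <- vs]).
Proof.
rewrite /runs !map_cat !flatten_cat; congr cat; first by elim: cs => //= c cs ->.
by elim: vs => //= v vs ->.
Qed.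

(** The literals are read in the matrix and the cycle in the run lengths, which list each clause and
    each variable exactly once; encoding the result gives back the word block by block. *)
Lemma valid_instance (R : realType) x (n := size x) (B := nth false x) : valid n B ->
  exists s, linked_planar_3SAT R (@Instance (matrix_cnf (p_nv n B) (p_nc n B) (p_lit n B))
      (incidence_edges _) s) /\
    encode (@Instance (matrix_cnf (p_nv n B) (p_nc n B) (p_lit n B)) (incidence_edges _) s) = x.
Proof.
move=> /and5P[h3n Bn big /eqP zE /and3P[/and3P[V1 V2 V3] /and4P[V4 V5 V6 V7] V8]].
set nv := p_nv n B in big zE V1 V2 V3 V4 V5 V6 V7 V8 *.
set nc := p_nc n B in big zE V1 V2 V3 V4 V5 V6 V7 V8 *.
have inI i k : i < k -> i \in iota 0 k by rewrite mem_iota.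
pose seg o k := [seq B (o + i) | i <- iota 0 k].
have cut o k : o + k <= n -> drop o x = seg o k ++ drop (o + k) x.
  by move=> h; rewrite /seg map_nth_iota_drop // -{1}(cat_take_drop k (drop o x)) drop_drop addnC.
have seg_unary o k : (forall j, j < k -> B (o + j)) -> ~~ B (o + k) -> seg o k.+1 = unary k.
  move=> H1 H2; rewrite /seg -addn1 iotaD map_cat /= add0n (negbTE H2) /unary; congr cat.
  apply: (@eq_from_nth _ false); rewrite size_map size_iota ?size_nseq // => i ik.
  by rewrite (nth_map 0) ?size_iota // nth_iota // nth_nseq ik H1.
have o1E : p_o1 n B = nv + nc + 2 by [].
have o2E : p_o2 n B = p_o1 n B + nc * (nv * 2) by [].
have o3E : p_o3 n B = p_o2 n B + nc * nv by [].
have U1 : seg 0 nv.+1 = unary nv.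
  have [k [kE kn H1 H2]] := lead_spec n B 0; rewrite -/(p_nv n B) -/nv in kE.
  by rewrite kE; apply: seg_unary => //; apply: H2; rewrite -kE; lia.
have U2 : seg nv.+1 nc.+1 = unary nc.
  have [k [kE kn H1 H2]] := lead_spec n B nv.+1.
  have kE' : nc = k by rewrite -kE -addn1.
  by rewrite kE'; apply: seg_unary => //; apply: H2; rewrite -kE'; lia.
pose m1 := seg (p_o1 n B) (nc * (nv * 2)); pose m2 := seg (p_o2 n B) (nc * nv).
have [rs rsE] : exists rs, drop (p_o3 n B) x = runs rs.
  apply: runs_exists; rewrite -nth_last nth_drop size_drop -/n.
  by have -> : p_o3 n B + (n - p_o3 n B).-1 = n - 1 by lia.
have xE : x = unary nv ++ unary nc ++ m1 ++ m2 ++ runs rs.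
  rewrite -{1}(drop0 x) (cut 0 nv.+1) ?U1; last lia.
  rewrite add0n (cut nv.+1 nc.+1) ?U2; last lia.
  have -> : nv.+1 + nc.+1 = p_o1 n B by lia.
  rewrite (cut (p_o1 n B) (nc * (nv * 2))); last lia.
  rewrite -o2E (cut (p_o2 n B) (nc * nv)); last lia.
  by rewrite -o3E rsE.
have [||_ _ _ _ [zs rE]] := @parse_spec nv nc m1 m2 rs; rewrite -?xE.
- by rewrite size_map size_iota.
- by rewrite size_map size_iota.
rewrite -xE -/n -/B in zs rE.
have srs : size rs = nc + nv * 2 by rewrite -zs zE.
have [cs csE] : exists cs : seq 'I_nc, map val cs = [seq p_c n B k | k <- iota 0 nc].
  apply: ord_list; apply/allP => i /mapP[k]; move/(allP V4) => /andP[h1 h2] ->.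
  by rewrite /p_c; lia.
have [vs vsE] : exists vs : seq 'I_nv, map val vs = [seq p_v n B l | l <- iota 0 nv].
  apply: ord_list; apply/allP => i /mapP[l]; move/(allP V6) => /andP[h1 h2] ->.
  exact: h2.
have scs : size cs = nc by rewrite -(size_map val) csE size_map size_iota.
have svs : size vs = nv by rewrite -(size_map val) vsE size_map size_iota.
have ucs : uniq cs.
  rewrite -(map_inj_uniq val_inj) csE map_inj_in_uniq ?iota_uniq // => k k' kI k'I.
  move/(allP V4): (kI) => /andP[a1 _]; move/(allP V4): (k'I) => /andP[a2 _].
  move/(allP V5): kI => /allP/(_ _ k'I); rewrite /p_c => /orP[/eqP //|/eqP ne] e.
  by exfalso; apply: ne; lia.
have uvs : uniq vs.
  rewrite -(map_inj_uniq val_inj) vsE map_inj_in_uniq ?iota_uniq // => k k' kI k'I.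
  by move/(allP V7): kI => /allP/(_ _ k'I) => /orP[/eqP //|/eqP ne] e.
pose phi := matrix_cnf nv nc (p_lit n B).
pose s : seq (vertex phi) := map inl cs ++ map inr vs.
exists s; split; last first.
  rewrite encode_matrix_cycle xE /s runs_vertices; do 2!congr cat; congr cat; last congr cat.
  - rewrite /m1 /seg -flatten_iota; congr flatten; apply: eq_map => c.
    rewrite -[in RHS](flatten_iota (fun j => B (p_o1 n B + (c * (nv * 2) + j))) nv 2).
    by congr flatten; apply: eq_map => v.
  - rewrite /m2 /seg -flatten_iota; congr flatten; apply/eq_in_map => c cI; apply/eq_in_map => v vI.
    by move/(allP V3): cI => /allP/(_ _ vI) /eqP h; rewrite /occ -h.
  - congr runs; rewrite -[RHS](mkseq_nth 0) /mkseq srs iotaD map_cat; congr cat.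
      have -> : [seq (val c).+1 | c <- cs] = [seq i.+1 | i <- map val cs] by rewrite -map_comp.
      rewrite csE -map_comp; apply/eq_in_map => k kI /=; rewrite -rE /p_c.
      by move/(allP V4): kI => /andP[h _]; lia.
    have -> : [seq [:: 0; val v] | v <- vs] = [seq [:: 0; i] | i <- map val vs] by rewrite -map_comp.
    rewrite vsE -map_comp add0n -[in RHS](addn0 nc) iotaDl -map_comp.
    rewrite -[in RHS](flatten_iota (fun j => nth 0 rs (nc + j)) nv 2); congr flatten.
    apply/eq_in_map => l lI /=; rewrite addn0 -!rE.
    by move/(allP V6): lI => /andP[/eqP -> _].
have us : uniq s.
  rewrite /s cat_uniq; apply/and3P; split.
  - by rewrite map_inj_uniq // => a b [].
  - by apply/hasPn => z /mapP[v _ ->]; apply/negP => /mapP[c _].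
  - by rewrite map_inj_uniq // => a b [].
have alls z : z \in s.
  rewrite mem_cat; apply/orP; case: z => z; [left|right]; apply: map_f; exact: ord_list_full.
have ss : size s = nc + nv by rewrite size_cat !size_map scs svs.
have edgeE c v : c < nc -> v < nv -> occ (p_lit n B) c v -> p_edge n B c v.
  by move=> cn vn o; move/(allP V3): (inI _ _ cn) => /allP/(_ _ (inI _ _ vn)) /eqP ->.
split=> //=.
- split=> [c c' /=|c].
    rewrite !ffunE => E; apply: val_inj; apply/eqP.
    move/(allP V1): (inI _ _ (ltn_ord c)) => /allP/(_ _ (inI _ _ (ltn_ord c'))) /orP[//|/hasP[v]].
    rewrite mem_iota add0n => /= vn.
    have F b : p_lit n B c v b = p_lit n B c' v b.
      by move/setP: E => /(_ (Ordinal vn, b)); rewrite !inE.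
    by rewrite !F !eqxx.
  move/(allP V2): (inI _ _ (ltn_ord c)); rewrite -card_count; apply: leq_trans.
  by apply: subset_leq_card; apply/fintype.subsetP => v; rewrite !inE occursE.
- by split=> //; rewrite ss.
- by exists cs, vs.
- apply: linked_planar_draw => //; first by rewrite -/s ss.
  move=> c1 c2 c3 v1 v2 v3; rewrite !inE !occursE /= => h1 h2 h3 k12 k23 l12 l23.
  have idc (c : 'I_nc) : index c cs < nc /\ p_c n B (index c cs) = c.
    have ic : index c cs < nc by rewrite -{2}scs index_mem ord_list_full.
    split=> //; have := congr1 (fun L => nth 0 L (index c cs)) csE.
    rewrite (nth_map c) ?scs // nth_index ?ord_list_full // (nth_map 0) ?size_iota // nth_iota //.
  have idv (v : 'I_nv) : index v vs < nv /\ p_v n B (index v vs) = v.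
    have ic : index v vs < nv by rewrite -{2}svs index_mem ord_list_full.
    split=> //; have := congr1 (fun L => nth 0 L (index v vs)) vsE.
    rewrite (nth_map v) ?svs // nth_index ?ord_list_full // (nth_map 0) ?size_iota // nth_iota //.
  have [[[a1 b1] [a2 b2]] [a3 b3]] := (idc c1, idc c2, idc c3).
  have [[[a4 b4] [a5 b5]] [a6 b6]] := (idv v1, idv v2, idv v3).
  move/allP: V8 => /(_ _ (inI _ _ a1)) /allP/(_ _ (inI _ _ a2)) /allP/(_ _ (inI _ _ a3)).
  move=> /allP/(_ _ (inI _ _ a4)) /allP/(_ _ (inI _ _ a5)) /allP/(_ _ (inI _ _ a6)).
  by rewrite b1 b2 b3 b4 b5 b6 k12 k23 l12 l23 !edgeE.
Qed.

Lemma instance_valid (R : realType) I (x := encode I) :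
  linked_planar_3SAT R I -> valid (size x) (nth false x).
Proof.
move=> [[Cinj C3] eE [s2 us alls] [cs [vs sE]] pl]; rewrite /x {x}.
case: I Cinj C3 eE s2 us alls cs vs sE pl => [[nv nc C] E s] /= Cinj C3 eE s2 us alls cs vs sE pl.
(* Literals out of range are made false, which turns the formula into a matrix formula. *)
pose lit (c v : nat) b := match insub c, insub v with
  | Some c', Some v' => (v', b) \in C (c' : 'I_nc) | _, _ => false end.
have litE (c : 'I_nc) (v : 'I_nv) b : lit c v b = ((v, b) \in C c) by rewrite /lit !valK.
have CE : C = [ffun c : 'I_nc => [set l : literal nv | lit c l.1 l.2]%SET].
  by apply/ffunP => c; rewrite ffunE; apply/setP => -[v b]; rewrite inE litE.
rewrite eE {E eE} in pl *; rewrite sE in us alls s2 pl *.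
have -> : @Instance (Cnf C) (incidence_edges (Cnf C)) (map inl cs ++ map inr vs) =
    @Instance (matrix_cnf nv nc lit) (incidence_edges _) (map inl cs ++ map inr vs).
  by rewrite /matrix_cnf -CE.
rewrite encode_matrix_cycle runs_vertices; set rs := (_ ++ flatten _).
pose w := nv * 2.
(* [G1], and [G2] below, number the matrix entries by a single index, as the parser reads them. *)
pose G1 i := lit (i %/ w) ((i %% w) %/ 2) (i %% 2 == 0).
have G1E c v d : v < nv -> d < 2 -> G1 (c * w + (v * 2 + d)) = lit c v (d == 0).
  move=> vn d2; have lw : v * 2 + d < w by rewrite /w; lia.
  have w0 : 0 < w by lia.
  rewrite /G1 divnMDl // (divn_small lw) addn0 modnMDl (modn_small lw) divnMDl // (divn_small d2) addn0.
  by congr (lit _ _ (_ == _)); rewrite /w mulnA addnA -mulnDl modnMDl modn_small.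
have -> : flatten [seq flatten [seq [:: lit c v true; lit c v false] | v <- iota 0 nv] | c <- iota 0 nc]
    = [seq G1 i | i <- iota 0 (nc * w)].
  rewrite -flatten_iota; congr flatten; apply: eq_map => c.
  rewrite -[in RHS](flatten_iota (fun j => G1 (c * w + j)) nv 2); congr flatten.
  by apply/eq_in_map => v; rewrite mem_iota add0n => /= vn; rewrite !G1E.
pose G2 i := occ lit (i %/ nv) (i %% nv).
have G2E c v : v < nv -> G2 (c * nv + v) = occ lit c v.
  move=> vn; have n0 : 0 < nv by lia.
  by rewrite /G2 divnMDl // (divn_small vn) addn0 modnMDl (modn_small vn).
have -> : flatten [seq [seq occ lit c v | v <- iota 0 nv] | c <- iota 0 nc] =
    [seq G2 i | i <- iota 0 (nc * nv)].
  rewrite -flatten_iota; congr flatten; apply: eq_map => c.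
  by apply/eq_in_map => v; rewrite mem_iota add0n => /= vn; rewrite G2E.
have [||] := @parse_spec nv nc [seq G1 i | i <- iota 0 (nc * w)] [seq G2 i | i <- iota 0 (nc * nv)] rs.
- by rewrite size_map size_iota.
- by rewrite size_map size_iota.
cbv zeta; set x := unary nv ++ _; set n := size x; set B := nth false x.
move=> nvE ncE [B1 B2] nE [zE rE].
have ucs : uniq cs by move: us; rewrite cat_uniq => /and3P[h _ _]; apply: map_uniq h.
have uvs : uniq vs by move: us; rewrite cat_uniq => /and3P[_ _ h]; apply: map_uniq h.
have mcs c : c \in cs.
  have := alls (inl c); rewrite mem_cat => /orP[|/mapP[v _ //]].
  by rewrite mem_map // => a b [].
have mvs v : v \in vs.
  have := alls (inr v); rewrite mem_cat => /orP[/mapP[c _ //]|].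
  by rewrite mem_map // => a b [].
have scs : size cs = nc.
  by rewrite -(card_uniqP ucs) -[RHS]card_ord; apply: eq_card => c; rewrite mcs.
have svs : size vs = nv.
  by rewrite -(card_uniqP uvs) -[RHS]card_ord; apply: eq_card => c; rewrite mvs.
have srs : size rs = nc + nv * 2.
  by rewrite /rs size_cat size_map scs size_flatten_pairs svs.
have cs0 k (c0 : 'I_nc) : k < nc -> p_r n B k = (nth c0 cs k).+1.
  by move=> kn; rewrite rE /rs nth_cat size_map scs kn (nth_map c0) ?scs.
have vs0 l (v0 : 'I_nv) : l < nv -> p_r n B (nc + l * 2) = 0 /\ p_r n B (nc + (l * 2 + 1)) = nth v0 vs l.
  move=> ln; rewrite !rE /rs !nth_cat !size_map scs !ltnNge !leq_addr /= !addKn.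
  by apply: nth_flatten_pairs; rewrite svs.
have plit c v b : c < nc -> v < nv -> p_lit n B c v b = lit c v b.
  move=> cn vn; have d2 : (if b then 0 else 1) < 2 by case: b.
  have lt : c * w + (v * 2 + (if b then 0 else 1)) < nc * w.
    by rewrite /w; have := leq_mul cn (leqnn (nv * 2)); rewrite mulSn; lia.
  rewrite /p_lit nvE B1 ?size_map ?size_iota // (nth_map 0) ?size_iota // nth_iota // add0n G1E //.
  by case: b {d2 lt}.
have pedge c v : c < nc -> v < nv -> p_edge n B c v = occ lit c v.
  move=> cn vn; have lt : c * nv + v < nc * nv.
    by have := leq_mul cn (leqnn nv); rewrite mulSn; lia.
  by rewrite /p_edge nvE B2 ?size_map ?size_iota // (nth_map 0) ?size_iota // nth_iota // add0n G2E.
have rs0 : 2 < size rs by move: s2; rewrite size_cat !size_map scs svs srs; lia.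
have runs0 : 0 < size (runs rs).
  by case: (rs) rs0 => // r r' _; rewrite /runs /= !size_cat /= addn1.
have iotaP k i : i \in iota 0 k -> i < k by rewrite mem_iota.
rewrite /valid /valid_clauses /valid_cycle /valid_planar nvE ncE; apply/and5P; split; last (apply/and3P; split).
- by rewrite {2}nE -[X in X < _]addn0 ltn_add2l.
- have : ~~ last false (runs rs).
    by case/lastP: (rs) rs0 => // r' r _; rewrite /runs map_rcons flatten_rcons last_cat /unary last_cat.
  rewrite -nth_last; suff -> : B (n - 1) = nth false (runs rs) (size (runs rs)).-1 by [].
  have catA4 (a b c d e : seq bool) : a ++ b ++ c ++ d ++ e = (a ++ b ++ c ++ d) ++ e by rewrite -!catA.
  have xs := catA4 (unary nv) (unary nc) [seq G1 i | i <- iota 0 (nc * w)]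
    [seq G2 i | i <- iota 0 (nc * nv)] (runs rs); rewrite -/x in xs.
  set pre := (unary nv ++ _) in xs.
  have nE' : n = size pre + size (runs rs) by rewrite /n xs size_cat.
  rewrite /B xs nth_cat ifN; last by rewrite -leqNgt nE'; lia.
  by congr nth; rewrite nE'; lia.
- by move: s2; rewrite size_cat !size_map scs svs.
- by rewrite zE srs.
- apply/and3P; split.
  + apply/allP => c /iotaP cn; apply/allP => c' /iotaP cn'.
    apply/orP; case: (eqVneq c c') => [//|ne]; first by left.
    right; apply: contraT => /hasPn H; exfalso; move/eqP: ne; apply.
    suff : Ordinal cn = Ordinal cn' by move/(congr1 val).
    apply: Cinj; apply/setP => -[v b]; rewrite -!litE.
    have := H v; rewrite mem_iota add0n ltn_ord => /(_ isT).
    rewrite !plit // negb_or !negbK => /andP[/eqP e1 /eqP e2].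
    by case: b.
  + apply/allP => c /iotaP cn; have := C3 (Ordinal cn); apply: leq_trans.
    rewrite -(card_count nv (fun v => p_lit n B c v true || p_lit n B c v false)).
    apply: subset_leq_card; apply/fintype.subsetP => v; rewrite !inE !plit // => h.
    apply/existsP; move: h => /orP[h|h]; [exists true|exists false]; by rewrite -litE.
  + apply/allP => c /iotaP cn; apply/allP => v /iotaP vn.
    by rewrite pedge // !plit.
- apply/and4P; split.
  + apply/allP => k /iotaP kn; by rewrite (cs0 k (Ordinal kn)) //=.
  + apply/allP => k /iotaP kn; apply/allP => k' /iotaP kn'.
    rewrite !(cs0 _ (Ordinal kn)) // eqSS (inj_eq val_inj) nth_uniq ?scs //.
    by case: eqP.
  + apply/allP => l /iotaP ln; have [h1 h2] := vs0 l (Ordinal ln) ln.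
    by rewrite h1 /p_v ncE h2 ltn_ord.
  + apply/allP => k /iotaP kn; apply/allP => k' /iotaP kn'.
    have [_ h1] := vs0 k (Ordinal kn) kn; have [_ h2] := vs0 k' (Ordinal kn) kn'.
    rewrite /p_v ncE h1 h2 (inj_eq val_inj) nth_uniq ?svs //.
    by case: eqP.
- apply/allP => k1 /iotaP k1n; apply/allP => k2 /iotaP k2n; apply/allP => k3 /iotaP k3n.
  apply/allP => l1 /iotaP l1n; apply/allP => l2 /iotaP l2n; apply/allP => l3 /iotaP l3n.
  apply/negP => /and5P[k12 k23 l12 l23 /and3P[]].
  pose c0 := Ordinal k1n; pose v0 := Ordinal l1n.
  have pc k : k < nc -> p_c n B k = nth c0 cs k by move=> kn; rewrite /p_c (cs0 k c0) // subn1.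
  have pv l : l < nv -> p_v n B l = nth v0 vs l by move=> ln; rewrite /p_v ncE; case: (vs0 l v0 ln).
  rewrite !pc // !pv // !pedge //.
  have occI (c : 'I_nc) (v : 'I_nv) : occ lit c v -> (c, v) \in incidence_edges (Cnf C).
    rewrite inE /= => h; apply/existsP; move: h => /orP[h|h]; [exists true|exists false]; by rewrite -litE.
  move=> /occI e1 /occI e2 /occI e3.
  apply: (linked_planar_cross us alls s2 pl e1 e2 e3); by rewrite !index_uniq ?scs ?svs.
Qed.

(** * The verifier as a definable predicate of the paired word *)

Lemma nth_pair_word_fst x y i : nth false (pair_word x y) (2 * i + 1) = (if i < size x then nth false x i
  else nth false (false :: y) (2 * i + 1 - 2 * size x)).
Proof.
rewrite /pair_word; elim: x i => [|b x IH] i; first by rewrite muln0 subn0.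
case: i => [|i] //; have -> : 2 * i.+1 + 1 = (2 * i + 1).+2 by lia.
apply: (etrans (IH i)).
rewrite -[size (b :: x)]/(size x).+1 -[nth _ (b :: x) _]/(nth false x i) ltnS.
by have -> : (2 * i + 1).+2 - 2 * (size x).+1 = 2 * i + 1 - 2 * size x by lia.
Qed.

Lemma nth_pair_word_snd x y j : nth false (pair_word x y) (2 * size x + 1 + j) = nth false y j.
Proof.
rewrite /pair_word; elim: x => [|b x IH] //.
have -> : 2 * size (b :: x) + 1 + j = (2 * size x + 1 + j).+2 by rewrite /=; lia.
exact: IH.
Qed.

(** Witnesses are as long as the input, so a pair has length three times that of the input, plus
    one. *)
Definition zn (z : seq bool) := (size z - 1) %/ 3.
(** The bits of the first component have odd positions; the guard reproduces the default [false]
    past its end. *)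
Definition zB (z : seq bool) i := (i < zn z) && nth false z (2 * i + 1).
Definition zy (z : seq bool) j := nth false z (2 * zn z + 1 + j).

Lemma zn_pair x y : size y = size x -> zn (pair_word x y) = size x.
Proof. by move=> e; rewrite /zn size_pair_word e; lia. Qed.

Lemma zB_pair x y : size y = size x -> zB (pair_word x y) = nth false x.
Proof.
move=> e; apply/funext => i; rewrite /zB zn_pair // nth_pair_word_fst; case: ltnP => //= h.
by rewrite nth_default.
Qed.

Lemma zy_pair x y : size y = size x -> zy (pair_word x y) = nth false y.
Proof. by move=> e; apply/funext => j; rewrite /zy zn_pair // nth_pair_word_snd. Qed.

Ltac df_var :=
  lazymatch goal with
  | |- Df (fun x s => nth 0 s ?k) => exact: (Df_var k)
  | |- Df (fun x s => nth 0 (behead s) ?k) => exact: (Df_shift (Df_var k))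
  | |- Df (fun x s => nth 0 (behead (behead s)) ?k) => exact: (Df_shift (Df_shift (Df_var k)))
  | |- Df (fun x s => nth 0 (behead (behead (behead s))) ?k) =>
      exact: (Df_shift (Df_shift (Df_shift (Df_var k))))
  | |- Df (fun x s => nth 0 (behead (behead (behead (behead s)))) ?k) =>
      exact: (Df_shift (Df_shift (Df_shift (Df_shift (Df_var k)))))
  | |- Df (fun x s => nth 0 (behead (behead (behead (behead (behead s))))) ?k) =>
      exact: (Df_shift (Df_shift (Df_shift (Df_shift (Df_shift (Df_var k))))))
  | |- Df (fun x s => ?f x (behead s)) => apply: (Df_shift (f := f))
  end.

(** The bound variable becomes entry 0 of the environment, and the outer environment is reached
    through [behead]. *)
Ltac df_quant :=
  lazymatch goal with
  | |- Db (fun x s => all (fun i => @?b x s i) (iota 0 (@?f x s))) =>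
      refine (Db_all (f := f) (b := fun x s => b x (behead s) (nth 0 s 0)) _ _); cbv beta
  | |- Db (fun x s => has (fun i => @?b x s i) (iota 0 (@?f x s))) =>
      refine (Db_has (f := f) (b := fun x s => b x (behead s) (nth 0 s 0)) _ _); cbv beta
  | |- Df (fun x s => count (fun i => @?b x s i) (iota 0 (@?f x s))) =>
      refine (Df_count (f := f) (b := fun x s => b x (behead s) (nth 0 s 0)) _ _); cbv beta
  end.

Lemma Df_zn : Df (fun z s => zn z). Proof. by rewrite /zn; df. Qed.

Lemma Db_zB f : Df f -> Db (fun z s => zB z (f z s)).
Proof. by move=> Hf; have Hn := Df_zn; rewrite /zB; df. Qed.

Lemma Db_zy f : Df f -> Db (fun z s => zy z (f z s)).
Proof. by move=> Hf; have Hn := Df_zn; rewrite /zy; df. Qed.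

Lemma Df_lead f : Df f -> Df (fun z s => lead (zn z) (zB z) (f z s)).
Proof.
move=> Hf; have Hn := Df_zn; rewrite /lead; df_quant => //.
df_quant; first by apply: Df_add; [exact: (Df_cst 1)|df_var].
apply: Db_zB; apply: Df_add; last df_var.
exact: (Df_shift (Df_shift Hf)).
Qed.

Lemma Df_p_nv : Df (fun z s => p_nv (zn z) (zB z)).
Proof. by apply: Df_lead; df. Qed.

Lemma Df_p_nc : Df (fun z s => p_nc (zn z) (zB z)).
Proof. by have H := Df_p_nv; apply: Df_lead; df. Qed.

Lemma Df_p_o1 : Df (fun z s => p_o1 (zn z) (zB z)).
Proof. by have H1 := Df_p_nv; have H2 := Df_p_nc; rewrite /p_o1; df. Qed.

Lemma Df_p_o2 : Df (fun z s => p_o2 (zn z) (zB z)).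
Proof. by have H1 := Df_p_nv; have H2 := Df_p_nc; have H3 := Df_p_o1; rewrite /p_o2; df. Qed.

Lemma Df_p_o3 : Df (fun z s => p_o3 (zn z) (zB z)).
Proof. by have H1 := Df_p_nv; have H2 := Df_p_nc; have H3 := Df_p_o2; rewrite /p_o3; df. Qed.

Lemma Db_p_lit b f g : Df f -> Df g -> Db (fun z s => p_lit (zn z) (zB z) (f z s) (g z s) b).
Proof.
move=> Hf Hg; have H1 := Df_p_nv; have H2 := Df_p_o1.
by rewrite /p_lit; apply: Db_zB; case: b; df.
Qed.

Lemma Db_p_edge f g : Df f -> Df g -> Db (fun z s => p_edge (zn z) (zB z) (f z s) (g z s)).
Proof.
move=> Hf Hg; have H1 := Df_p_nv; have H2 := Df_p_o2.
by rewrite /p_edge; apply: Db_zB; df.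
Qed.

Lemma Df_p_zeros f : Df f -> Df (fun z s => p_zeros (zn z) (zB z) (f z s)).
Proof.
move=> Hf; have H1 := Df_p_o3; rewrite /p_zeros; df_quant => //.
by apply: Db_neg; apply: Db_zB; apply: Df_add => //; df_var.
Qed.

Lemma Df_p_r f : Df f -> Df (fun z s => p_r (zn z) (zB z) (f z s)).
Proof.
move=> Hf; have H1 := Df_p_o3; have Hn := Df_zn; rewrite /p_r; df_quant; first by df.
apply: Db_and; first by apply: Db_zB; apply: Df_add => //; df_var.
by apply: Db_eqn; [apply: Df_p_zeros; df_var|exact: (Df_shift Hf)].
Qed.

Lemma Df_p_c f : Df f -> Df (fun z s => p_c (zn z) (zB z) (f z s)).
Proof. by move=> /Df_p_r H; rewrite /p_c; df. Qed.

Lemma Df_p_v f : Df f -> Df (fun z s => p_v (zn z) (zB z) (f z s)).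
Proof. by move=> Hf; have H := Df_p_nc; rewrite /p_v; apply: Df_p_r; df. Qed.

Ltac df_parse :=
  first
  [ exact: Df_zn | exact: Df_p_nv | exact: Df_p_nc | exact: Df_p_o3 | df_var | df_quant
  | lazymatch goal with
    | |- Db (fun z s => zB _ _) => apply: Db_zB
    | |- Db (fun z s => zy _ _) => apply: Db_zy
    | |- Db (fun z s => p_lit _ _ _ _ _) => apply: Db_p_lit
    | |- Db (fun z s => p_edge _ _ _ _) => apply: Db_p_edge
    | |- Df (fun z s => p_zeros _ _ _) => apply: Df_p_zeros
    | |- Df (fun z s => p_r _ _ _) => apply: Df_p_r
    | |- Df (fun z s => p_c _ _ _) => apply: Df_p_c
    | |- Df (fun z s => p_v _ _ _) => apply: Df_p_v
    end
  | df_step ].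

Lemma Db_valid_clauses : Db (fun z s => valid_clauses (zn z) (zB z)).
Proof. by rewrite /valid_clauses; repeat df_parse. Qed.

Lemma Db_valid_cycle : Db (fun z s => valid_cycle (zn z) (zB z)).
Proof. by rewrite /valid_cycle; repeat df_parse. Qed.

Lemma Db_valid_planar : Db (fun z s => valid_planar (zn z) (zB z)).
Proof. by rewrite /valid_planar; repeat df_parse. Qed.

Lemma Db_valid : Db (fun z s => valid (zn z) (zB z)).
Proof.
have H1 := Db_valid_clauses; have H2 := Db_valid_cycle; have H3 := Db_valid_planar.
by rewrite /valid; repeat first [assumption | df_parse].
Qed.

Lemma Db_p_sat : Db (fun z s => p_sat (zn z) (zB z) (zy z)).
Proof. by rewrite /p_sat; repeat df_parse. Qed.

Lemma p_sat_msat n B (a : nat -> bool) : p_sat n B a =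
  all (msat (p_nv n B) (p_lit n B) a) (iota 0 (p_nc n B)) &&
  all (fun j => (p_nv n B <= j) ==> ~~ a j) (iota 0 n).
Proof.
rewrite /p_sat; congr andb; apply: eq_all => c; apply: eq_has => v.
by case: (a v); rewrite ?andbT ?andbF ?orbF.
Qed.

Lemma card_p_sat n (B : nat -> bool) : p_o3 n B < n ->
  #|[set y : n.-tuple bool | p_sat n B (nth false y)]%SET| =
  nb_satisfying (matrix_cnf (p_nv n B) (p_nc n B) (p_lit n B)).
Proof.
set nv := p_nv n B; set nc := p_nc n B => o3.
(* The word contains the number of variables in unary, so a witness of its length has room for an
   assignment. *)
have nvn : nv < n by apply: leq_ltn_trans o3; rewrite /p_o3 /p_o2 /p_o1 -/nv -/nc; lia.
pose h (a : {ffun 'I_nv -> bool}) : n.-tuple bool :=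
  [tuple (if insub (val i) is Some j then a j else false) | i < n].
have hE a j : nth false (h a) j = (if insub j is Some j' then a j' else false).
  case: (ltnP j n) => jn; first by rewrite -(tnth_nth false (h a) (Ordinal jn)) tnth_mktuple.
  by rewrite nth_default ?size_tuple // insubN // -leqNgt (leq_trans (ltnW nvn)).
have hE1 a (j : 'I_nv) : nth false (h a) j = a j by rewrite hE valK.
have h_inj : injective h.
  by move=> a a' e; apply/ffunP => j; rewrite -!hE1 e.
rewrite /nb_satisfying -(card_imset _ h_inj); apply: eq_card => y.
apply/idP/imsetP; rewrite inE p_sat_msat -/nv -/nc.
- move=> /andP[s1 /allP s2]; pose a : {ffun 'I_nv -> bool} := [ffun j : 'I_nv => nth false y j].
  exists a; first by rewrite inE (@satisfies_matrix nv nc _ a (nth false y)) // => i; rewrite ffunE.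
  apply: eq_from_tnth => i; rewrite !(tnth_nth false) hE.
  case: insubP => [j _ <-|]; first by rewrite ffunE.
  rewrite -leqNgt => ni; have := s2 i; rewrite mem_iota add0n ltn_ord ni => /(_ isT) /=.
  by move/negbTE.
- move=> [a]; rewrite inE => sa ->; apply/andP; split.
    by rewrite -(@satisfies_matrix nv nc _ a) // => i; rewrite hE1.
  apply/allP => j _; apply/implyP => nj; rewrite hE insubN //.
  by rewrite -leqNgt.
Qed.

Theorem count_in_sharpP (R : realType) : in_sharpP (count_linked_planar_3SAT R).
Proof.
exists (fun z => valid (zn z) (zB z) && p_sat (zn z) (zB z) (zy z)), 'X%R; split.
  exact: (Dg_in_FP (Dg_emit (Db_and Db_valid Db_p_sat))).
move=> x; have -> : poly_bound 'X%R (size x) = size x by rewrite /poly_bound hornerX.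
have E (y : (size x).-tuple bool) : let z := pair_word x y in
    valid (zn z) (zB z) && p_sat (zn z) (zB z) (zy z) =
    valid (size x) (nth false x) && p_sat (size x) (nth false x) (nth false y).
  by cbv zeta; rewrite zB_pair ?size_tuple // zy_pair ?size_tuple // zn_pair ?size_tuple.
(* Validity does not depend on the witness: an invalid word has none, in accordance with its count
   0. *)
case: (boolP (valid (size x) (nth false x))) => vx.
  have [s [I1 I2]] := valid_instance R vx.
  rewrite -{1}I2 count_linked_planar_3SAT_encode //= -card_p_sat; last by case/andP: vx.
  by apply: eq_card => y; rewrite !inE E vx.
rewrite eq_card0 => [|y]; last by rewrite !inE E (negbTE vx).
rewrite /count_linked_planar_3SAT; case: pselect => // -[I [IL Ix]].
by exfalso; move/negP: vx; apply; rewrite -Ix; exact: instance_valid IL.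
Qed.

Theorem theorem3 (R : realType) :
  sharpP_complete (count_linked_planar_3SAT R).
Proof. by split; [exact: count_in_sharpP|exact: count_hard]. Qed.
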